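(* Let $M\ge N\ge K\ge 2$. Let $F:(\mathbb{R}^M,0)\to(\mathbb{R}^N,0)$ be a tame analytic map germ with $\mathrm{Disc}\,F=\{0\}$, and let $G:(\mathbb{R}^N,0)\to(\mathbb{R}^K,0)$ be an analytic map germ with $\{0\}\subseteq \mathrm{Sing}\,G\subseteq V_G$. Then the composition $H=G\circ F$ is tame if and only if $$\overline{F(M(H)\setminus \mathrm{Sing}\,H)}\cap \mathrm{Sing}\,G\subseteq\{0\}$$ as set germs at the origin.
   Context: All analytic map germs are non-constant; a germ and its representatives are denoted by the same symbol, and all sets are considered as germs at the origin. For a map germ $F:(\mathbb{R}^M,0)\to(\mathbb{R}^N,0)$, put $V_F=F^{-1}(0)$ and let $\mathrm{Sing}\,F$ be the set of points $x$ where the Jacobian matrix $\mathrm{d}F(x)$ does not have maximal rank (rank less than the target dimension $N$, i.e. $F$ is not a submersion at $x$). $\mathrm{Disc}\,F=F(\mathrm{Sing}\,F)$. The condition $\mathrm{Disc}\,F=\{0\}$ (isolated critical value at the origin) means $\mathrm{Sing}\,F\subseteq V_F$. Let $\rho_E(x)=\|x\|^2$. The Milnor set of $F$ is $M(F)=\mathrm{Sing}(F,\rho_E)$, the set of points where $(F,\rho_E)$ is not a submersion to $\mathbb{R}^{N+1}$; in particular $\mathrm{Sing}\,F\subseteq M(F)$. $F$ is tame if $\overline{M(F)\setminus V_F}\cap V_F\subseteq\{0\}$ as set germs at the origin. The same notation is used for $G$ and $H$. In forming images under $F$, $M(H)$ stands for $M(H)\cap\bar B_\epsilon$, where $\bar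 B_\epsilon$ is the closed ball of radius $\epsilon$ about the origin of $\mathbb{R}^M$ and $\epsilon>0$ is arbitrary but small enough. *)

(* Defs.v *)
From HB Require Import structures.
From mathcomp Require Import all_boot all_order all_algebra.
From mathcomp Require Import all_classical all_reals all_analysis.

Set Implicit Arguments.
Unset Strict Implicit.
Unset Printing Implicit Defensive.

Import Order.TTheory GRing.Theory Num.Theory.
Import numFieldNormedType.Exports.

Local Open Scope classical_set_scope.
Local Open Scope ring_scope.

(* A map germ (R^m, 0) -> (R^n, 0) is represented by a total function on row
   vectors; only its values near 0 are ever constrained. *)

Definition monomial (R : realType) (m : nat) (k : {ffun 'I_m -> nat})
  (v : 'rV[R]_m) : R := \prod_(i < m) v 0 i ^+ k i.

(* f is the sum of an absolutely convergent power series in the m variables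
   near a. By absolute convergence the order of summation is irrelevant; the
   sum is computed here along the boxes of multi-indices [0, d)^m. *)
Definition analytic_at (R : realType) (m : nat) (f : 'rV[R]_m -> R)
    (a : 'rV[R]_m) : Prop :=
  exists c : {ffun 'I_m -> nat} -> R, \forall x \near a,
    summable [set: {ffun 'I_m -> nat}]
      (fun k => (c k * monomial k (x - a))%:E) /\
    (fun d : nat => \sum_(k : {ffun 'I_m -> 'I_d})
       (let k' := [ffun i => nat_of_ord (k i)] in
        c k' * monomial k' (x - a))) @ \oo --> f x.

Definition analytic_germ (R : realType) (m n : nat)
    (F : 'rV[R]_m -> 'rV[R]_n) : Prop :=
  [/\ F 0 = 0,
      forall j, \forall a \near (0 : 'rV[R]_m), analytic_at (fun x => F x 0 j) a
    & ~ (\forall x \near (0 : 'rV[R]_m), F x = F 0)].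

(* Inclusion of set germs at the origin. *)
Definition germ_subset (R : realType) (m : nat) (A B : set 'rV[R]_m) : Prop :=
  \forall x \near (0 : 'rV[R]_m), A x -> B x.

Definition zero_locus (R : realType) (m n : nat)
  (F : 'rV[R]_m -> 'rV[R]_n) : set 'rV[R]_m := F @^-1` [set 0].

(* 'J F x is the m x n matrix acting on row vectors from the right, i.e. the
   transpose of the usual Jacobian matrix. *)
Definition Sing (R : realType) (m n : nat)
    (F : 'rV[R]_m -> 'rV[R]_n) : set 'rV[R]_m :=
  [set x | (\rank ('J F x) < n)%N].

(* Disc F = {0}, where Disc F = F(Sing F), in the form "F vanishes on Sing F near
   0"; Sing F may be empty as a germ. *)
Definition isolated_critical_value (R : realType) (m n : nat)
    (F : 'rV[R]_m -> 'rV[R]_n) : Prop :=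
  germ_subset (Sing F) (zero_locus F).

(* The squared Euclidean norm; `|x| is the sup norm on 'rV[R]_m. *)
Definition rhoE (R : realType) (m : nat) (x : 'rV[R]_m) : R :=
  \sum_(i < m) x 0 i ^+ 2.

Definition closed_eball (R : realType) (m : nat) (e : R) : set 'rV[R]_m :=
  [set x | rhoE x <= e ^+ 2].

Definition milnor_set (R : realType) (m n : nat)
    (F : 'rV[R]_m -> 'rV[R]_n) : set 'rV[R]_m :=
  Sing (fun x => row_mx (F x) (rhoE x)%:M : 'rV[R]_(n + 1)).

Definition tame (R : realType) (m n : nat)
    (F : 'rV[R]_m -> 'rV[R]_n) : Prop :=
  germ_subset
    (closure (milnor_set F `\` zero_locus F) `&` zero_locus F) [set 0].

(* Main.v *)
(* Everything but one fact is elementary. Near 0 the set Sing H is the preimage of Sing G,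
   and M(H) \ Sing H is contained in M(F); a point of the closure of M(H) \ V_H in V_H is
   therefore controlled by the tameness of F on V_F, by the closure condition over
   Sing G \ {0}, and elsewhere by the fact that the squared norm has no critical point on
   V_H \ Sing H near 0. The converse uses compactness of the small closed ball and the same
   fact.

   The curve selection lemma, the usual source of that fact, is avoided. If such critical
   points accumulated at 0, take an ultrafilter U on them that converges to 0: the analytic
   germs vanishing along U form a prime ideal P. A vector field v with v(P) in P kills the
   components of H modulo P, hence also the squared norm, whose gradient is a combination of
   those of the components. But a quotient of germs killed modulo P by all such v is constant
   modulo P, and a constant squared norm is 0 along U. The last claim is proved by induction
   on the number of variables: if P = 0 by the identity theorem, and otherwise by Weierstrass
   division, which makes the germs modulo P algebraic over the germs in fewer variables;
   vector fields lift along this extension and kill the ratios of the coefficients of a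
   minimal equation of the quotient, which is thus a root of a real polynomial. *)

From HB Require Import structures.
From mathcomp Require Import finmap.
Require Import Defs.
From mathcomp Require Import all_boot all_order all_algebra.
From mathcomp Require Import all_classical all_reals all_analysis.
From mathcomp Require Import ring lra zify.
Set Implicit Arguments.
Unset Strict Implicit.
Unset Printing Implicit Defensive.
Import Order.TTheory GRing.Theory Num.Theory.
Import numFieldNormedType.Exports.
Local Open Scope classical_set_scope.
Local Open Scope ring_scope.

(** * Unordered sums *)

(** The claim on constants concerns a quotient [a / b] rather than a single germ because the
    inductive step applies it to ratios of coefficients of a minimal equation; these coefficients
    are germs in one variable fewer, but their ratios need not be germs. No fraction field is
    formed. Denominators are cleared throughout: in the homogeneous form of an algebraic equation,
    in pseudo-division, and in the lifted vector field, which is scaled by the derivative of the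
    minimal equation of the first coordinate. That factor does not vanish along [U], by minimality
    and characteristic zero, so it can be cancelled modulo a prime ideal.

    The ideal itself is never manipulated: what is used is that [U] contains either the zero set of
    a germ or its complement. Passing to fewer variables is pushing [U] forward along the
    projection.

    Power series are measured by a weighted norm of their coefficients: Weierstrass division is a
    contraction of ratio 1/4 for it, and a bound at the corner of a polydisc controls the series on
    the whole polydisc. *)

Section UnorderedSums.
Context {R : realType}.

(** Convergence along the net of finite subsets: reindexing, summing over pairs and padding by zeros
    need no enumeration of [I]. *)
Definition sum_to (I : choiceType) (a : I -> R) (s : R) : Prop :=
  forall e : R, 0 < e -> exists J0 : {fset I}, forall J : {fset I},
    (J0 `<=` J)%fset -> `|\sum_(i <- J) a i - s| <= e.

Definition abs_bounded (I : choiceType) (a : I -> R) (C : R) : Prop :=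
  forall J : {fset I}, \sum_(i <- J) `|a i| <= C.

Lemma le0_eps (x : R) : (forall e, 0 < e -> x <= e) -> x <= 0.
Proof.
move=> h; apply/ler_addgt0Pr => e e0.
by rewrite add0r; exact: h.
Qed.

Lemma sum_to_unique (I : choiceType) (a : I -> R) s t :
  sum_to a s -> sum_to a t -> s = t.
Proof.
move=> hs ht; apply/eqP; rewrite -subr_eq0 -normr_le0.
apply: le0_eps => e e0; have e20 : 0 < e / 2 by lra.
have [J hJ] := hs _ e20; have [K hK] := ht _ e20.
have := hJ _ (fsubsetUl J K); have := hK _ (fsubsetUr J K).
set z := \sum_(i <- _) _ => h1 h2.
have -> : s - t = (z - t) - (z - s) by ring.
apply: (le_trans (ler_normB _ _)); lra.
Qed.

Lemma eq_sum_to (I : choiceType) (a b : I -> R) s t :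
  a =1 b -> s = t -> sum_to a s -> sum_to b t.
Proof. by move=> /funext -> ->. Qed.

Lemma sum_toD (I : choiceType) (a b : I -> R) s t :
  sum_to a s -> sum_to b t -> sum_to (fun i => a i + b i) (s + t).
Proof.
move=> hs ht e e0; have e20 : 0 < e / 2 by lra.
have [J hJ] := hs _ e20; have [K hK] := ht _ e20.
exists (J `|` K)%fset => L; rewrite fsubUset => /andP[JL KL].
have h1 := hJ _ JL; have h2 := hK _ KL; rewrite big_split /=.
have -> (x y : R) : x + y - (s + t) = (x - s) + (y - t) by ring.
apply: (le_trans (ler_normD _ _)); lra.
Qed.

Lemma sum_toZ (I : choiceType) (a : I -> R) s c :
  sum_to a s -> sum_to (fun i => c * a i) (c * s).
Proof.
move=> hs e e0; have c0 : 0 < `|c| + 1 by rewrite ltr_wpDl.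
have [J hJ] := hs (e / (`|c| + 1)) (divr_gt0 e0 c0).
exists J => K /hJ; rewrite -mulr_sumr -mulrBr normrM ler_pdivlMr // => h.
apply: le_trans h; rewrite mulrC; apply: ler_wpM2l => //; lra.
Qed.

Lemma sum_to0 (I : choiceType) : sum_to (fun _ : I => 0) (0 : R).
Proof. by move=> e e0; exists fset0 => J _; rewrite big1 // subr0 normr0 ltW. Qed.

Lemma sum_to_big (I : choiceType) (K : Type) (r : seq K) (a : K -> I -> R)
    (s : K -> R) :
  (forall k, sum_to (a k) (s k)) ->
  sum_to (fun i => \sum_(k <- r) a k i) (\sum_(k <- r) s k).
Proof.
move=> h; elim: r => [|k r IH].
  by apply: eq_sum_to (@sum_to0 I); [move=> i|]; rewrite big_nil.
by apply: eq_sum_to (sum_toD (h k) IH); [move=> i|]; rewrite big_cons.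
Qed.

Lemma sum_to_le (I : choiceType) (a : I -> R) s C :
  abs_bounded a C -> sum_to a s -> `|s| <= C.
Proof.
move=> hb hs; apply/ler_addgt0Pr => e e0; have [J hJ] := hs _ e0.
have := hJ _ (fsubset_refl J) => h.
have -> : s = \sum_(i <- J) a i - (\sum_(i <- J) a i - s) by ring.
apply: (le_trans (ler_normB _ _)); apply: lerD => //.
by apply: (le_trans (ler_norm_sum _ _ _)); exact: hb.
Qed.

Lemma abs_bounded_le (I : choiceType) (a b : I -> R) C :
  (forall i, `|b i| <= `|a i|) -> abs_bounded a C -> abs_bounded b C.
Proof. by move=> h ha J; apply: le_trans (ha J); apply: ler_sum. Qed.

Lemma abs_boundedW (I : choiceType) (a : I -> R) C D :
  C <= D -> abs_bounded a C -> abs_bounded a D.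
Proof. by move=> h ha J; apply: le_trans (ha J) h. Qed.

Lemma abs_boundedZ (I : choiceType) (a : I -> R) C c :
  abs_bounded a C -> abs_bounded (fun i => c * a i) (`|c| * C).
Proof.
move=> h J; under eq_bigr do rewrite normrM.
by rewrite -mulr_sumr; apply: ler_wpM2l.
Qed.

Lemma abs_bounded_ge0 (I : choiceType) (a : I -> R) C : abs_bounded a C -> 0 <= C.
Proof. by move=> /(_ fset0); rewrite big_seq_fset0. Qed.

Lemma ler_sum_fset (I : choiceType) (a : I -> R) (J K : {fset I}) :
  (forall i, 0 <= a i) -> (J `<=` K)%fset ->
  \sum_(i <- J) a i <= \sum_(i <- K) a i.
Proof.
move=> a0 JK; rewrite [leRHS](big_fsetID _ (mem J)) /=.
have -> : [fset x in K | x \in J]%fset = J.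
  apply/fsetP => x; rewrite !inE /=; case: (boolP (x \in J)) => h; last by rewrite andbF.
  by rewrite (fsubsetP JK).
by rewrite lerDl; apply: sumr_ge0.
Qed.

Lemma abs_bounded_nonneg_sum (I : choiceType) (a : I -> R) C :
  (forall i, 0 <= a i) -> abs_bounded a C -> exists s, sum_to a s.
Proof.
move=> a0 ha; pose S := [set \sum_(i <- J) a i | J in [set: {fset I}]].
have hS : has_sup S.
  split; first by exists (\sum_(i <- fset0) a i), fset0.
  exists C => _ [J _ <-]; apply: le_trans (ha J).
  by apply: ler_sum => i _; exact: ler_norm.
exists (sup S) => e e0; have [_ [J _ <-] hJ] := sup_adherent e0 hS.
exists J => K JK; rewrite ler_norml.
have h1 := ler_sum_fset a0 JK.
have h2 : \sum_(i <- K) a i <= sup S by apply: (ub_le_sup hS.2); exists K.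
by apply/andP; split; lra.
Qed.

(** [a] is the difference of the nonnegative families [|a i| + a i] and [|a i|], each summed by the
    supremum of its finite sums. *)
Lemma abs_bounded_sum (I : choiceType) (a : I -> R) C :
  abs_bounded a C -> exists s, sum_to a s.
Proof.
move=> ha.
have [s1 h1] : exists s, sum_to (fun i => `|a i|) s.
  apply: abs_bounded_nonneg_sum => //; apply: (abs_bounded_le _ ha) => i.
  by rewrite normr_id.
have [s2 h2] : exists s, sum_to (fun i => `|a i| + a i) s.
  apply: (@abs_bounded_nonneg_sum _ _ (C + C)) => [i|J].
    by rewrite -[X in _ <= _ + X]opprK subr_ge0 -normrN ler_norm.
  apply: (@le_trans _ _ (\sum_(i <- J) (`|a i| + `|a i|))).
    by apply: ler_sum => i _; apply: (le_trans (ler_normD _ _)); rewrite normr_id.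
  by rewrite big_split /=; apply: lerD.
exists (s2 + -1 * s1); apply: eq_sum_to (sum_toD h2 (sum_toZ (-1) h1)) => //.
by move=> i /=; ring.
Qed.

Lemma sum_fset_prod (I J : choiceType) (a : I * J -> R) (A : {fset I})
    (B : {fset J}) :
  \sum_(p <- (A `*` B)%fset) a p = \sum_(i <- A) \sum_(j <- B) a (i, j).
Proof.
rewrite -big_allpairs; apply: perm_big; apply: uniq_perm.
- exact: fset_uniq.
- by apply: allpairs_uniq; rewrite ?fset_uniq // => -[x y] [z t] _ _ /= [-> ->].
- move=> [x y]; rewrite in_fsetM /=; apply/idP/allpairsP => [/andP[h1 h2]|].
    by exists (x, y).
  by case=> -[x' y'] /= [h1 h2 [-> ->]]; rewrite h1.
Qed.

Lemma abs_bounded_prod (I J : choiceType) (a : I * J -> R) (D : I -> R) C :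
  (forall i, abs_bounded (fun j => a (i, j)) (D i)) -> abs_bounded D C ->
  abs_bounded a C.
Proof.
move=> ha hD S.
pose A := [fset p.1 | p in S]%fset; pose B := [fset p.2 | p in S]%fset.
apply: (@le_trans _ _ (\sum_(p <- (A `*` B)%fset) `|a p|)).
  apply: ler_sum_fset => [//|]; apply/fsubsetP => p pS; rewrite in_fsetM.
  by apply/andP; split; apply: in_imfset.
rewrite sum_fset_prod; apply: le_trans (hD A); apply: ler_sum => i _.
by apply: le_trans (ha i B) _; exact: ler_norm.
Qed.

(** Fubini. The total [u] exists by absolute boundedness; on a large enough rectangle of indices the
    finite sum is close to both [u] and [t]. *)
Lemma sum_to_prod (I J : choiceType) (a : I * J -> R) (s : I -> R) (t C : R) :
  abs_bounded a C -> (forall i, sum_to (fun j => a (i, j)) (s i)) ->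
  sum_to s t -> sum_to a t.
Proof.
move=> ha hs ht; have [u hu] := abs_bounded_sum ha.
suff -> : t = u by [].
apply/eqP; rewrite -subr_eq0 -normr_le0; apply: le0_eps => e e0.
have e30 : 0 < e / 3 by lra.
have [S0 hS0] := hu _ e30; have [I0 hI0] := ht _ e30.
pose I1 := (I0 `|` [fset p.1 | p in S0])%fset.
(* The tolerance [e / 3] is shared among the rows of [I1]; the added 1 keeps the divisor
   positive. *)
pose n : R := (size (I1 : seq I))%:R + 1.
have n0 : 0 < n by rewrite ltr_wpDl.
have /choice[K hK] i := hs i _ (divr_gt0 e30 n0).
pose B := (\bigcup_(i <- I1) K i `|` [fset p.2 | p in S0])%fset.
have KB i : i \in I1 -> (K i `<=` B)%fset.
  move=> iI; apply: fsubset_trans (fsubsetUl _ _).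
  by apply: (bigfcup_sup (P := predT) _ iI isT).
have S0B : (S0 `<=` I1 `*` B)%fset.
  apply/fsubsetP => p pS; rewrite in_fsetM !inE /=.
  by apply/andP; split; apply/orP; right; apply: in_imfset.
have h1 := hS0 _ S0B; have h2 := hI0 _ (fsubsetUl I0 _ : (I0 `<=` I1)%fset).
have h3 : `|\sum_(p <- (I1 `*` B)%fset) a p - \sum_(i <- I1) s i| <= e / 3.
  rewrite sum_fset_prod -sumrB; apply: (le_trans (ler_norm_sum _ _ _)).
  apply: (@le_trans _ _ (\sum_(i <- I1) (e / 3) / n)).
    rewrite big_seq [leRHS]big_seq; apply: ler_sum => i iI.
    exact/hK/KB.
  rewrite big_const_seq count_predT iter_addr_0 -(mulr_natr (e / 3 / n)) mulrAC ler_pdivrMr //.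
  by apply: ler_wpM2l; [lra | rewrite /n; lra].
move: h1 h2 h3; set x := \sum_(p <- _) _; set y := \sum_(i <- _) _ => h1 h2 h3.
have -> : t - u = (x - u) - (x - y) - (y - t) by ring.
apply: (le_trans (ler_normB _ _)).
have := ler_normB (x - u) (x - y); lra.
Qed.

Lemma sum_fset_enum (I : finType) (a : I -> R) :
  \sum_(i <- [fset i in enum I]%fset) a i = \sum_i a i.
Proof.
rewrite -big_enum /=; apply: perm_big; apply: uniq_perm.
- exact: fset_uniq.
- exact: enum_uniq.
- by move=> i; rewrite inE.
Qed.

Lemma sum_to_fin (I : finType) (a : I -> R) : sum_to a (\sum_i a i).
Proof.
move=> e e0; exists [fset i in enum I]%fset => J hJ.
suff -> : J = [fset i in enum I]%fset.
  by rewrite sum_fset_enum subrr normr0 ltW.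
have hi i : i \in [fset i in enum I]%fset by rewrite inE /= mem_enum.
by apply/fsetP => i; rewrite hi (fsubsetP hJ).
Qed.

Lemma abs_bounded_fin (I : finType) (a : I -> R) C :
  \sum_i `|a i| <= C -> abs_bounded a C.
Proof.
move=> hC J; apply: le_trans hC; rewrite -sum_fset_enum; apply: ler_sum_fset => //.
by apply/fsubsetP => i _; rewrite inE /= mem_enum.
Qed.

Definition pickle_ext (I : countType) (T : Type) (d : T) (a : I -> T) (n : nat) : T :=
  if pickle_inv n is Some i then a i else d.

Lemma sum_pickle_ext (I : countType) (a : I -> R) (J : {fset nat}) :
  \sum_(n <- J) pickle_ext 0 a n
    = \sum_(i <- [fset i in pmap (@pickle_inv I) J]%fset) a i.
Proof.
transitivity (\sum_(i <- pmap (@pickle_inv I) J) a i).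
  elim: (J : seq nat) => [|n s IH]; first by rewrite !big_nil.
  rewrite big_cons IH /= /pickle_ext; case: (pickle_inv n) => [i|] /=.
    by rewrite big_cons.
  by rewrite add0r.
apply: perm_big; apply: uniq_perm.
- by apply: (pmap_uniq (g := pickle)); [move=> i; apply: pickle_invK| exact: fset_uniq].
- exact: fset_uniq.
- by move=> i; rewrite inE.
Qed.

Lemma abs_bounded_pickle (I : countType) (a : I -> R) C :
  abs_bounded a C -> abs_bounded (pickle_ext 0 a) C.
Proof.
move=> h J; have -> : \sum_(i <- J) `|pickle_ext 0 a i|
    = \sum_(i <- J) pickle_ext 0 (fun i => `|a i|) i.
  by apply: eq_bigr => n _; rewrite /pickle_ext; case: pickle_inv => //; rewrite normr0.
by rewrite sum_pickle_ext.
Qed.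

Lemma sum_to_pickle (I : countType) (a : I -> R) s :
  sum_to a s -> sum_to (pickle_ext 0 a) s.
Proof.
move=> h e /h[J hJ]; exists [fset pickle i | i in J]%fset => K hK.
rewrite sum_pickle_ext; apply: hJ; apply/fsubsetP => i iJ.
rewrite inE /= mem_pmap; apply/mapP; exists (pickle i); last by rewrite pickleK_inv.
by apply: (fsubsetP hK); apply: in_imfset.
Qed.

End UnorderedSums.

(** * Absolutely convergent power series on polydiscs *)

Section PowerSeries.
Context {R : realType}.

Definition polydisc (m : nat) (w : 'rV[R]_m) : set 'rV[R]_m :=
  [set x | forall i, `|x 0 i| <= w 0 i].

(* C bounds the l^1 norm of the coefficients with weights w. Monomials may be repeated in the
   expansion: closure under products, infinite sums and composition is then a matter of
   reindexing only. *)
Definition pseries (m : nat) (w : 'rV[R]_m) (f : 'rV[R]_m -> R) (C : R) : Prop :=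
  exists (c : nat -> R) (k : nat -> {ffun 'I_m -> nat}),
    abs_bounded (fun n => c n * monomial (k n) w) C /\
    forall x, polydisc w x -> sum_to (fun n => c n * monomial (k n) x) (f x).

Section Dim.
Context {m : nat}.
Implicit Types (w x : 'rV[R]_m) (f g : 'rV[R]_m -> R) (k : {ffun 'I_m -> nat}).

Lemma monomial0 x : monomial [ffun=> 0%N] x = 1.
Proof. by rewrite /monomial big1 // => i _; rewrite ffunE expr0. Qed.

Lemma monomialM k (l : {ffun 'I_m -> nat}) x :
  monomial [ffun i => (k i + l i)%N] x = monomial k x * monomial l x.
Proof.
by rewrite /monomial -big_split /=; apply: eq_bigr => i _; rewrite ffunE exprD.
Qed.

Lemma monomial_coord i x : monomial [ffun j => (j == i)%N : nat] x = x 0 i.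
Proof.
rewrite /monomial (bigD1 i) //= ffunE eqxx expr1 big1 ?mulr1 // => j /negPf ji.
by rewrite ffunE ji expr0.
Qed.

Lemma monomial_le k w x : polydisc w x -> `|monomial k x| <= monomial k w.
Proof.
move=> h; rewrite /monomial normr_prod; apply: ler_prod => i _.
by rewrite normr_ge0 normrX; apply: lerXn2r; rewrite ?nnegrE ?(le_trans _ (h i)).
Qed.

Lemma polydisc_trans w w' x : polydisc w w' -> polydisc w' x -> polydisc w x.
Proof.
move=> h h' i; apply: le_trans (h' i) (le_trans (ler_norm _) (h i)).
Qed.

Lemma pseries_of_countable (I : countType) w f C (c : I -> R)
    (k : I -> {ffun 'I_m -> nat}) :
  abs_bounded (fun i => c i * monomial (k i) w) C ->
  (forall x, polydisc w x -> sum_to (fun i => c i * monomial (k i) x) (f x)) ->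
  pseries w f C.
Proof.
move=> hC hf; exists (pickle_ext 0 c), (pickle_ext [ffun=> 0%N] k).
have E x : (fun n => pickle_ext 0 c n * monomial (pickle_ext [ffun=> 0%N] k n) x)
    = pickle_ext 0 (fun i => c i * monomial (k i) x).
  by apply/funext => n; rewrite /pickle_ext; case: pickle_inv => // ; rewrite mul0r.
split=> [|x /hf h]; rewrite E; first exact: abs_bounded_pickle.
exact: sum_to_pickle.
Qed.

Lemma pseries_ext w f g C : pseries w f C -> (forall x, polydisc w x -> f x = g x) -> pseries w g C.
Proof. by move=> [c [k [h1 h2]]] fg; exists c, k; split=> // x xw; rewrite -fg //; apply: h2. Qed.

Lemma pseriesW w f C D : C <= D -> pseries w f C -> pseries w f D.
Proof.
by move=> CD [c [k [h1 h2]]]; exists c, k; split => //; apply: abs_boundedW CD h1.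
Qed.

Lemma pseries_ge0 w f C : pseries w f C -> 0 <= C.
Proof. by move=> [c [k [h1 _]]]; exact: abs_bounded_ge0 h1. Qed.

Lemma pseries_term_le w (c : nat -> R) (k : nat -> {ffun 'I_m -> nat}) C x :
  abs_bounded (fun n => c n * monomial (k n) w) C -> polydisc w x ->
  abs_bounded (fun n => c n * monomial (k n) x) C.
Proof.
move=> h xw; apply: abs_bounded_le h => n; rewrite !normrM.
apply: ler_wpM2l => //; apply: le_trans (ler_norm _); exact: monomial_le.
Qed.

Lemma pseries_shrink w w' f C : polydisc w w' -> pseries w f C -> pseries w' f C.
Proof.
move=> h [c [k [h1 h2]]]; exists c, k; split; first exact: pseries_term_le h1 h.
by move=> x /(polydisc_trans h); exact: h2.
Qed.

Lemma pseries_bound w f C x : pseries w f C -> polydisc w x -> `|f x| <= C.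
Proof.
by move=> [c [k [h1 h2]]] xw; apply: sum_to_le (pseries_term_le h1 xw) (h2 _ xw).
Qed.

Lemma pseries_sum (I : countType) w (f : I -> 'rV[R]_m -> R) (D : I -> R) g C :
  (forall i, pseries w (f i) (D i)) -> abs_bounded D C ->
  (forall x, polydisc w x -> sum_to (fun i => f i x) (g x)) -> pseries w g C.
Proof.
move=> hf hD hg; case/choice: hf => c /choice[k hck].
have hb x : polydisc w x -> abs_bounded
    (fun p : I * nat => c p.1 p.2 * monomial (k p.1 p.2) x) C.
  move=> xw; apply: abs_bounded_prod hD => i /=.
  by apply: pseries_term_le xw; case: (hck i).
have hw : abs_bounded (fun p : I * nat => c p.1 p.2 * monomial (k p.1 p.2) w) C.
  by apply: abs_bounded_prod hD => i /=; case: (hck i).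
apply: (pseries_of_countable hw) => x xw; apply: sum_to_prod (hb _ xw) _ (hg _ xw) => i /=.
by case: (hck i) => _; apply.
Qed.

Lemma pseriesZ w f C c : pseries w f C -> pseries w (fun x => c * f x) (`|c| * C).
Proof.
move=> [d [k [h1 h2]]]; exists (fun n => c * d n), k.
have E x : (fun n => c * d n * monomial (k n) x) = fun n => c * (d n * monomial (k n) x).
  by apply/funext => n; rewrite mulrA.
split=> [|x /h2 h]; rewrite E; first exact: abs_boundedZ.
exact: sum_toZ.
Qed.

Lemma pseries_monomialM w f C k :
  (forall i, 0 <= w 0 i) -> pseries w f C ->
  pseries w (fun x => monomial k x * f x) (monomial k w * C).
Proof.
move=> w0 [d [l [h1 h2]]]; exists d, (fun n => [ffun i => (k i + l n i)%N]).
have E x : (fun n => d n * monomial [ffun i => (k i + l n i)%N] x)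
    = fun n => monomial k x * (d n * monomial (l n) x).
  by apply/funext => n; rewrite monomialM; ring.
have kw : 0 <= monomial k w by apply: prodr_ge0 => i _; exact: exprn_ge0.
split=> [|x /h2 h]; rewrite E; last exact: sum_toZ.
by rewrite -{2}(ger0_norm kw); exact: abs_boundedZ.
Qed.

Lemma pseries_cst w c : pseries w (fun=> c) `|c|.
Proof.
apply: (@pseries_of_countable unit w _ _ (fun=> c) (fun=> [ffun=> 0%N])) => [|x _].
  by apply: abs_bounded_fin; rewrite big_const card_unit /= addr0 monomial0 mulr1.
rewrite monomial0 mulr1.
apply: eq_sum_to (sum_to_fin (fun _ : unit => c)) => //.
by rewrite big_const card_unit /= addr0.
Qed.

Lemma pseries_monomial w k : (forall i, 0 <= w 0 i) ->
  pseries w (monomial k) (monomial k w).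
Proof.
move=> w0; apply: (@pseries_ext w (fun x => monomial k x * 1)) => [|x _]; last exact: mulr1.
have := pseries_monomialM k w0 (pseries_cst w 1).
by rewrite normr1 mulr1.
Qed.

Lemma pseries_coord w i : (forall i, 0 <= w 0 i) -> pseries w (fun x => x 0 i) (w 0 i).
Proof.
move=> w0; have := pseries_monomial [ffun j => (j == i)%N : nat] w0.
by rewrite monomial_coord => /pseries_ext; apply => x _; rewrite monomial_coord.
Qed.

Lemma pseriesD w f g C D : pseries w f C -> pseries w g D -> pseries w (fun x => f x + g x) (C + D).
Proof.
move=> hf hg; apply: (@pseries_sum bool w (fun b => if b then f else g)
  (fun b => if b then C else D)) => [[]//||x _].
  apply: abs_bounded_fin; rewrite big_bool /=.
  by rewrite (ger0_norm (pseries_ge0 hf)) (ger0_norm (pseries_ge0 hg)).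
by apply: eq_sum_to (sum_to_fin _); [move=> i|rewrite big_bool].
Qed.

Lemma pseriesM w f g C D : (forall i, 0 <= w 0 i) -> pseries w f C -> pseries w g D ->
  pseries w (fun x => f x * g x) (C * D).
Proof.
move=> w0 [c [k [h1 h2]]] hg.
apply: (@pseries_sum nat w (fun n x => c n * (monomial (k n) x * g x))
  (fun n => `|c n| * (monomial (k n) w * D))) => [n||x xw].
- exact: pseriesZ (pseries_monomialM _ w0 hg).
- rewrite [C * D]mulrC -(ger0_norm (pseries_ge0 hg)).
  apply: abs_bounded_le (abs_boundedZ D h1) => n.
  by rewrite !normrM !normr_id [leRHS]mulrC mulrA.
- rewrite mulrC; apply: eq_sum_to (sum_toZ (g x) (h2 _ xw)) => // n; ring.
Qed.

Lemma pseries_big (K : Type) (r : seq K) (P : pred K) w (f : K -> 'rV[R]_m -> R) (D : K -> R) :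
  (forall i, P i -> pseries w (f i) (D i)) ->
  pseries w (fun x => \sum_(i <- r | P i) f i x) (\sum_(i <- r | P i) D i).
Proof.
move=> h; elim: r => [|i r IH].
  rewrite big_nil; have := pseries_cst w 0; rewrite normr0.
  by move/pseries_ext; apply => x _; rewrite big_nil.
rewrite big_cons; case: ifP => Pi.
  by apply: (pseries_ext (pseriesD (h i Pi) IH)) => x _; rewrite big_cons Pi.
by apply: (pseries_ext IH) => x _; rewrite big_cons Pi.
Qed.

Lemma pseriesX w f C n : (forall i, 0 <= w 0 i) -> pseries w f C ->
  pseries w (fun x => f x ^+ n) (C ^+ n).
Proof.
move=> w0 hf; elim: n => [|n IH].
  by rewrite expr0 -(normr1 R); exact: pseries_cst.
by rewrite exprS; apply: (pseries_ext (pseriesM w0 hf IH)) => x _; rewrite exprS.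
Qed.

Lemma pseries_prod (K : Type) (r : seq K) w (f : K -> 'rV[R]_m -> R) (D : K -> R) :
  (forall i, 0 <= w 0 i) -> (forall i, pseries w (f i) (D i)) ->
  pseries w (fun x => \prod_(i <- r) f i x) (\prod_(i <- r) D i).
Proof.
move=> w0 h; elim: r => [|i r IH].
  have := pseries_cst w 1; rewrite big_nil normr1 => /pseries_ext; apply => x _.
  by rewrite big_nil.
by rewrite big_cons; apply: (pseries_ext (pseriesM w0 (h i) IH)) => x _; rewrite big_cons.
Qed.

End Dim.

(** Each monomial becomes a product of powers of the components of [phi], of norm at most the same
    monomial evaluated at their norms [w]; the bound [C] is thus unchanged. *)
Lemma pseries_comp (m p : nat) (w : 'rV[R]_m) (v : 'rV[R]_p) f C
    (phi : 'rV[R]_p -> 'rV[R]_m) :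
  (forall i, 0 <= v 0 i) -> pseries w f C ->
  (forall i, pseries v (fun x => phi x 0 i) (w 0 i)) -> pseries v (fun x => f (phi x)) C.
Proof.
move=> v0 [c [k [h1 h2]]] hphi.
have w0 i : 0 <= w 0 i := pseries_ge0 (hphi i).
apply: (@pseries_sum p nat v (fun n x => c n * monomial (k n) (phi x))
   (fun n => `|c n| * monomial (k n) w)) => [n||x xv].
- by apply: pseriesZ; apply: pseries_prod => // i; exact: pseriesX.
- by apply: abs_bounded_le h1 => n; rewrite !normrM normr_id.
- by apply: h2 => i; exact: pseries_bound (hphi i) xv.
Qed.

End PowerSeries.

(** * Germs at the origin that are sums of convergent power series *)

Section Germs.
Context {R : realType}.

Definition analytic0 (m : nat) (f : 'rV[R]_m -> R) : Prop :=
  exists r C : R, 0 < r /\ pseries (const_mx r) f C.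

Lemma nbhs0_polydisc (m : nat) (P : set 'rV[R]_m) :
  (\forall x \near (0 : 'rV[R]_m), P x) <->
  exists r : R, 0 < r /\ forall x, polydisc (const_mx r) x -> P x.
Proof.
split=> [/nbhs_ballP[e /= e0 h]|[r [r0 h]]].
  exists (e / 2); split=> [|x hx]; first by rewrite divr_gt0.
  apply: h; split=> // i j; rewrite /ball /= mxE sub0r normrN !ord1.
  by apply: le_lt_trans (hx j) _; rewrite mxE; lra.
apply/nbhs_ballP; exists r => //= x [_ hx]; apply: h => i.
by have := hx 0 i; rewrite /ball /= !mxE sub0r normrN => /ltW.
Qed.

Lemma polydisc_const_le (m : nat) (r s : R) (x : 'rV[R]_m) : r <= s ->
  polydisc (const_mx r) x -> polydisc (const_mx s) x.
Proof. by move=> rs h i; have := h i; rewrite !mxE => /le_trans; apply. Qed.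

Lemma analytic0_small (m : nat) (f : 'rV[R]_m -> R) : analytic0 f ->
  exists C d : R, 0 < d /\ forall w : 'rV[R]_m, (forall i, 0 <= w 0 i <= d) -> pseries w f C.
Proof.
move=> [r [C [r0 h]]]; exists C, r; split=> // w hw; apply: pseries_shrink h => i.
by have /andP[w0 wr] := hw i; rewrite mxE ger0_norm.
Qed.

Lemma analytic0_of (m : nat) (f : 'rV[R]_m -> R) (d : R) : 0 < d ->
  (forall w : 'rV[R]_m, (forall i, 0 < w 0 i <= d) -> exists C, pseries w f C) -> analytic0 f.
Proof.
move=> d0 h; have [|C hC] := h (const_mx d); last by exists d, C.
by move=> i; rewrite mxE d0 lexx.
Qed.

Lemma analytic0_ext (m : nat) (f g : 'rV[R]_m -> R) :
  analytic0 f -> (\forall x \near (0 : 'rV[R]_m), f x = g x) -> analytic0 g.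
Proof.
move=> [r [C [r0 h]]] /nbhs0_polydisc[s [s0 fg]].
exists (Num.min r s), C; split; first by rewrite lt_min r0.
apply: (@pseries_ext _ _ _ f) => [|x xw].
  by apply: pseries_shrink h => i; rewrite !mxE ger0_norm ?ge_min ?le_min ?lexx ?(ltW r0) ?(ltW s0).
by apply/fg/(polydisc_const_le _ xw); rewrite ge_min lexx orbT.
Qed.

Lemma analytic0_eq (m : nat) (f g : 'rV[R]_m -> R) : analytic0 f -> f =1 g -> analytic0 g.
Proof. by move=> h /funext <-. Qed.

Section Dim.
Context {m : nat}.
Implicit Types (w x : 'rV[R]_m) (f g : 'rV[R]_m -> R).

Lemma analytic0_cst (c : R) : analytic0 (fun _ : 'rV[R]_m => c).
Proof. by exists 1, `|c|; split => //; exact: pseries_cst. Qed.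

Lemma analytic0_coord i : analytic0 (fun x : 'rV[R]_m => x 0 i).
Proof.
exists 1, 1; split => //; have := @pseries_coord R m (const_mx 1) i.
by rewrite mxE; apply => j; rewrite mxE.
Qed.

Lemma analytic0D f g : analytic0 f -> analytic0 g -> analytic0 (fun x => f x + g x).
Proof.
move=> /analytic0_small[C [c [c0 hf]]] /analytic0_small[D [d [d0 hg]]].
have e0 : 0 < Num.min c d by rewrite lt_min c0.
apply: (analytic0_of e0) => w hw; exists (C + D); apply: pseriesD; [apply: hf|apply: hg] => i;
  by have /andP[h1] := hw i; rewrite le_min => /andP[h2 h3]; rewrite (ltW h1).
Qed.

Lemma analytic0M f g : analytic0 f -> analytic0 g -> analytic0 (fun x => f x * g x).
Proof.
move=> /analytic0_small[C [c [c0 hf]]] /analytic0_small[D [d [d0 hg]]].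
have e0 : 0 < Num.min c d by rewrite lt_min c0.
apply: (analytic0_of e0) => w hw; exists (C * D).
apply: pseriesM; [move=> i|apply: hf => i|apply: hg => i];
  by have /andP[h1] := hw i; rewrite le_min => /andP[h2 h3]; rewrite (ltW h1).
Qed.

Lemma analytic0N f : analytic0 f -> analytic0 (fun x => - f x).
Proof.
by move=> h; apply: (analytic0_eq (analytic0M (analytic0_cst (-1)) h)) => x; rewrite mulN1r.
Qed.

Lemma analytic0B f g : analytic0 f -> analytic0 g -> analytic0 (fun x => f x - g x).
Proof. by move=> hf hg; apply: analytic0D hf (analytic0N hg). Qed.

Lemma analytic0X f n : analytic0 f -> analytic0 (fun x => f x ^+ n).
Proof.
move=> h; elim: n => [|n IH]; first exact: analytic0_cst.
by apply: (analytic0_eq (analytic0M h IH)) => x; rewrite exprS.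
Qed.

Lemma analytic0_sum (K : Type) (r : seq K) (f : K -> 'rV[R]_m -> R) :
  (forall i, analytic0 (f i)) -> analytic0 (fun x => \sum_(i <- r) f i x).
Proof.
move=> h; elim: r => [|i r IH].
  by apply: (analytic0_eq (analytic0_cst 0)) => x; rewrite big_nil.
by apply: (analytic0_eq (analytic0D (h i) IH)) => x; rewrite big_cons.
Qed.

Lemma monomial_at0 (k : {ffun 'I_m -> nat}) :
  monomial k (0 : 'rV[R]_m) = (k == [ffun=> 0%N])%:R.
Proof.
case: eqP => [->|]; first exact: monomial0.
move=> /eqP h; have [i hi] : exists i, k i != 0%N.
  apply/existsP; apply: contraNT h; rewrite negb_exists => /forallP h.
  by apply/eqP/ffunP => i; rewrite ffunE; apply/eqP; have := h i; rewrite negbK.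
by rewrite /monomial (bigD1 i) //= mxE expr0n (negPf hi) mul0r.
Qed.

Lemma monomialZ (k : {ffun 'I_m -> nat}) (t : R) x :
  monomial k (t *: x) = t ^+ (\sum_i k i) * monomial k x.
Proof.
rewrite /monomial -prodrXr -big_split /=; apply: eq_bigr => i _.
by rewrite mxE exprMn.
Qed.

Lemma pseries_zero_scale w f C (t : R) : 0 <= t <= 1 -> (forall i, 0 <= w 0 i) ->
  pseries w f C -> f 0 = 0 -> pseries (t *: w) f (t * C).
Proof.
move=> /andP[t0 t1] w0 [c [k [h1 h2]]] f0.
have w'w : polydisc w (t *: w).
  by move=> i; rewrite mxE ger0_norm ?mulr_ge0 // ler_piMl.
(* Since monomials may be repeated, several indices may carry the constant monomial, with nonzero
   coefficients that add up to [f 0 = 0]; [c'] removes them all. Every remaining monomial has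
   positive degree and gains a factor [t]. *)
pose c' n := c n - c n * (k n == [ffun=> 0%N])%:R.
exists c', k; split => [|x /(polydisc_trans w'w) xw].
  rewrite -[X in X * C](ger0_norm t0); apply: abs_bounded_le (abs_boundedZ t h1) => n.
  rewrite /c'; case: eqP => [_|/eqP kn]; first by rewrite mulr1 subrr mul0r normr0.
  rewrite mulr0 subr0 monomialZ !normrM.
  have [d ->] : exists d, \sum_i k n i = d.+1.
    case E: (\sum_i k n i)%N => [|d]; last by exists d.
    have : monomial (k n) (0 *: 0 : 'rV[R]_m) = 1.
      rewrite scaler0 /monomial big1 // => i _; have /eqP := E.
      by rewrite sum_nat_eq0 => /forallP/(_ i)/eqP ->; rewrite expr0.
    by rewrite scaler0 monomial_at0 (negPf kn) => /eqP; rewrite eq_sym oner_eq0.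
  rewrite exprS normrM mulrCA -mulrA; apply: ler_wpM2l => //.
  rewrite ler_piMl ?mulr_ge0 // normrX ger0_norm //.
  exact: exprn_ile1.
have p0 : polydisc w 0 by move=> i; rewrite mxE normr0.
apply: eq_sum_to (sum_toD (h2 _ xw) (sum_toZ (-1) (h2 _ p0))) => [n|] /=.
  rewrite /c' monomial_at0; case: eqP => [->|_]; last by rewrite !mulr0 subr0 addr0.
  by rewrite monomial0; ring.
by rewrite f0 mulr0 addr0.
Qed.

(** Smallness in norm, and not only in value, is what substitution and the perturbation argument
    behind division require. *)
Lemma analytic0_vanish_small f (e : R) : analytic0 f -> f 0 = 0 -> 0 < e ->
  exists d, 0 < d /\ forall w, (forall i, 0 <= w 0 i <= d) -> pseries w f e.
Proof.
move=> [r [C [r0 hC]]] f0 e0.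
have C0 := pseries_ge0 hC; have C1 : 0 < C + 1 by lra.
pose t := Num.min 1 (e / (C + 1)).
have t0 : 0 < t by rewrite lt_min ltr01 divr_gt0.
have t1 : 0 <= t <= 1 by rewrite (ltW t0) ge_min lexx.
exists (t * r); split=> [|w hw]; first exact: mulr_gt0.
have h : pseries (t *: const_mx r) f (t * C).
  by apply: pseries_zero_scale => // i; rewrite mxE ltW.
apply: (@pseriesW _ _ _ _ (t * C)).
  apply: (@le_trans _ _ (e / (C + 1) * (C + 1))); last by rewrite divfK ?gt_eqF.
  apply: ler_pM => //; [exact: ltW|by rewrite ge_min lexx orbT|lra].
apply: pseries_shrink h => i; have /andP[h1 h2] := hw i.
by rewrite !mxE ger0_norm.
Qed.

End Dim.

Lemma analytic0_comp (m p : nat) (f : 'rV[R]_m -> R) (phi : 'rV[R]_p -> 'rV[R]_m) :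
  analytic0 f -> (forall i, analytic0 (fun x => phi x 0 i)) -> phi 0 = 0 ->
  analytic0 (fun x => f (phi x)).
Proof.
move=> [r [C [r0 hC]]] hphi phi0.
have /choice[d hd] i := analytic0_vanish_small (hphi i)
  (etrans (congr1 (fun y : 'rV[R]_m => y 0 i) phi0) (mxE _ _ _ _)) r0.
pose e := \big[Num.min/1]_i d i.
have e0 : 0 < e by apply: lt_bigmin => // i _; case: (hd i).
exists e, C; split=> //; apply: pseries_comp hC _ => i; rewrite mxE ?(ltW e0) //.
apply: (hd i).2 => j; rewrite mxE (ltW e0) /=.
exact: bigmin_le_cond.
Qed.

(** * Splitting off the first variable *)

Section Cons.
Context {m : nat}.
Implicit Types (x w : 'rV[R]_m.+1) (y : 'rV[R]_m).

Definition hd x : R := x 0 ord0.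
Definition tl x : 'rV[R]_m := \row_j x 0 (lift ord0 j).
Definition consrv (t : R) y : 'rV[R]_m.+1 :=
  \row_i if unlift ord0 i is Some j then y 0 j else t.

Lemma hd_cons t y : hd (consrv t y) = t.
Proof. by rewrite /hd mxE unlift_none. Qed.

Lemma tl_cons t y : tl (consrv t y) = y.
Proof. by apply/rowP => j; rewrite !mxE liftK. Qed.

Lemma cons_hd_tl x : consrv (hd x) (tl x) = x.
Proof. by apply/rowP => i; rewrite mxE; case: unliftP => [j ->|->] //; rewrite mxE. Qed.

Lemma polydisc_tl w x : polydisc w x -> polydisc (tl w) (tl x).
Proof. by move=> h i; rewrite !mxE. Qed.

Lemma polydisc_cons w t y :
  `|t| <= hd w -> polydisc (tl w) y -> polydisc w (consrv t y).
Proof.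
move=> ht hy i; rewrite mxE; case: unliftP => [j ->|->] //.
by have := hy j; rewrite mxE.
Qed.

Definition tlk (k : {ffun 'I_m.+1 -> nat}) : {ffun 'I_m -> nat} :=
  [ffun j => k (lift ord0 j)].

Lemma monomial_split (k : {ffun 'I_m.+1 -> nat}) x :
  monomial k x = hd x ^+ k ord0 * monomial (tlk k) (tl x).
Proof.
rewrite /monomial big_ord_recl; congr (_ * _); apply: eq_bigr => i _.
by rewrite mxE ffunE.
Qed.

End Cons.

Lemma pseries_exists (m : nat) (w : 'rV[R]_m) (c : nat -> R)
    (k : nat -> {ffun 'I_m -> nat}) C :
  abs_bounded (fun n => c n * monomial (k n) w) C ->
  exists f, pseries w f C /\
    forall x, polydisc w x -> sum_to (fun n => c n * monomial (k n) x) (f x).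
Proof.
move=> h; have /choice[f hf] x : exists s, polydisc w x ->
    sum_to (fun n => c n * monomial (k n) x) s.
  case: (pselect (polydisc w x)) => [xw|]; last by exists 0.
  by have [s hs] := abs_bounded_sum (pseries_term_le h xw); exists s.
by exists f; split=> //; exists c, k.
Qed.

(** The terms are sorted by their exponent in the first variable. Removing a factor [hd x ^+ i]
    removes the weight [hd w ^+ i], hence the divisors in the bounds. *)
Lemma pseries_split (m n : nat) (w : 'rV[R]_m.+1) f C :
  0 < hd w -> (forall i, 0 <= w 0 i) -> pseries w f C ->
  exists (r : nat -> 'rV[R]_m -> R) (h : 'rV[R]_m.+1 -> R),
    [/\ forall i, pseries (tl w) (r i) (C / hd w ^+ i), pseries w h (C / hd w ^+ n) &
     forall x, polydisc w x ->
       f x = hd x ^+ n * h x + \sum_(i < n) r i (tl x) * hd x ^+ i].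
Proof.
move=> hw0 w0 [c [k [h1 h2]]].
have b i : abs_bounded
    (fun j => (c j * (k j ord0 == i)%:R) * monomial (tlk (k j)) (tl w)) (C / hd w ^+ i).
  have hwi : 0 < hd w ^+ i by exact: exprn_gt0.
  rewrite mulrC -(ger0_norm (_ : 0 <= (hd w ^+ i)^-1)) ?invr_ge0 ?ltW //.
  apply: abs_bounded_le (abs_boundedZ _ h1) => j.
  case: eqP => [E|_]; last by rewrite mulr0 mul0r normr0.
  by rewrite monomial_split E mulr1 (mulrCA (c j)) mulKf ?gt_eqF.
(* The truncated subtraction is harmless: in [h] the terms with first exponent below [n] get
   coefficient 0. *)
pose sh (l : {ffun 'I_m.+1 -> nat}) : {ffun 'I_m.+1 -> nat} :=
  [ffun i => if i == ord0 then (l i - n)%N else l i].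
have shE (l : {ffun 'I_m.+1 -> nat}) x : (n <= l ord0)%N ->
    hd x ^+ n * monomial (sh l) x = monomial l x.
  move=> nl; rewrite !monomial_split mulrA ffunE eqxx -exprD subnKC //.
  by congr (_ * monomial _ _); apply/ffunP => i; rewrite !ffunE.
have bh : abs_bounded
    (fun j => (c j * (n <= k j ord0)%:R) * monomial (sh (k j)) w) (C / hd w ^+ n).
  have hwi : 0 < hd w ^+ n by exact: exprn_gt0.
  rewrite mulrC -(ger0_norm (_ : 0 <= (hd w ^+ n)^-1)) ?invr_ge0 ?ltW //.
  apply: abs_bounded_le (abs_boundedZ _ h1) => j.
  case: (boolP (n <= _)%N) => [E|_]; last by rewrite mulr0 mul0r normr0.
  by rewrite -(shE _ _ E) mulr1 (mulrCA (c j)) mulKf ?gt_eqF.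
have /choice[r hr] i := pseries_exists (b i); have [h [hh hs]] := pseries_exists bh.
exists r, h; split=> // [i|x xw]; first by case: (hr i).
apply: (sum_to_unique (h2 _ xw)).
have S i : sum_to (fun j => hd x ^+ i * (c j * (k j ord0 == i)%:R *
    monomial (tlk (k j)) (tl x))) (hd x ^+ i * r i (tl x)).
  by apply: sum_toZ; apply: (hr i).2; exact: polydisc_tl.
apply: eq_sum_to (sum_toD (sum_toZ (hd x ^+ n) (hs _ xw))
  (sum_to_big (index_enum 'I_n) (fun i : 'I_n => S i))) => [j|] /=; last first.
  by congr (_ + _); apply: eq_bigr => i _; rewrite mulrC.
case: (leqP n (k j ord0)) => [E|E].
  rewrite mulr1 mulrCA (shE _ _ E) big1 ?addr0 // => i _.
  by rewrite gtn_eqF ?mulr0 ?mul0r ?mulr0 //; apply: leq_trans E.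
rewrite mulr0 mul0r mulr0 add0r (bigD1 (Ordinal E)) //= eqxx mulr1.
rewrite big1 ?addr0 => [|i /negPf iE].
  by rewrite monomial_split mulrCA.
suff -> : (k j ord0 == i) = false by rewrite mulr0 mul0r mulr0.
by apply: contraFF iE => /eqP h'; apply/eqP/val_inj.
Qed.

End Germs.

(** * Weierstrass division *)

Section Weierstrass.
Context {R : realType}.

(** Links unordered sums to sequences: the partial sums over [nat], and the sums over boxes of
    multi-indices in the definition of analyticity. *)
Lemma sum_to_cofinal (I : choiceType) (a : I -> R) s (J : nat -> {fset I}) :
  {homo J : m n / (m <= n)%N >-> (m `<=` n)%fset} ->
  (forall i, exists n, i \in J n) -> sum_to a s ->
  forall e, 0 < e -> exists n0, forall n, (n0 <= n)%N ->
    `|\sum_(i <- J n) a i - s| <= e.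
Proof.
move=> Jmono Jcover hs e e0; have [J0 hJ0] := hs e e0.
have [n0 hn0] : exists n0, (J0 `<=` J n0)%fset.
  have [n hn] := choice Jcover.
  exists (\max_(i <- J0) n i)%N; apply/fsubsetP => i iJ.
  apply: (fsubsetP (Jmono _ _ _)) (hn i).
  exact: (@leq_bigmax_seq _ _ predT n i).
exists n0 => n nn; apply: hJ0; exact: fsubset_trans hn0 (Jmono _ _ nn).
Qed.

Lemma in_fset_iota n i : (i \in [fset i in iota 0 n]%fset) = (i < n)%N.
Proof. by rewrite inE /= mem_iota. Qed.

Lemma sum_to_partial_sums (a : nat -> R) s : sum_to a s ->
  forall e, 0 < e -> exists n0, forall n, (n0 <= n)%N ->
    `|\sum_(i < n) a i - s| <= e.
Proof.
move=> hs e e0; pose J n := [fset i in iota 0 n]%fset.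
have [||n0 hn0] := @sum_to_cofinal _ a s J _ _ hs e e0.
- move=> m n mn; apply/fsubsetP => i; rewrite /J !in_fset_iota.
  by move=> h; apply: leq_trans mn.
- by move=> i; exists i.+1; rewrite /J in_fset_iota.
exists n0 => n /hn0; suff -> : \sum_(i <- J n) a i = \sum_(i < n) a i by [].
rewrite -(big_mkord predT a) /index_iota subn0; apply: perm_big; apply: uniq_perm.
- exact: fset_uniq.
- exact: iota_uniq.
- by move=> i; rewrite inE.
Qed.

(** The exact total is [4 / 3 * D]; the rounder [2 * D] is still small enough for the unit in
    [weierstrass_preparation]. *)
Lemma abs_bounded_geometric (D : R) : 0 <= D ->
  abs_bounded (fun j => D * 4^-1 ^+ j) (2 * D).
Proof.
move=> D0 J; have [n hn] : exists n, (J `<=` [fset i in iota 0 n])%fset.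
  exists (\max_(i <- J) i).+1; apply/fsubsetP => i iJ.
  rewrite in_fset_iota ltnS; exact: (@leq_bigmax_seq _ _ predT id i).
apply: le_trans (ler_sum_fset _ hn) _ => //.
have -> : \sum_(i <- [fset i in iota 0 n]%fset) `|D * 4^-1 ^+ i|
    = \sum_(i < n) D * 4^-1 ^+ i.
  rewrite -(big_mkord predT (fun i => D * 4^-1 ^+ i)) /index_iota subn0.
  rewrite (@perm_big _ _ _ _ _ (iota 0 n)) /=.
    by apply: eq_bigr => i _; rewrite ger0_norm ?mulr_ge0 ?exprn_ge0 ?invr_ge0.
  by apply: uniq_perm; [exact: fset_uniq|exact: iota_uniq|move=> i; rewrite inE].
suff : \sum_(i < n) D * 4^-1 ^+ i <= 4 / 3 * D - 4 / 3 * D * 4^-1 ^+ n.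
  have : 0 <= 4 / 3 * D * 4^-1 ^+ n by rewrite !mulr_ge0 ?exprn_ge0 ?invr_ge0.
  lra.
elim: n {hn} => [|n IH]; first by rewrite big_ord0 expr0; lra.
by rewrite big_ord_recr /= exprS; lra.
Qed.

Lemma geometric_small (C e : R) : 0 < e -> exists n0, forall n, (n0 <= n)%N ->
  C * 4^-1 ^+ n <= e.
Proof.
move=> e0; exists (Num.truncn (`|C| / e)).+1 => n hn.
have h1 : `|C| / e <= n%:R.
  apply: ltW; apply: lt_le_trans (truncnS_gt _) _; by rewrite ler_nat.
have h2 : n%:R * 4^-1 ^+ n <= 1 :> R.
  rewrite exprVn ler_pdivrMr ?exprn_gt0 // mul1r -natrX ler_nat.
  by rewrite ltnW // ltn_expl.
have p : 0 <= 4^-1 ^+ n :> R by rewrite exprn_ge0 ?invr_ge0.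
apply: (@le_trans _ _ (`|C| * 4^-1 ^+ n)); first by apply: ler_wpM2r; rewrite // ler_norm.
rewrite ler_pdivrMr // in h1.
apply: (@le_trans _ _ (n%:R * e * 4^-1 ^+ n)); first exact: ler_wpM2r.
by rewrite mulrAC ler_piMl // ltW.
Qed.

Lemma pseries_series (m : nat) (w : 'rV[R]_m) (f : nat -> 'rV[R]_m -> R) (D : nat -> R) C :
  (forall j, pseries w (f j) (D j)) -> abs_bounded D C ->
  exists g, pseries w g C /\ forall x, polydisc w x -> sum_to (fun j => f j x) (g x).
Proof.
move=> hf hD; have /choice[g hg] x : exists s, polydisc w x ->
    sum_to (fun j => f j x) s.
  case: (pselect (polydisc w x)) => [xw|]; last by exists 0.
  have [|s hs] := @abs_bounded_sum _ _ (fun j => f j x) C; last by exists s.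
  apply: abs_bounded_le hD => j; apply: le_trans (ler_norm _).
  exact: pseries_bound (hf j) xw.
by exists g; split=> //; exact: pseries_sum hf hD hg.
Qed.

Section Division.
Context {m n : nat} (w : 'rV[R]_m.+1) (g : 'rV[R]_m.+1 -> R) (u : R)
  (hw0 : 0 < hd w) (w0 : forall i, 0 <= w 0 i) (u0 : u != 0)
  (hg : pseries w (fun x => g x - u * hd x ^+ n) (`|u| * hd w ^+ n / 4)).

(* Dividing by u * hd ^ n, to which g is close, instead of g leaves an error of norm C / 4;
   the division is obtained by iteration. *)
Lemma division_step h C : pseries w h C -> exists p : ('rV[R]_m.+1 -> R) *
    (nat -> 'rV[R]_m -> R) * ('rV[R]_m.+1 -> R),
  [/\ pseries w p.1.1 (C / (`|u| * hd w ^+ n)), forall i, pseries (tl w) (p.1.2 i) (C / hd w ^+ i),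
    pseries w p.2 (C * 4^-1) & forall x, polydisc w x ->
      h x = p.1.1 x * g x + \sum_(i < n) p.1.2 i (tl x) * hd x ^+ i + p.2 x].
Proof.
move=> hh; have [r [h1 [hr hh1 E]]] := pseries_split n hw0 w0 hh.
have p1 : 0 < hd w ^+ n by exact: exprn_gt0.
have pu : 0 < `|u| by rewrite normr_gt0.
have hq : pseries w (fun x => u^-1 * h1 x) (C / (`|u| * hd w ^+ n)).
  apply: pseriesW (pseriesZ u^-1 hh1); rewrite normfV.
  by rewrite le_eqVlt; apply/orP; left; apply/eqP; field; rewrite !gt_eqF.
exists (fun x => u^-1 * h1 x, r,
  fun x => -1 * (u^-1 * h1 x * (g x - u * hd x ^+ n))); split => //=.
- apply: pseriesW (pseriesZ (-1) (pseriesM w0 hq hg)); rewrite normrN1 mul1r.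
  by rewrite le_eqVlt; apply/orP; left; apply/eqP; field; rewrite !gt_eqF.
- by move=> x xw; rewrite (E _ xw); field.
Qed.

Lemma weierstrass_division_pseries h C : pseries w h C ->
  exists (q : 'rV[R]_m.+1 -> R) (r : nat -> 'rV[R]_m -> R),
  [/\ pseries w q (2 * (C / (`|u| * hd w ^+ n))),
      forall i, pseries (tl w) (r i) (2 * (C / hd w ^+ i)) &
      forall x, polydisc w x ->
        h x = q x * g x + \sum_(i < n) r i (tl x) * hd x ^+ i].
Proof.
move=> hh; have C0 := pseries_ge0 hh.
have p1 i : 0 < hd w ^+ i by exact: exprn_gt0.
have pu : 0 < `|u| by rewrite normr_gt0.
(* [division_step] needs a series of known norm; the case distinction turns it into a total
   function, which the fixpoint [H] iterates together with the bounds [Cj]. *)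
have /choice[S hS] (p : ('rV[R]_m.+1 -> R) * R) : exists q, pseries w p.1 p.2 -> _ :=
  match pselect (pseries w p.1 p.2) with
  | left H => let: ex_intro q hq := division_step H in ex_intro _ q (fun=> hq)
  | right H => ex_intro _ (fun=> 0, fun=> fun=> 0, fun=> 0) (fun K => False_ind _ (H K))
  end.
pose Cj j := C * 4^-1 ^+ j.
pose H := fix H j := if j is j'.+1 then (S (H j', Cj j')).2 else h.
have hH j : pseries w (H j) (Cj j).
  elim: j => [|j IH]; first by rewrite /Cj expr0 mulr1.
  by have [_ _ h2 _] := hS (H j, Cj j) IH; rewrite /Cj exprSr mulrA.
pose Q j := (S (H j, Cj j)).1.1; pose r j := (S (H j, Cj j)).1.2.
have hQ j : pseries w (Q j) (C / (`|u| * hd w ^+ n) * 4^-1 ^+ j).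
  by have [h1 _ _ _] := hS (H j, Cj j) (hH j); rewrite mulrAC.
have hr i j : pseries (tl w) (r j i) (C / hd w ^+ i * 4^-1 ^+ j).
  by have [_ h1 _ _] := hS (H j, Cj j) (hH j); rewrite mulrAC; exact: h1.
have E j x : polydisc w x -> Q j x * g x + \sum_(i < n) r j i (tl x) * hd x ^+ i
    = H j x - H j.+1 x.
  move=> xw; have [_ _ _ h4] := hS (H j, Cj j) (hH j).
  have {}h4 := h4 x xw; rewrite [H j x]h4; exact/esym/addrK.
have D0 : 0 <= C / (`|u| * hd w ^+ n) by rewrite divr_ge0 // ltW // mulr_gt0.
have [q [hq sq]] := pseries_series hQ (abs_bounded_geometric D0).
have /choice[rr hrr] i := pseries_series (hr i) (abs_bounded_geometric (divr_ge0 C0 (ltW (p1 i)))).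
exists q, rr; split=> // [i|x xw]; first by case: (hrr i).
have S' i : sum_to (fun j => hd x ^+ i * r j i (tl x)) (hd x ^+ i * rr i (tl x)).
  by apply: sum_toZ; apply: (hrr i).2; exact: polydisc_tl.
have := sum_toD (sum_toZ (g x) (sq _ xw))
  (sum_to_big (index_enum 'I_n) (fun i : 'I_n => S' i)).
set T := (X in sum_to _ X) => hT.
transitivity T; last first.
  by rewrite /T mulrC; congr (_ + _); apply: eq_bigr => i _; rewrite mulrC.
have hT' : sum_to (fun j => H j x - H j.+1 x) T.
  apply: eq_sum_to hT => // j; rewrite -E // mulrC; congr (_ + _).
  by apply: eq_bigr => i _; rewrite mulrC.
apply/eqP; rewrite -subr_eq0 -normr_le0; apply: le0_eps => e e0.
have e20 : 0 < e / 2 by lra.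
have [n1 hn1] := sum_to_partial_sums hT' e20.
have [n2 hn2] := geometric_small C e20.
have := hn1 _ (leq_maxl n1 n2); have := hn2 _ (leq_maxr n1 n2).
set N := maxn n1 n2 => h2 h1.
(* After [N] steps the undivided part is [H N], of norm at most [C * 4^-1 ^+ N]. *)
have tel : \sum_(j < N) (H j x - H j.+1 x) = h x - H N x.
  elim: N {h1 h2} => [|N IH]; first by rewrite big_ord0 subrr.
  by rewrite big_ord_recr /= IH; ring.
have h3 : `|H N x| <= e / 2 by apply: le_trans (pseries_bound (hH N) xw) h2.
rewrite tel in h1.
have -> : h x - T = (h x - H N x - T) + H N x by ring.
apply: le_trans (ler_normD _ _) _; lra.
Qed.

End Division.

(** On the axis [tl x = 0] the germ has order exactly [n] in [hd x]. The expansion is part of the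
    definition because [regular_approx] estimates the coefficients [gi] off the axis. *)
Definition regular_in_hd (m n : nat) (g : 'rV[R]_m.+1 -> R) : Prop :=
  exists (d : R) (gi : nat -> 'rV[R]_m -> R) (G : 'rV[R]_m.+1 -> R),
    [/\ 0 < d, forall i, analytic0 (gi i), analytic0 G,
      forall i, (i < n)%N -> gi i 0 = 0 & gi n 0 != 0 /\
      forall x, polydisc (const_mx d) x ->
        g x = hd x ^+ n.+1 * G x + \sum_(i < n.+1) gi i (tl x) * hd x ^+ i].

(** The radius [s] of the first variable is fixed first, so that the tail [hd x ^+ n.+1 * G x] has
    norm at most an eighth of [|u| * s ^+ n]. The radius [t] of the other variables then depends on
    [s] and makes the variations [gi'] of the coefficients contribute at most another eighth. *)
Lemma regular_approx (m n : nat) (g : 'rV[R]_m.+1 -> R) (e : R) :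
  regular_in_hd n g -> 0 < e -> exists (w : 'rV[R]_m.+1) (u : R),
  [/\ u != 0, forall i, 0 < w 0 i <= e &
   pseries w (fun x => g x - u * hd x ^+ n) (`|u| * hd w ^+ n / 4)].
Proof.
move=> [d [gi [G [d0 hgi /analytic0_small[CG [dG [dG0 hG]]] gi0 [gn0 E]]]]] e0.
pose u := gi n 0; have pu : 0 < `|u| by rewrite normr_gt0.
have CG0 : 0 <= CG.
  by apply: (@pseries_ge0 R _ 0 G); apply: hG => i; rewrite mxE lexx ltW.
pose s := Num.min (Num.min d e) (Num.min dG (`|u| / 8 / (CG + 1))).
have CG1 : 0 < CG + 1 by lra.
have s0 : 0 < s by rewrite !lt_min d0 e0 dG0 !divr_gt0.
have [[sd se] [sG su]] : (s <= d /\ s <= e) /\ (s <= dG /\ s <= `|u| / 8 / (CG + 1)).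
  by rewrite /s !ge_min !lexx !orbT.
have ps i : 0 < s ^+ i by exact: exprn_gt0.
pose K := `|u| * s ^+ n / 8 / n.+1%:R.
have K0 : 0 < K by rewrite !divr_gt0 // mulr_gt0.
pose gi' i y := gi i y - gi i 0.
have hgi' i : analytic0 (gi' i) by apply: analytic0B => //; exact: analytic0_cst.
have /choice[dd hdd] i := analytic0_vanish_small (hgi' i) (subrr _) (divr_gt0 K0 (ps i)).
pose t := Num.min (Num.min d e) (Num.min dG (\big[Num.min/1]_(i < n.+1) dd i)).
have t0 : 0 < t.
  rewrite !lt_min d0 e0 dG0 /=; apply: lt_bigmin => // i _; by case: (hdd i).
have [[td te] [tG tdd]] : (t <= d /\ t <= e) /\
    (t <= dG /\ t <= \big[Num.min/1]_(i < n.+1) dd i).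
  by rewrite /t !ge_min !lexx !orbT.
pose w := consrv s (const_mx t : 'rV[R]_m).
have ww i : w 0 i = s \/ w 0 i = t.
  by rewrite mxE; case: unliftP => [j _|_]; [right; rewrite mxE|left].
have hdw : hd w = s by rewrite hd_cons.
have tlw : tl w = const_mx t by rewrite tl_cons.
clearbody w.
have w0 i : 0 <= w 0 i by case: (ww i) => ->; exact: ltW.
exists w, u; split => //; first by move=> i; case: (ww i) => ->; rewrite ?s0 ?t0.
have wd : polydisc (const_mx d) w.
  by move=> i; rewrite mxE ger0_norm //; case: (ww i) => ->.
have hGw : pseries w G CG.
  by apply: hG => i; rewrite w0 /=; case: (ww i) => ->.
have hh : pseries w (@hd R m) s by rewrite -hdw; exact: pseries_coord.
have htl (f : 'rV[R]_m -> R) C : pseries (tl w) f C -> pseries w (fun x => f (tl x)) C.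
  move=> hf; apply: pseries_comp hf _ => // i; have := pseries_coord (lift ord0 i) w0.
  rewrite mxE => /pseries_ext; apply => x _; by rewrite mxE.
have hi (i : 'I_n.+1) : pseries w (fun x => gi' i (tl x) * hd x ^+ i) K.
  have h1 : pseries (tl w) (gi' i) (K / s ^+ i).
    apply: (hdd i).2 => j; rewrite tlw mxE (ltW t0) /=; apply: le_trans tdd _.
    exact: bigmin_le_cond.
  by have := pseriesM w0 (htl _ _ h1) (pseriesX i w0 hh); rewrite divfK ?gt_eqF.
have := pseriesD (pseriesM w0 (pseriesX n.+1 w0 hh) hGw)
  (pseries_big (index_enum 'I_n.+1) (fun i (_ : predT i) => hi i)).
move=> /(@pseriesW _ _ _ _ _ (`|u| * hd w ^+ n / 4)); rewrite hdw => h.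
apply: pseries_ext (h _) _.
  have -> : \sum_(i : 'I_n.+1) K = `|u| * s ^+ n / 8.
    by rewrite sumr_const card_ord -(mulr_natr K) /K divfK // pnatr_eq0.
  have : s ^+ n.+1 * CG <= s ^+ n * (`|u| / 8).
    rewrite exprSr -mulrA; apply: ler_wpM2l; first exact: ltW.
    rewrite ler_pdivlMr // in su; apply: le_trans su.
    by apply: ler_wpM2l; [exact: ltW|lra].
  lra.
move=> x /(polydisc_trans wd) xd; rewrite (E _ xd) /gi'.
rewrite -addrA; congr (_ + _).
rewrite !big_ord_recr /= mulrBl.
have -> : \sum_(i < n) (gi i (tl x) - gi i 0) * hd x ^+ i
    = \sum_(i < n) gi i (tl x) * hd x ^+ i.
  by apply: eq_bigr => i _; rewrite gi0 ?subr0.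
by rewrite addrA.
Qed.

End Weierstrass.

(** * Derivatives of power series *)

Section Derivatives.
Context {R : realType}.

Lemma rv_norm_ge (m : nat) (x : 'rV[R]_m) i : `|x 0 i| <= `|x|.
Proof.
by rewrite [leRHS]/Num.Def.normr /= mx_normrE; apply/bigmax_geP; right => /=; exists (0, i).
Qed.

Lemma cvg_bigsum (T I : Type) (F : set_system T) {FF : Filter F} (r : seq I)
    (f : I -> T -> R) (a : I -> R) :
  (forall i, f i x @[x --> F] --> a i) ->
  (\sum_(i <- r) f i x) @[x --> F] --> \sum_(i <- r) a i.
Proof.
move=> h; apply: (@cvg_big _ _ _ 0 predT) => // x.
by apply: cvgD; [exact: cvg_fst|exact: cvg_snd].
Qed.

Definition dot (m : nat) (a h : 'rV[R]_m) : R := \sum_i h 0 i * a 0 i.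

Fact dot_linear (m : nat) (a : 'rV[R]_m) : linear (dot a).
Proof.
move=> k u v; rewrite /dot scaler_sumr -big_split /=; apply: eq_bigr => i _.
by rewrite !mxE mulrDl -scalerAl.
Qed.

HB.instance Definition _ (m : nat) (a : 'rV[R]_m) :=
  GRing.isLinear.Build R 'rV[R]_m R *:%R (dot a) (@dot_linear m a).

Lemma dot_continuous (m : nat) (a : 'rV[R]_m) : continuous (dot a).
Proof.
move=> x; apply: (@cvg_bigsum _ _ _ (nbhs_filter x)) => i; apply: cvgM; last exact: cvg_cst.
exact: coord_continuous.
Qed.

Lemma diff_of_quadratic_remainder (m : nat) (f : 'rV[R]_m -> R) (x a : 'rV[R]_m)
    (K s : R) : 0 < s ->
  (forall h, `|h| <= s -> `|f (h + x) - f x - dot a h| <= K * `|h| ^+ 2) ->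
  differentiable f x /\ forall v, 'D_v f x = dot a v.
Proof.
move=> s0 hK.
have E : f \o shift x = cst (f x) + dot a +o_ (0 : 'rV[R]_m) id.
  apply/eqaddoP => e e0; have K1 : 0 < `|K| + 1 by rewrite ltr_wpDl.
  have d0 : 0 < Num.min s (e / (`|K| + 1)) by rewrite lt_min s0 divr_gt0.
  apply/nbhs_ballP; exists (Num.min s (e / (`|K| + 1))) => //= h.
  rewrite mx_norm_ball /ball_ /= sub0r normrN lt_min => /andP[hs /ltW he].
  have := hK h (ltW hs); rewrite !fctE /= opprD addrA => /le_trans; apply.
  rewrite expr2 mulrA; apply: ler_wpM2r => //.
  rewrite ler_pdivlMr // in he; apply: le_trans he; rewrite mulrC.
  by apply: ler_wpM2l => //; have := ler_norm K; lra.
have D := diff_unique (@dot_continuous m a) E.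
have df : differentiable f x.
  apply/diff_locallyP; rewrite D; split => //; exact: dot_continuous.
by split=> // v; rewrite deriveE // D.
Qed.

Lemma analytic0_derivative (m : nat) (f : 'rV[R]_m -> R) : analytic0 f ->
  exists df : 'I_m -> 'rV[R]_m -> R, (forall i, analytic0 (df i)) /\
    \forall x \near (0 : 'rV[R]_m),
      differentiable f x /\ forall v, 'D_v f x = \sum_i v 0 i * df i x.
Proof.
(* f (y + h) is a power series in (y, h), which is sorted by degree in h *)
move=> [r [C [r0 hf]]]; pose s := r / 2; have s0 : 0 < s by rewrite divr_gt0.
have C0 := pseries_ge0 hf.
pose ws p : 'rV[R]_p := const_mx s.
have ws0 p i : 0 <= ws p 0 i by rewrite mxE ltW.
have [c [k [hb hs]]] : pseries (ws (m + m)%N) (fun z => f (lsubmx z + rsubmx z)) C.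
  apply: pseries_comp hf _ => // i.
  have := pseriesD (pseries_coord (lshift m i) (ws0 (m + m)%N))
    (pseries_coord (rshift m i) (ws0 (m + m)%N)).
  have -> : ws (m + m)%N 0 (lshift m i) + ws (m + m)%N 0 (rshift m i) = (const_mx r : 'rV[R]_m) 0 i.
    by rewrite !mxE /s; lra.
  by move/pseries_ext; apply => x _; rewrite !mxE.
pose kl n : {ffun 'I_m -> nat} := [ffun i => k n (lshift m i)].
pose kr n : {ffun 'I_m -> nat} := [ffun i => k n (rshift m i)].
have kE n y h : monomial (k n) (row_mx y h) = monomial (kl n) y * monomial (kr n) h.
  rewrite /monomial big_split_ord /=; congr (_ * _); apply: eq_bigr => i _.
    by rewrite row_mxEl ffunE.
  by rewrite row_mxEr ffunE.
have wsE : ws (m + m)%N = row_mx (ws m) (ws m).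
  by rewrite /ws row_mx_const.
have kws n : monomial (k n) (ws (m + m)%N) = monomial (kl n) (ws m) * monomial (kr n) (ws m).
  by rewrite wsE kE.
have mws0 p (l : {ffun 'I_p -> nat}) : 0 <= monomial l (ws p).
  by apply: prodr_ge0 => i _; exact: exprn_ge0.
pose e_ i : {ffun 'I_m -> nat} := [ffun j => (j == i)%N : nat].
pose z_ : {ffun 'I_m -> nat} := [ffun=> 0%N].
(* Terms of degree at least 2 in [h]; degrees 0 and 1 make up [f0] and the partial derivatives
   [df i]. *)
pose big n := (kr n != z_) && [forall i, kr n != e_ i].
have bz : abs_bounded (fun n => (c n * (kr n == z_)%:R) * monomial (kl n) (ws m)) C.
  apply: abs_bounded_le hb => n; case: eqP => [E|_]; last by rewrite mulr0 mul0r normr0.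
  by rewrite kws E monomial0 !mulr1.
have be i : abs_bounded (fun n => (c n * (kr n == e_ i)%:R) * monomial (kl n) (ws m))
    (`|s^-1| * C).
  apply: abs_bounded_le (abs_boundedZ s^-1 hb) => n.
  case: eqP => [E|_]; last by rewrite mulr0 mul0r normr0.
  have -> : monomial (k n) (ws (m + m)%N) = s * monomial (kl n) (ws m).
    by rewrite kws E monomial_coord mxE mulrC.
  by rewrite mulr1 (mulrCA (c n)) mulKf ?gt_eqF.
have bbig : abs_bounded (fun n => (c n * (big n)%:R) * monomial (k n) (ws (m + m)%N)) C.
  apply: abs_bounded_le hb => n; case: (big n); first by rewrite mulr1.
  by rewrite mulr0 mul0r normr0.
have [f0 [_ hf0]] := pseries_exists bz.
have /choice[df hdf] i := pseries_exists (be i).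
have [rem [_ hrem]] := pseries_exists bbig.
have krdeg n : big n -> exists p, \sum_i kr n i = p.+2.
  move=> /andP[h0 /forallP h1]; case E: (\sum_i kr n i)%N => [|[|p]]; last by exists p.
    case/eqP: h0; apply/ffunP => i; rewrite [RHS]ffunE; apply/eqP.
    by move/eqP: E; rewrite sum_nat_eq0 => /forallP/(_ i).
  have [i hi] : exists i, kr n i != 0%N.
    apply/existsP; apply: contraT; rewrite negb_exists => /forallP hh.
    by move: E; rewrite big1 // => i _; apply/eqP; have := hh i; rewrite negbK.
  case/eqP: (h1 i); apply/ffunP => j; rewrite [RHS]ffunE.
  move: E; rewrite (bigD1 i) //=; set S := (\sum_(_ < _ | _) _)%N => E.
  have [ki /eqP S0] : kr n i = 1%N /\ S = 0%N.
    by rewrite -lt0n in hi; lia.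
  have [->//|ji] := eqVneq j i.
  by move: S0; rewrite sum_nat_eq0 => /forall_inP/(_ j ji)/eqP.
have polyws y h : polydisc (ws m) y -> polydisc (ws m) h ->
    polydisc (ws (m + m)%N) (row_mx y h).
  move=> hy hh i; rewrite !mxE; case: splitP => j _.
    by have := hy j; rewrite mxE.
  by have := hh j; rewrite mxE.
have normws (h : 'rV[R]_m) : `|h| <= s -> polydisc (ws m) h.
  by move=> hs' i; rewrite mxE; apply: le_trans hs'; exact: rv_norm_ge.
have rem_le y h : polydisc (ws m) y -> `|h| <= s ->
    `|rem (row_mx y h)| <= C / s ^+ 2 * `|h| ^+ 2.
  move=> hy hh; have hz := polyws _ _ hy (normws _ hh).
  apply: sum_to_le (hrem _ hz).
  (* [h] lies in the polydisc shrunk by [t], where every monomial of degree at least 2 gains a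
     factor [t ^+ 2]. *)
  pose t := `|h| / s.
  have t0 : 0 <= t by rewrite divr_ge0 // ltW.
  have t1 : t <= 1 by rewrite ler_pdivrMr // mul1r.
  have -> : C / s ^+ 2 * `|h| ^+ 2 = `|t ^+ 2| * C.
    by rewrite ger0_norm ?exprn_ge0 // /t (expr_div_n `|h|) mulrC mulrA mulrAC.
  have [u uE] : exists u, u = t ^+ 2 by exists (t ^+ 2).
  have u0 : 0 <= u by rewrite uE exprn_ge0.
  rewrite -uE; apply: abs_bounded_le (abs_boundedZ u hb) => n.
  case: (boolP (big n)) => [/krdeg[p hp]|_]; last by rewrite mulr0 mul0r normr0.
  rewrite mulr1 kE kws !normrM !(ger0_norm (mws0 _ _)) (ger0_norm u0).
  rewrite [leRHS]mulrCA; apply: ler_wpM2l => //; rewrite [leRHS]mulrCA.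
  apply: ler_pM => //; first exact: monomial_le.
  have ht : polydisc (t *: ws m) h.
    by move=> i; rewrite !mxE divfK ?gt_eqF //; exact: rv_norm_ge.
  apply: le_trans (monomial_le _ ht) _.
  rewrite monomialZ hp uE; apply: ler_wpM2r => //.
  rewrite -addn2 exprD ler_piMl ?exprn_ge0 //; exact: exprn_ile1.
have expand y h : polydisc (ws m) y -> `|h| <= s ->
    f (y + h) = f0 y + dot (\row_i df i y) h + rem (row_mx y h).
  move=> hy hh; have hz := polyws _ _ hy (normws _ hh).
  have := hs _ hz; rewrite row_mxKl row_mxKr => /sum_to_unique; apply.
  have Sd i : sum_to (fun n => h 0 i * (c n * (kr n == e_ i)%:R * monomial (kl n) y))
    (h 0 i * df i y) by apply: sum_toZ; exact: (hdf i).2.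
  apply: eq_sum_to (sum_toD (sum_toD (hf0 _ hy) (sum_to_big (index_enum 'I_m) Sd))
    (hrem _ hz)) => [n|]; last first.
    by congr (_ + _ + _); apply: eq_bigr => i _; rewrite mxE.
  rewrite /= kE; case: (eqVneq (kr n) z_) => [E|kz].
    rewrite /big E eqxx /= mulr0 mul0r addr0 monomial0 !mulr1 big1 ?addr0 // => i _.
    have /negPf -> : z_ != e_ i by apply/eqP => /ffunP/(_ i); rewrite !ffunE eqxx.
    by rewrite mulr0 mul0r mulr0.
  rewrite mulr0 mul0r add0r; case: (boolP [forall i, kr n != e_ i]) => [hn|].
    rewrite /big kz hn /= mulr1 big1 ?add0r // => i _.
    by have /forallP/(_ i)/negPf -> := hn; rewrite mulr0 mul0r mulr0.
  rewrite /big negb_forall => /[dup] hn /existsP[i /negbNE/eqP ki].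
  have -> : [forall i, kr n != e_ i] = false by apply/negbTE; rewrite negb_forall.
  rewrite andbF mulr0 mul0r addr0 (bigD1 i) //= ki eqxx mulr1 big1 ?addr0 => [|j ji].
    by rewrite monomial_coord; ring.
  have /negPf -> : e_ i != e_ j.
    by apply/eqP => /ffunP/(_ i); rewrite !ffunE eqxx eq_sym (negPf ji).
  by rewrite mulr0 mul0r mulr0.
exists df; split=> [i|].
  by exists s, (`|s^-1| * C); split => //; case: (hdf i).
apply/nbhs0_polydisc; exists s; split=> // y hy.
have hf0y : f y = f0 y.
  have := expand y 0 hy; rewrite normr0 (ltW s0) linear0 addr0 => -> //.
  rewrite addr0; apply/eqP; rewrite -subr_eq0 addrC addKr -normr_le0.
  by have := rem_le y 0 hy; rewrite normr0 expr0n mulr0 (ltW s0); apply.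
have [|d1 d2] := @diff_of_quadratic_remainder m f y (\row_i df i y) (C / s ^+ 2) s s0.
  move=> h hh; rewrite [h + y]addrC (expand _ _ hy hh) hf0y.
  have -> (a b d : R) : a + b + d - a - b = d by ring.
  exact: rem_le.
split=> // v; rewrite d2; apply: eq_bigr => i _; by rewrite mxE.
Qed.

End Derivatives.

(** * Rules of differentiation, and germs vanishing along an ultrafilter *)

Section GermCalculus.
Context {R : realType}.

Section Rules.
Context {V : normedModType R}.
Implicit Types (f g : V -> R) (x v : V).

Lemma fderivD f g x v : derivable f x v -> derivable g x v ->
  derivable (fun y => f y + g y) x v /\
  'D_v (fun y => f y + g y) x = 'D_v f x + 'D_v g x.
Proof. by move=> hf hg; split; [exact: derivableD|exact: deriveD]. Qed.

Lemma fderivB f g x v : derivable f x v -> derivable g x v ->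
  derivable (fun y => f y - g y) x v /\
  'D_v (fun y => f y - g y) x = 'D_v f x - 'D_v g x.
Proof. by move=> hf hg; split; [exact: derivableB|exact: deriveB]. Qed.

Lemma fderivM f g x v : derivable f x v -> derivable g x v ->
  derivable (fun y => f y * g y) x v /\
  'D_v (fun y => f y * g y) x = f x * 'D_v g x + g x * 'D_v f x.
Proof. have -> : (fun y => f y * g y) = f * g by apply/funext.
move=> hf hg; split; [exact: derivableM hf hg|exact: deriveM hf hg]. Qed.

Lemma fderiv_cst (c : R) x v :
  derivable (fun _ : V => c) x v /\ 'D_v (fun _ : V => c) x = 0.
Proof. by split; [exact: derivable_cst|exact: derive_cst]. Qed.

Lemma fderivX f n x v : derivable f x v ->
  derivable (fun y => f y ^+ n) x v /\
  'D_v (fun y => f y ^+ n) x = n%:R * f x ^+ n.-1 * 'D_v f x.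
Proof.
move=> hf; elim: n => [|n [IH1 IH2]].
  by have [h1 h2] := fderiv_cst 1 x v; rewrite !mul0r.
have -> : (fun y => f y ^+ n.+1) = (fun y => f y * f y ^+ n).
  by apply/funext => y; rewrite exprS.
have [h1 ->] := fderivM hf IH1; split=> //; rewrite IH2 /=.
case: n {IH1 IH2 h1} => [|n]; first by rewrite !mul0r mulr0 add0r !mul1r.
by rewrite /= exprS (mulrSr 1 n.+1); ring.
Qed.

Lemma fderiv_sum (n : nat) (f : nat -> V -> R) x v :
  (forall i, (i < n)%N -> derivable (f i) x v) ->
  derivable (fun y => \sum_(i < n) f i y) x v /\
  'D_v (fun y => \sum_(i < n) f i y) x = \sum_(i < n) 'D_v (f i) x.
Proof.
elim: n => [|n IH] h.
  have -> : (fun y => \sum_(i < 0) f i y) = (fun=> 0).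
    by apply/funext => y; rewrite big_ord0.
  by rewrite big_ord0; exact: fderiv_cst.
have [|h1 h2] := IH; first by move=> i ni; apply: h; apply: leqW.
have -> : (fun y => \sum_(i < n.+1) f i y) = (fun y => \sum_(i < n) f i y + f n y).
  by apply/funext => y; rewrite big_ord_recr.
by have [h3 ->] := fderivD h1 (h n (leqnn _)); rewrite big_ord_recr /= h2.
Qed.

End Rules.

Lemma near0W (m : nat) (P Q : set 'rV[R]_m) : (forall x, P x -> Q x) ->
  (\forall x \near (0 : 'rV[R]_m), P x) -> \forall x \near (0 : 'rV[R]_m), Q x.
Proof.
move=> h /nbhs0_polydisc[r [r0 hr]]; apply/nbhs0_polydisc; exists r; split=> // x.
by move/hr/h.
Qed.

Lemma near0I (m : nat) (P Q : set 'rV[R]_m) : (\forall x \near (0 : 'rV[R]_m), P x) ->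
  (\forall x \near (0 : 'rV[R]_m), Q x) -> \forall x \near (0 : 'rV[R]_m), P x /\ Q x.
Proof.
move=> /nbhs0_polydisc[r [r0 hr]] /nbhs0_polydisc[s [s0 hs]].
apply/nbhs0_polydisc; exists (Num.min r s); split; first by rewrite lt_min r0.
move=> x hx; split; [apply: hr|apply: hs]; apply: polydisc_const_le hx;
  by rewrite ge_min lexx ?orbT.
Qed.

Lemma near0T (m : nat) (P : set 'rV[R]_m) : (forall x, P x) ->
  \forall x \near (0 : 'rV[R]_m), P x.
Proof. by move=> h; apply/nbhs0_polydisc; exists 1; split. Qed.

Lemma near0_forall (m : nat) (n : nat) (P : nat -> set 'rV[R]_m) :
  (forall i, \forall x \near (0 : 'rV[R]_m), P i x) ->
  \forall x \near (0 : 'rV[R]_m), forall i, (i < n)%N -> P i x.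
Proof.
move=> h; elim: n => [|n IH]; first exact: near0T.
apply: near0W (near0I IH (h n)) => x [h1 h2] i.
by rewrite ltnS leq_eqVlt => /orP[/eqP ->//|]; exact: h1.
Qed.

Lemma analytic0_near_diff (m : nat) (f : 'rV[R]_m -> R) : analytic0 f ->
  \forall x \near (0 : 'rV[R]_m), differentiable f x.
Proof. by move=> /analytic0_derivative[df [_ h]]; apply: near0W h => x []. Qed.

Lemma analytic0_derive (m : nat) (f : 'rV[R]_m -> R) (v : 'rV[R]_m -> 'rV[R]_m) :
  analytic0 f -> (forall i, analytic0 (fun x => v x 0 i)) -> analytic0 (fun x => 'D_(v x) f x).
Proof.
move=> /analytic0_derivative[df [hdf h]] hv.
apply: (@analytic0_ext _ _ (fun x => \sum_i v x 0 i * df i x)).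
  by apply: analytic0_sum => i; apply: analytic0M.
by apply: near0W h => x [_ ->].
Qed.

Lemma analytic0_cvg0 (m : nat) (f : 'rV[R]_m -> R) e : analytic0 f -> 0 < e ->
  \forall x \near (0 : 'rV[R]_m), `|f x - f 0| <= e.
Proof.
move=> hf e0; have [d [d0 hd]] := analytic0_vanish_small
  (analytic0B hf (analytic0_cst (f 0))) (subrr _) e0.
apply/nbhs0_polydisc; exists d; split=> // x hx.
by apply: (pseries_bound (hd (const_mx d) _) hx) => i; rewrite mxE lexx ltW.
Qed.

Lemma analytic0_near_neq0 (m : nat) (f : 'rV[R]_m -> R) : analytic0 f -> f 0 != 0 ->
  \forall x \near (0 : 'rV[R]_m), f x != 0.
Proof.
move=> hf f0; have e0 : 0 < `|f 0| / 2 by rewrite divr_gt0 ?normr_gt0.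
apply: near0W (analytic0_cvg0 hf e0) => x; apply: contraTN => /eqP ->.
by rewrite sub0r normrN -ltNge ltr_pdivrMr // ltr_pMr ?normr_gt0 // ltr1n.
Qed.

Lemma near0_pullback (m p : nat) (phi : 'rV[R]_p -> 'rV[R]_m) (P : set 'rV[R]_m) :
  (forall i, analytic0 (fun x => phi x 0 i)) -> phi 0 = 0 ->
  (\forall y \near (0 : 'rV[R]_m), P y) -> \forall x \near (0 : 'rV[R]_p), P (phi x).
Proof.
move=> hphi phi0 /nbhs0_polydisc[r [r0 hr]].
have /choice[d hd] i := analytic0_vanish_small (hphi i)
  (etrans (congr1 (fun z : 'rV[R]_m => z 0 i) phi0) (mxE _ _ _ _)) r0.
apply/nbhs0_polydisc; exists (\big[Num.min/1]_i d i).
have d0 : 0 < \big[Num.min/1]_i d i by apply: lt_bigmin => // i _; case: (hd i).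
split=> // x hx; apply: hr => i; rewrite [leRHS]mxE.
apply: (pseries_bound ((hd i).2 (const_mx (\big[Num.min/1]_i d i)) _)) hx => j.
by rewrite mxE (ltW d0) /=; exact: bigmin_le_cond.
Qed.

Section Pullback.
Context {m : nat}.
Implicit Types (x v : 'rV[R]_m.+1) (f : 'rV[R]_m -> R).

Lemma tl_is_linear (t : R) v x : tl (t *: v + x) = t *: tl v + tl x.
Proof. by apply/rowP => i; rewrite !mxE. Qed.

Lemma hd_is_linear (t : R) v x : hd (t *: v + x) = t * hd v + hd x.
Proof. by rewrite /hd !mxE. Qed.

Lemma tl0 : tl (0 : 'rV[R]_m.+1) = 0.
Proof. by apply/rowP => i; rewrite !mxE. Qed.

Lemma difference_quotient_tl f x v :
  (fun h : R => h^-1 *: (((fun y => f (tl y)) \o shift x) (h *: v) - f (tl x)))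
  = (fun h : R => h^-1 *: ((f \o shift (tl x)) (h *: tl v) - f (tl x))).
Proof. by apply/funext => h; rewrite /= tl_is_linear. Qed.

Lemma derivable_tl f x v : derivable f (tl x) (tl v) ->
  derivable (fun y => f (tl y)) x v.
Proof. by rewrite /derivable difference_quotient_tl. Qed.

Lemma derive_tl f x v : 'D_v (fun y => f (tl y)) x = 'D_(tl v) f (tl x).
Proof. by rewrite /derive difference_quotient_tl. Qed.

Lemma fderiv_hd x v : derivable (@hd R m) x v /\ 'D_v (@hd R m) x = hd v.
Proof.
have [|d1 d2] := @diff_of_quadratic_remainder R _ (@hd R m) x (delta_mx 0 ord0) 0 1 ltr01.
  move=> h _; rewrite -{1}(scale1r h) hd_is_linear mul1r mul0r addrK.
  rewrite /dot (bigD1 ord0) //= big1 => [|i /negPf i0]; rewrite !mxE /= ?i0 ?mulr0 //.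
  by rewrite ?eqxx mulr1 addr0 subrr normr0.
split; first exact: diff_derivable.
rewrite d2 /dot (bigD1 ord0) //= big1 => [|i /negPf i0]; rewrite !mxE /= ?i0 ?mulr0 //.
by rewrite ?eqxx mulr1 addr0.
Qed.

Lemma near0_tl (P : set 'rV[R]_m) : (\forall y \near (0 : 'rV[R]_m), P y) ->
  \forall x \near (0 : 'rV[R]_m.+1), P (tl x).
Proof.
move=> /nbhs0_polydisc[r [r0 hr]]; apply/nbhs0_polydisc; exists r; split=> // x hx.
by apply: hr => i; have := hx (lift ord0 i); rewrite !mxE.
Qed.

Lemma analytic0_tl f : analytic0 f -> analytic0 (fun x => f (tl x)).
Proof.
move=> hf; apply: analytic0_comp hf _ tl0 => i.
by apply: (analytic0_eq (analytic0_coord (lift ord0 i))) => x; rewrite mxE.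
Qed.

Lemma analytic0_hd : analytic0 (@hd R m).
Proof. exact: analytic0_coord. Qed.

Lemma fderiv_poly (n : nat) (r : nat -> 'rV[R]_m -> R) x v :
  (forall i, (i < n)%N -> differentiable (r i) (tl x)) ->
  derivable (fun y => \sum_(i < n) r i (tl y) * hd y ^+ i) x v /\
  'D_v (fun y => \sum_(i < n) r i (tl y) * hd y ^+ i) x =
    \sum_(i < n) 'D_(tl v) (r i) (tl x) * hd x ^+ i
    + (\sum_(i < n) i%:R * r i (tl x) * hd x ^+ i.-1) * hd v.
Proof.
move=> h; have [h1 h2] := fderiv_hd x v.
have hi i : (i < n)%N -> derivable (fun y => r i (tl y) * hd y ^+ i) x v /\
   'D_v (fun y => r i (tl y) * hd y ^+ i) x =
   'D_(tl v) (r i) (tl x) * hd x ^+ i + i%:R * r i (tl x) * hd x ^+ i.-1 * hd v.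
  move=> ni; have [h3 h4] := fderivX i h1.
  have h5 : derivable (fun y => r i (tl y)) x v.
    by apply: derivable_tl; apply: diff_derivable; exact: h.
  have [h6 ->] := fderivM h5 h3; split=> //.
  by rewrite h4 h2 derive_tl; ring.
have [|h3 ->] := fderiv_sum (n := n) (f := fun i y => r i (tl y) * hd y ^+ i) (x := x) (v := v).
  by move=> i /hi[].
split=> //; rewrite mulr_suml -big_split /=; apply: eq_bigr => i _.
by have [_ ->] := hi i (ltn_ord i).
Qed.

End Pullback.

Section Ultra.
Context {m : nat} (U : set_system 'rV[R]_m) {FU : UltraFilter U}
  (U0 : forall P : set 'rV[R]_m, (\forall x \near (0 : 'rV[R]_m), P x) -> U P).
Implicit Types (f g : 'rV[R]_m -> R).

Definition vanish f : Prop := U [set x | f x = 0].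

Lemma vanish_neg f : ~ vanish f -> U [set x | f x != 0].
Proof.
move=> h; have [//|h'] := in_ultra_setVsetC [set x | f x = 0] FU.
by apply: filterS h' => x /eqP.
Qed.

Lemma not_vanish f : U [set x | f x != 0] -> ~ vanish f.
Proof.
by move=> h1 h2; have [x [/= /eqP]] := filter_ex (filterI h1 h2).
Qed.

Lemma vanishD f g : vanish f -> vanish g -> vanish (fun x => f x + g x).
Proof. by move=> hf hg; apply: filterS (filterI hf hg) => x [/= -> ->]; rewrite addr0. Qed.

Lemma vanishMl f g : vanish g -> vanish (fun x => f x * g x).
Proof. by apply: filterS => x /= ->; rewrite mulr0. Qed.

(** Primality of the ideal of germs vanishing along [U]; it replaces division in a field of
    fractions. *)
Lemma vanish_cancel f g : ~ vanish f -> vanish (fun x => f x * g x) -> vanish g.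
Proof.
move=> /vanish_neg hf hfg; apply: filterS (filterI hf hfg) => x [/= f0 /eqP].
by rewrite mulf_eq0 (negPf f0) => /eqP.
Qed.

Lemma vanish_ext f g : vanish f -> U [set x | f x = g x] -> vanish g.
Proof. by move=> hf hfg; apply: filterS (filterI hf hfg) => x [/= h <-]. Qed.

Lemma vanish_eq f g : vanish f -> f =1 g -> vanish g.
Proof. by move=> h /funext <-. Qed.

Lemma vanish_sum n (f : nat -> 'rV[R]_m -> R) :
  (forall i, (i < n)%N -> vanish (f i)) -> vanish (fun x => \sum_(i < n) f i x).
Proof.
elim: n => [|n IH] h; first by apply: filterS filterT => x _ /=; rewrite big_ord0.
have h1 : vanish (fun x => \sum_(i < n) f i x) by apply: IH => i ni; apply/h/leqW.
by apply: vanish_eq (vanishD h1 (h n (leqnn _))) _ => x; rewrite big_ord_recr.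
Qed.

(* A polynomial vanishing at the values of z vanishes, along an ultrafilter, through
   a single one of its roots. *)
Lemma ultra_poly_root (p : {poly R}) (z : 'rV[R]_m -> R) :
  p != 0 -> U [set x | p.[z x] = 0] -> exists c, U [set x | z x = c].
Proof.
have [n] := ubnP (size p); elim: n p => [//|n IH] p sp p0 hp.
have [x hx] := filter_ex hp.
have /factor_theorem[q pq] : root p (z x) by apply/rootP.
have q0 : q != 0 by apply: contraNneq p0 => q0; rewrite pq q0 mul0r.
have [h|h] := in_ultra_setVsetC [set y | z y = z x] FU; first by exists (z x).
apply: (IH q) => //.
  move: sp; rewrite pq size_Mmonic ?monicXsubC // size_XsubC addn2 /=.
  by rewrite ltnS.
apply: filterS (filterI hp h) => y [/=]; rewrite pq hornerM hornerXsubC => /eqP.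
by rewrite mulf_eq0 => /orP[/eqP //|]; rewrite subr_eq0 => /eqP.
Qed.

End Ultra.

Lemma ultra_of_or (T : Type) (F : set_system T) (FF : ProperFilter F) :
  (forall A : set T, F A \/ F (~` A)) -> UltraFilter F.
Proof.
move=> h; split=> // G GG FG; apply/seteqP; split=> [A GA|]; last exact: FG.
by have [//|/FG h'] := h A; have [x []] := filter_ex (filterI GA h').
Qed.

(** Along the projection [tl] this contracts the ideal to the germs that do not depend on the first
    variable; along a shear it is a change of coordinates. *)
Definition push (T T' : Type) (f : T -> T') (U : set_system T) : set_system T' :=
  [set P | U (f @^-1` P)].

Lemma push_ultra (T T' : Type) (f : T -> T') (U : set_system T) :
  UltraFilter U -> UltraFilter (push f U).
Proof.
move=> FU; have PU : ProperFilter (push f U).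
  by apply: Build_ProperFilter; exact: (filter_not_empty U).
apply: ultra_of_or => A; exact: (in_ultra_setVsetC (f @^-1` A) FU).
Qed.

End GermCalculus.

#[global] Existing Instance push_ultra.

(** * Weierstrass division and preparation for germs *)

Section GermWeierstrass.
Context {R : realType}.

Lemma polydisc_uniform (m : nat) (w : 'rV[R]_m) : (forall i, 0 < w 0 i) ->
  exists r, 0 < r /\ polydisc w (const_mx r).
Proof.
move=> w0; exists (\big[Num.min/1]_i w 0 i).
have r0 : 0 < \big[Num.min/1]_i w 0 i by apply: lt_bigmin.
by split=> // i; rewrite mxE ger0_norm ?(ltW r0) //; exact: bigmin_le_cond.
Qed.

Lemma pseries_analytic0 (m : nat) (w : 'rV[R]_m) f C :
  (forall i, 0 < w 0 i) -> pseries w f C -> analytic0 f.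
Proof.
move=> /polydisc_uniform[r [r0 rw]] hf; exists r, C; split=> //.
exact: pseries_shrink rw hf.
Qed.

Lemma near0_polydisc (m : nat) (w : 'rV[R]_m) : (forall i, 0 < w 0 i) ->
  \forall x \near (0 : 'rV[R]_m), polydisc w x.
Proof.
move=> /polydisc_uniform[r [r0 rw]]; apply/nbhs0_polydisc; exists r; split=> // x.
exact: polydisc_trans.
Qed.

Section Regular.
Context {m n : nat} (g : 'rV[R]_m.+1 -> R) (g_regular : regular_in_hd n g).

Lemma weierstrass_division (h : 'rV[R]_m.+1 -> R) : analytic0 h ->
  exists (q : 'rV[R]_m.+1 -> R) (r : nat -> 'rV[R]_m -> R),
  [/\ analytic0 q, forall i, analytic0 (r i) &
   \forall x \near (0 : 'rV[R]_m.+1),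
     h x = q x * g x + \sum_(i < n) r i (tl x) * hd x ^+ i].
Proof.
move=> /analytic0_small[C [d [d0 hh]]].
have [w [u [u0 w0 hg]]] := regular_approx g_regular d0.
have wp i : 0 < w 0 i by have /andP[] := w0 i.
have wn i : 0 <= w 0 i := ltW (wp i).
have hw : pseries w h C by apply: hh => i; have /andP[h1 ->] := w0 i; rewrite ltW.
have [q [r [hq hr E]]] := weierstrass_division_pseries (wp ord0) wn u0 hg hw.
exists q, r; split.
- exact: pseries_analytic0 hq.
- by move=> i; apply: pseries_analytic0 (hr i) => j; rewrite mxE.
- exact: near0W E (near0_polydisc wp).
Qed.

(** The germ divided by [g] is [hd x ^+ n - u^-1 * g x], of norm at most [hd w ^+ n / 4]. Its
    quotient [q] is therefore bounded by [|u|^-1 / 2], and the factor [u^-1 + q] has no zero. *)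
Lemma weierstrass_preparation :
  exists (q : 'rV[R]_m.+1 -> R) (r : nat -> 'rV[R]_m -> R),
  [/\ analytic0 q, forall i, analytic0 (r i) &
   \forall x \near (0 : 'rV[R]_m.+1), q x != 0 /\
     hd x ^+ n - \sum_(i < n) r i (tl x) * hd x ^+ i = q x * g x].
Proof.
have [w [u [u0 w0 hg]]] := regular_approx g_regular ltr01.
have wp i : 0 < w 0 i by have /andP[] := w0 i.
have wn i : 0 <= w 0 i := ltW (wp i).
have pu : 0 < `|u| by rewrite normr_gt0.
have pw : 0 < hd w ^+ n by rewrite exprn_gt0 // wp.
have hE : pseries w (fun x => - u^-1 * (g x - u * hd x ^+ n)) (hd w ^+ n / 4).
  apply: pseriesW (pseriesZ (- u^-1) hg); rewrite normrN normfV le_eqVlt; apply/orP; left.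
  by apply/eqP; field; rewrite gt_eqF.
have [q [r [hq hr E]]] := weierstrass_division_pseries (wp ord0) wn u0 hg hE.
exists (fun x => u^-1 + q x), r; split.
- exact: analytic0D (analytic0_cst _) (pseries_analytic0 wp hq).
- by move=> i; apply: pseries_analytic0 (hr i) => j; rewrite mxE.
apply: near0W (near0_polydisc wp) => x xw; split.
  have := pseries_bound hq xw; apply: contraTneq => h.
  have -> : q x = - u^-1 by apply/eqP; rewrite -addr_eq0 addrC h.
  rewrite normrN normfV -ltNge.
  have -> : 2 * (hd w ^+ n / 4 / (`|u| * hd w ^+ n)) = `|u|^-1 / 2.
    by field; rewrite !gt_eqF // wp.
  by rewrite ltr_pdivrMr // ltr_pMr ?invr_gt0 // ltr1n.
rewrite mulrDl; have := E _ xw; set S := \sum_(i < n) _ => h.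
have -> : q x * g x = - u^-1 * (g x - u * hd x ^+ n) - S by rewrite h addrK.
by field.
Qed.

End Regular.

(** * Algebraic relations along an ultrafilter *)

Section Elimination.
Context {m : nat} (V : set_system 'rV[R]_m) {FV : UltraFilter V}.

(** Linear dependence of [n.+1] vectors with [n] entries over the fraction field modulo the ideal.
    Gaussian elimination is carried out without division, rows being multiplied by the pivot. *)
Lemma elimination n (r : nat -> nat -> 'rV[R]_m -> R) :
  (forall i j, analytic0 (r i j)) -> exists al : nat -> 'rV[R]_m -> R,
  [/\ forall i, analytic0 (al i), exists i, (i <= n)%N /\ ~ vanish V (al i) &
   forall j, (j < n)%N -> vanish V (fun y => \sum_(i < n.+1) al i y * r i j y)].
Proof.
elim: n r => [|n IH] r hr.
  exists (fun _ _ => 1); split => //; first by move=> i; exact: analytic0_cst.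
  exists 0%N; split=> //; apply: not_vanish; apply: filterS filterT => y _ /=.
  exact: oner_neq0.
have [all0|] := pselect (forall i, (i <= n.+1)%N -> vanish V (r i n)).
  have [al [h1 [i0 [i0n h2]] h3]] := IH _ hr.
  exists (fun i => if (i <= n)%N then al i else fun=> 0); split.
  - by move=> i; case: ifP => _ //; exact: analytic0_cst.
  - by exists i0; rewrite i0n (leqW i0n).
  move=> j; rewrite ltnS leq_eqVlt => /orP[/eqP ->|jn].
    apply: (vanish_sum (f := fun i y => (if (i <= n)%N then al i else fun=> 0) y * r i n y)).
    by move=> i ni; apply: vanishMl; apply: all0.
  apply: vanish_eq (h3 j jn) _ => y; rewrite [RHS]big_ord_recr /= ltnn mul0r addr0.
  by apply: eq_bigr => i _; rewrite -ltnS ltn_ord.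
move=> /existsNP[p /not_implyP[pn hp]].
(* [s] runs over the rows other than the pivot row [p], and [r'] clears column [n] in them. In [be],
   the coefficient of row [p] is the one that makes column [n] cancel. *)
pose s i := bump p i.
pose r' i j y := r p n y * r (s i) j y - r (s i) n y * r p j y.
have [|al [h1 [i0 [i0n h2]] h3]] := IH r'.
  by move=> i j; apply: analytic0B; apply: analytic0M.
pose be k := if k == p then fun y => - \sum_(i < n.+1) al i y * r (s i) n y
  else fun y => r p n y * al (unbump p k) y.
have beE j y : \sum_(k < n.+2) be k y * r k j y = \sum_(i < n.+1) al i y * r' i j y.
  rewrite (bigD1_ord (Ordinal (pn : (p < n.+2)%N))) //= /be eqxx mulNr mulr_suml.
  rewrite -sumrN -big_split /=; apply: eq_bigr => i _.
  by rewrite eq_sym (negPf (neq_bump p i)) bumpK /r' /s; ring.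
exists be; split.
- move=> k; rewrite /be; case: eqP => _; last exact: analytic0M.
  by apply/analytic0N/analytic0_sum => i; apply: analytic0M.
- exists (s i0); split.
    by rewrite /s /bump -addn1 addnC leq_add // leq_b1.
  rewrite /be eq_sym (negPf (neq_bump p i0)) bumpK => h; exact/h2/(vanish_cancel hp h).
- move=> j; rewrite ltnS leq_eqVlt => /orP[/eqP ->|jn].
    apply: filterS filterT => y _ /=; rewrite beE big1 // => i _.
    by rewrite /r' mulrC mulrBl; ring.
  by apply: vanish_eq (h3 j jn) _ => y; rewrite beE.
Qed.

End Elimination.

Section Relations.
Context {m : nat} (U : set_system 'rV[R]_m.+1) {FU : UltraFilter U}.
Local Notation V := (push tl U).

(** Where [b x] is nonzero, this is [b x ^+ n.-1] times a polynomial with [n] coefficients in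
    [a x / b x]: an equation for the quotient with its denominators cleared. *)
Definition homog_form (n : nat) (al : nat -> 'rV[R]_m -> R) (a b : 'rV[R]_m.+1 -> R)
    (x : 'rV[R]_m.+1) : R :=
  \sum_(i < n) al i (tl x) * a x ^+ i * b x ^+ (n.-1 - i).

Lemma homog_formS n al a b x : homog_form n.+1 al a b x =
  b x * homog_form n al a b x + al n (tl x) * a x ^+ n.
Proof.
rewrite /homog_form big_ord_recr /= subnn expr0 mulr1 mulr_sumr; congr (_ + _).
apply: eq_bigr => i _; have -> : (n - i)%N = (n.-1 - i).+1.
  by have := ltn_ord i; case: n i => [|n] i //= ni; rewrite subSn.
by rewrite exprS; ring.
Qed.

Context (a b : 'rV[R]_m.+1 -> R) (hb : ~ vanish U b).

Definition relation (e : nat) (al : nat -> 'rV[R]_m -> R) : Prop :=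
  [/\ forall i, analytic0 (al i), ~ vanish V (al e) & vanish U (homog_form e.+1 al a b)].

(** A leading coefficient in the ideal leaves a multiple of [b], and cancelling [b] lowers the
    degree by one. *)
Lemma relation_truncate n al : (forall i, analytic0 (al i)) -> vanish U (homog_form n al a b) ->
  (exists i, (i < n)%N /\ ~ vanish V (al i)) -> exists e, (e < n)%N /\ relation e al.
Proof.
move=> hal; elim: n => [|n IH] h [i [ni hi]] //.
have [hn|hn] := pselect (vanish V (al n)); last by exists n; split.
have h' : vanish U (homog_form n al a b).
  apply: (vanish_cancel hb).
  apply: filterS (filterI h (hn : vanish U (fun x => al n (tl x)))) => x [/= + an0].
  by rewrite homog_formS an0 mul0r addr0.
have [|e [en he]] := IH h'; last by exists e; split=> //; exact: leqW.
exists i; split=> //; move: ni; rewrite ltnS leq_eqVlt => /orP[/eqP ie|//].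
by rewrite ie in hi.
Qed.

(** [fin] says that modulo the ideal the germs are generated by [n] powers of [hd] over the germs in
    fewer variables, so the [n.+1] products [a ^+ i * b ^+ (n - i)] are dependent. In the conclusion
    [l] counts terms: [l <= e] means degree below [e]. *)
Lemma minimal_relation (n : nat) :
  (forall h, analytic0 h -> exists r : nat -> 'rV[R]_m -> R, (forall i, analytic0 (r i)) /\
     U [set x | h x = \sum_(i < n) r i (tl x) * hd x ^+ i]) ->
  analytic0 a -> analytic0 b ->
  exists e al, relation e al /\
    forall l be, (l <= e)%N -> (forall i, analytic0 (be i)) ->
      vanish U (homog_form l be a b) -> forall i, (i < l)%N -> vanish V (be i).
Proof.
move=> fin ha hb'.
have ex : exists e, `[< exists al, relation e al >].
  have /choice[r hr] i := fin _ (analytic0M (analytic0X i ha) (analytic0X (n - i) hb')).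
  have [|al [h1 [i [ni hi]] h3]] := @elimination m V _ n r; first by move=> i; case: (hr i).
  have hN : vanish U (homog_form n.+1 al a b).
    have h4 k : U [set x | forall i, (i <= k)%N ->
        a x ^+ i * b x ^+ (n - i) = \sum_(j < n) r i j (tl x) * hd x ^+ j].
      elim: k => [|k IHk].
        by apply: filterS (hr 0%N).2 => x /= E j; rewrite leqn0 => /eqP ->.
      apply: filterS (filterI IHk (hr k.+1).2) => x [/= E1 E2] j.
      by rewrite leq_eqVlt => /orP[/eqP ->|]; [|exact: E1].
    have h5 : vanish U (fun x => \sum_(j < n) (hd x ^+ j *
        \sum_(i < n.+1) al i (tl x) * r i j (tl x))).
      apply: (vanish_sum (f := fun j x => hd x ^+ j *
        \sum_(i < n.+1) al i (tl x) * r i j (tl x))) => j jn.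
      have h3' : vanish U (fun x => \sum_(i < n.+1) al i (tl x) * r i j (tl x)) := h3 j jn.
      exact: vanishMl.
    apply: vanish_ext h5 _; apply: filterS (h4 n) => x E /=.
    rewrite /homog_form; under eq_bigr do rewrite mulr_sumr.
    rewrite exchange_big /=; apply: eq_bigr => k _.
    have kn : (k <= n)%N by rewrite -ltnS.
    by rewrite -mulrA (E k kn) mulr_sumr; apply: eq_bigr => j _; ring.
  have [|e [_ he]] := relation_truncate h1 hN; first by exists i; rewrite ltnS.
  by exists e; apply/asboolP; exists al.
case: (ex_minnP ex) => e /asboolP[al hal] emin.
exists e, al; split=> // l be le hbe hv i il.
have [//|hi] := pselect (vanish V (be i)).
have [|e' [e'l he']] := relation_truncate hbe hv; first by exists i.
have : (e <= e')%N by apply: emin; apply/asboolP; exists be.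
by rewrite leqNgt (leq_trans e'l le).
Qed.

End Relations.

End GermWeierstrass.

(** * Derivations and constants *)

Section Derivations.
Context {R : realType}.

Definition admissible (m : nat) (U : set_system 'rV[R]_m)
    (v : 'rV[R]_m -> 'rV[R]_m) : Prop :=
  (forall i, analytic0 (fun x => v x 0 i)) /\
  forall h, analytic0 h -> vanish U h -> vanish U (fun x => 'D_(v x) h x).

Definition finer_than_nbhs0 (m : nat) (U : set_system 'rV[R]_m) : Prop :=
  forall P : set 'rV[R]_m, (\forall x \near (0 : 'rV[R]_m), P x) -> U P.

(* a / b is a constant of all the derivations induced modulo the prime ideal of the germs
   vanishing along U. *)
Definition constants_are_scalars (m : nat) : Prop :=
  forall (U : set_system 'rV[R]_m) (a b : 'rV[R]_m -> R),
    UltraFilter U -> finer_than_nbhs0 U -> analytic0 a -> analytic0 b -> ~ vanish U b ->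
    (forall v, admissible U v ->
       vanish U (fun x => b x * 'D_(v x) a x - a x * 'D_(v x) b x)) ->
    exists c, vanish U (fun x => a x - c * b x).

Lemma near0_near (m : nat) (P : set 'rV[R]_m) :
  (\forall x \near (0 : 'rV[R]_m), P x) ->
  \forall x \near (0 : 'rV[R]_m), \forall y \near x, P y.
Proof. exact: nbhs_interior. Qed.

Lemma deriveZv (m : nat) (f : 'rV[R]_m -> R) x (c : R) v :
  differentiable f x -> 'D_(c *: v) f x = c * 'D_v f x.
Proof. by move=> h; rewrite !deriveE // linearZ. Qed.

Definition tpoly (m n : nat) (r : nat -> 'rV[R]_m -> R) (x : 'rV[R]_m.+1) : R :=
  \sum_(i < n) r i (tl x) * hd x ^+ i.

Lemma homog_form_tpoly (m n : nat) (r : nat -> 'rV[R]_m -> R) :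
  homog_form n r (@hd R m) (fun=> 1) = tpoly n r.
Proof.
by apply/funext => x; apply: eq_bigr => i _; rewrite expr1n mulr1.
Qed.

Definition tpoly_deriv_hd (m n : nat) (r : nat -> 'rV[R]_m -> R) (x : 'rV[R]_m.+1) : R :=
  \sum_(i < n) i%:R * r i (tl x) * hd x ^+ i.-1.

Definition tpoly_deriv_coef (m n : nat) (r : nat -> 'rV[R]_m -> R)
    (v : 'rV[R]_m -> 'rV[R]_m) (x : 'rV[R]_m.+1) : R :=
  \sum_(i < n) 'D_(v (tl x)) (r i) (tl x) * hd x ^+ i.

Section Lift.
Context {m : nat} (U : set_system 'rV[R]_m.+1) {FU : UltraFilter U}
  (U0 : finer_than_nbhs0 U).
Local Notation V := (push tl U).

Lemma push_tl_finer : finer_than_nbhs0 V.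
Proof. by move=> P /near0_tl /U0. Qed.

Context (d : nat) (q : nat -> 'rV[R]_m -> R) (hq : forall i, analytic0 (q i))
  (qd : ~ vanish V (q d)) (qU : vanish U (tpoly d.+1 q))
  (qmin : forall l be, (l <= d)%N -> (forall i, analytic0 (be i)) ->
      vanish U (tpoly l be) -> forall i, (i < l)%N -> vanish V (be i)).
Context (v : 'rV[R]_m -> 'rV[R]_m) (hv : admissible V v).

Local Notation qt := (tpoly_deriv_hd d.+1 q).
Local Notation qv := (tpoly_deriv_coef d.+1 q v).

(* The components are chosen so that the derivative of tpoly d.+1 q along the field is
   identically zero. *)
Definition lift_field (x : 'rV[R]_m.+1) : 'rV[R]_m.+1 :=
  consrv (- qv x) (qt x *: v (tl x)).

(** Separability in characteristic zero: [qt] has [d] terms and leading coefficient [d%:R * q d],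
    and [qmin] excludes a nontrivial equation with so few terms. For [d = 0] the equation [qU] would
    already make [q 0] vanish. *)
Lemma not_vanish_qt : ~ vanish U qt.
Proof.
move=> h; have [d0|d0] := posnP d.
  apply: qd; change (vanish U (fun x => q d (tl x))).
  by apply: (vanish_eq qU) => x; rewrite /tpoly d0 big_ord1 expr0 mulr1.
have := @qmin d (fun i y => i.+1%:R * q i.+1 y) (leqnn _) _ _ d.-1.
rewrite prednK // => hd'; apply: qd.
apply: (vanish_cancel (f := fun=> d%:R)) (hd' _ _ (leqnn _)).
- apply: not_vanish; apply: filterS filterT => x _ /=.
  by rewrite pnatr_eq0 -lt0n.
- by move=> i; apply: analytic0M (analytic0_cst _) (hq _).
- apply: (vanish_eq h) => x; rewrite /tpoly_deriv_hd big_ord_recl /= !mul0r add0r.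
  by apply: eq_bigr => i _.
Qed.

Lemma analytic0_lift i : analytic0 (fun x => lift_field x 0 i).
Proof.
have hqt : analytic0 qt.
  apply: analytic0_sum => j; apply: analytic0M (analytic0X _ analytic0_hd).
  by apply: analytic0M (analytic0_cst _) (analytic0_tl (hq j)).
have hqv : analytic0 qv.
  apply: analytic0_sum => j; apply: analytic0M (analytic0X _ analytic0_hd).
  by apply: (analytic0_tl (f := fun y => 'D_(v y) (q j) y)); apply: analytic0_derive (hq j) hv.1.
case: (unliftP ord0 i) => [j ->|->].
  apply: (analytic0_eq (analytic0M hqt (analytic0_tl (hv.1 j)))) => x.
  by rewrite /lift_field mxE liftK mxE.
by apply: (analytic0_eq (analytic0N hqv)) => x; rewrite /lift_field mxE unlift_none.
Qed.

Lemma derive_lift_tl (f : 'rV[R]_m -> R) : analytic0 f ->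
  \forall x \near (0 : 'rV[R]_m.+1), derivable (fun y => f (tl y)) x (lift_field x) /\
    'D_(lift_field x) (fun y => f (tl y)) x = qt x * 'D_(v (tl x)) f (tl x).
Proof.
move=> /analytic0_near_diff/near0_tl; apply: near0W => x h; split.
  by apply: derivable_tl; exact: diff_derivable.
by rewrite derive_tl /lift_field tl_cons deriveZv.
Qed.

Lemma derive_lift_tpoly l (r : nat -> 'rV[R]_m -> R) : (forall i, analytic0 (r i)) ->
  \forall x \near (0 : 'rV[R]_m.+1), derivable (tpoly l r) x (lift_field x) /\
    'D_(lift_field x) (tpoly l r) x =
    qt x * tpoly_deriv_coef l r v x - tpoly_deriv_hd l r x * qv x.
Proof.
move=> hr; have := near0_forall l (fun i => near0_tl (analytic0_near_diff (hr i))).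
apply: near0W => x h; have [h1 h2] := fderiv_poly (lift_field x) h; split=> //.
rewrite [LHS]h2 {2}/lift_field hd_cons mulrN; congr (_ - _).
rewrite mulr_sumr; apply: eq_bigr => i _.
by rewrite /lift_field tl_cons deriveZv ?mulrA //; exact: h.
Qed.

(* Pseudo-division by q lowers the degree of r until qmin applies to its coefficients. *)
Lemma lift_tpoly_vanish l (r : nat -> 'rV[R]_m -> R) : (forall i, analytic0 (r i)) ->
  vanish U (tpoly l r) -> vanish U (fun x => 'D_(lift_field x) (tpoly l r) x).
Proof.
elim: l r => [|l IH] r hr h.
  have /U0 := derive_lift_tpoly 0 hr; apply: filterS => x [_] /= ->.
  by rewrite /tpoly_deriv_coef /tpoly_deriv_hd !big_ord0 mulr0 mul0r subr0.
case: (leqP l.+1 d) => ld.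
  have hri := qmin ld hr h.
  have h1 : vanish U (tpoly_deriv_coef l.+1 r v).
    apply: (vanish_sum (f := fun i x => 'D_(v (tl x)) (r i) (tl x) * hd x ^+ i)) => i il.
    have h2 : vanish U (fun x => 'D_(v (tl x)) (r i) (tl x)) := hv.2 _ (hr i) (hri i il).
    by apply: filterS h2 => x /= ->; rewrite mul0r.
  have h2 : vanish U (tpoly_deriv_hd l.+1 r).
    apply: (vanish_sum (f := fun i x => i%:R * r i (tl x) * hd x ^+ i.-1)) => i il.
    have h2 : vanish U (fun x => r i (tl x)) := hri i il.
    by apply: filterS h2 => x /= ->; rewrite mulr0 mul0r.
  have h3 := U0 (derive_lift_tpoly l.+1 hr).
  apply: filterS (filterI h3 (filterI h1 h2)) => x [[_ /= ->] [/= -> ->]].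
  by rewrite mulr0 mul0r subr0.
rewrite ltnS in ld; pose s := (l - d)%N.
(* Coefficients of [q d * r - r l * hd ^+ s * q]; the one of [hd ^+ l] is identically zero, so that
   [l] terms remain. *)
pose r' i y := q d y * r i y - (if (s <= i)%N then r l y * q (i - s)%N y else 0).
have hr' i : analytic0 (r' i).
  apply: (analytic0B (analytic0M (hq d) (hr i))); case: (s <= i)%N; last exact: analytic0_cst.
  exact: analytic0M.
have Er' : tpoly l r' = fun x => q d (tl x) * tpoly l.+1 r x
    - r l (tl x) * hd x ^+ s * tpoly d.+1 q x.
  apply/funext => x.
  have -> : tpoly l r' x = tpoly l.+1 r' x.
    have r'l : r' l (tl x) = 0 by rewrite /r' /s leq_subr subKn // mulrC subrr.
    by rewrite /tpoly big_ord_recr /= r'l mul0r addr0.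
  rewrite /tpoly /r'; under eq_bigr do rewrite mulrBl.
  rewrite sumrB mulr_sumr; congr (_ - _).
    by apply: eq_bigr => i _; rewrite mulrA.
  rewrite -(big_mkord predT (fun i => (if (s <= i)%N then r l (tl x) * q (i - s)%N (tl x)
     else 0) * hd x ^+ i)).
  have sl : (s <= l.+1)%N by rewrite /s leqW // leq_subr.
  rewrite (big_cat_nat (n := s)) //= big_nat big1 ?add0r => [|i /andP[_ is_]]; last first.
    by rewrite leqNgt is_ mul0r.
  rewrite -{1}(add0n s) big_addn big_mkord mulr_sumr.
  have -> : (l.+1 - s)%N = d.+1 by rewrite /s subSn ?leq_subr // subKn.
  by apply: eq_bigr => i _; rewrite leq_addl addnK exprD; ring.
have hU : vanish U (tpoly l r').
  by rewrite Er'; apply: filterS (filterI h qU) => x [/= -> ->]; rewrite !mulr0 subr0.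
have := IH _ hr' hU; rewrite Er' => h1.
have DQ := U0 (derive_lift_tpoly d.+1 hq); have DP := U0 (derive_lift_tpoly l.+1 hr).
have Dqd := U0 (derive_lift_tl (hq d)).
have hrl : analytic0 (fun x => r l (tl x) * hd x ^+ s).
  by apply: analytic0M (analytic0_tl (hr l)) (analytic0X _ analytic0_hd).
have Drl := U0 (analytic0_near_diff hrl).
(* When [Er'] is differentiated, every term except [q d] times the wanted derivative contains
   [tpoly l.+1 r], [tpoly d.+1 q] or the derivative of the latter, all zero along [U]. *)
apply: (vanish_cancel (f := fun x => q d (tl x))); first exact: qd.
apply: filterS (filterI (filterI (filterI DQ DP) (filterI Dqd Drl)) (filterI h1 (filterI h qU))).
move=> x [[[[q1 q2] [p1 p2]] [[d1 _] /= rl]] [/= E [/= P0 Q0]]].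
have rl' := diff_derivable (v := lift_field x) rl.
have [A1 A2] := fderivM d1 p1; have [B1 B2] := fderivM rl' q1.
have [_ E'] := fderivB A1 B1.
move: E; rewrite E' A2 B2 P0 Q0 q2 !mul0r !addr0 => <-.
by rewrite mulrC subrr mulr0 subr0.
Qed.

Context (n : nat) (g : 'rV[R]_m.+1 -> R) (hg : analytic0 g) (gU : vanish U g)
  (g_regular : regular_in_hd n g).

(** By preparation [g] is a polynomial in [hd] up to the unit [Q]. Where [g] vanishes, the product
    rule reduces the derivative of [Q * g] to [Q] times that of [g]. *)
Lemma lift_regular_vanish : vanish U (fun x => 'D_(lift_field x) g x).
Proof.
have [Q [r [hQ hr E]]] := weierstrass_preparation g_regular.
pose w i := if i == n then fun=> 1 else fun y => - r i y.
have hw i : analytic0 (w i) by rewrite /w; case: eqP => _; [exact: analytic0_cst|exact: analytic0N].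
have Ew x : tpoly n.+1 w x = hd x ^+ n - \sum_(i < n) r i (tl x) * hd x ^+ i.
  rewrite /tpoly big_ord_recr /= {2}/w eqxx mul1r addrC -sumrN; congr (_ + _).
  by apply: eq_bigr => i _; rewrite /w ltn_eqF // mulNr.
have EQ : \forall x \near (0 : 'rV[R]_m.+1), tpoly n.+1 w x = Q x * g x.
  by apply: near0W E => x [_ <-]; rewrite Ew.
have wU : vanish U (tpoly n.+1 w).
  by apply: filterS (filterI (U0 EQ) gU) => x [/= -> ->]; rewrite mulr0.
have h := lift_tpoly_vanish hw wU.
have hnear := U0 (near0I (near0I (near0_near EQ) E)
  (near0I (analytic0_near_diff hQ) (analytic0_near_diff hg))).
apply: filterS (filterI hnear (filterI h gU)) => x [[[Ex [Qx _]] [dQ dg]] [/= h0 g0]].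
have [_] := fderivM (diff_derivable (v := lift_field x) dQ) (diff_derivable (v := lift_field x) dg).
rewrite -(near_eq_derive _ Ex) h0 g0 mul0r addr0 => /esym/eqP.
by rewrite mulf_eq0 (negPf Qx) => /eqP.
Qed.

(** Division by [g] reduces a germ of the ideal to its remainder, a polynomial in [hd] that again
    lies in the ideal. *)
Lemma lift_admissible : admissible U lift_field.
Proof.
split=> [i|h hh hU]; first exact: analytic0_lift.
have [Q [r [hQ hr E]]] := weierstrass_division g_regular hh.
have rU : vanish U (tpoly n r).
  apply: filterS (filterI (U0 E) (filterI hU gU)) => x [/= + [h0 g0]].
  by rewrite h0 g0 mulr0 add0r => /esym.
have h1 := lift_tpoly_vanish hr rU.
have hnear := U0 (near0I (near0_near E) (near0I (derive_lift_tpoly n hr)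
  (near0I (analytic0_near_diff hQ) (analytic0_near_diff hg)))).
apply: filterS (filterI hnear (filterI (filterI h1 lift_regular_vanish) gU)).
move=> x [[Ex [[dr _] [dQ dg]]] [[/= h2 h3] g0]].
have [M1 M2] := fderivM (diff_derivable (v := lift_field x) dQ)
  (diff_derivable (v := lift_field x) dg).
have [_ D2] := fderivD M1 dr.
by rewrite /= (near_eq_derive _ Ex) [LHS]D2 M2 h3 g0 h2 mulr0 mul0r !addr0.
Qed.

End Lift.

End Derivations.

(** * The inductive step on the number of variables *)

Section Constants.
Context {R : realType}.

Section Step.
Context {m : nat} (U : set_system 'rV[R]_m.+1) {FU : UltraFilter U}
  (U0 : finer_than_nbhs0 U).
Local Notation V := (push tl U).

(** The form is [b ^+ e] times a polynomial in [a / b], and [a / b] is constant along [w]. Only the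
    coefficients and the factor [b ^+ e] get differentiated; the latter yields the second term. *)
Lemma derive_homog_form (a b : 'rV[R]_m.+1 -> R) (e : nat) (al de : nat -> 'rV[R]_m -> R)
    x w (k : R) :
  derivable a x w -> derivable b x w ->
  (forall i, (i <= e)%N -> derivable (fun y => al i (tl y)) x w /\
     'D_w (fun y => al i (tl y)) x = k * de i (tl x)) ->
  b x * 'D_w a x = a x * 'D_w b x ->
  b x * 'D_w (homog_form e.+1 al a b) x =
    b x * (k * homog_form e.+1 de a b x) + e%:R * 'D_w b x * homog_form e.+1 al a b x.
Proof.
move=> da db hal ab.
pose t i y := al i (tl y) * a y ^+ i * b y ^+ (e - i).
have ht i : (i < e.+1)%N -> derivable (t i) x w /\ b x * 'D_w (t i) x =
    b x * (k * (de i (tl x) * a x ^+ i * b x ^+ (e - i))) + e%:R * 'D_w b x * t i x.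
  move=> ie; have [d1 E1] := hal i ie; have [d2 E2] := fderivX i da.
  have [d3 E3] := fderivX (e - i) db; have [d4 E4] := fderivM d1 d2.
  have [d5 E5] := fderivM d4 d3; split=> //.
  rewrite E5 E4 E3 E2 E1 /t.
  have Ea : b x * (i%:R * a x ^+ i.-1 * 'D_w a x) = i%:R * a x ^+ i * 'D_w b x.
    case: i {t ie d1 E1 d2 E2 d3 E3 d4 E4 d5 E5} => [|i]; first by rewrite !mul0r mulr0.
    by rewrite mulrCA ab exprS /=; ring.
  have Eb : b x * ((e - i)%:R * b x ^+ (e - i).-1 * 'D_w b x)
      = (e - i)%:R * b x ^+ (e - i) * 'D_w b x.
    case: (e - i)%N => [|j]; first by rewrite !mul0r mulr0.
    by rewrite exprS /=; ring.
  have Ee : e%:R = i%:R + (e - i)%:R :> R by rewrite -natrD subnKC.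
  rewrite Ee; set A := a x ^+ i in Ea *; set B := b x ^+ (e - i) in Eb *.
  set X := (i%:R * a x ^+ i.-1 * 'D_w a x) in Ea *.
  set Y := ((e - i)%:R * _ * 'D_w b x) in Eb *.
  transitivity (al i (tl x) * A * (b x * Y) + B * (al i (tl x) * (b x * X))
     + b x * (k * (de i (tl x) * A * B))); first by ring.
  by rewrite Ea Eb; ring.
have [|_ E] := fderiv_sum (n := e.+1) (f := t) (x := x) (v := w); first by move=> i /ht[].
rewrite [X in b x * X]E /homog_form /= !mulr_sumr -big_split /=.
by apply: eq_bigr => i _; have [_ ->] := ht i (ltn_ord i).
Qed.

Lemma constants_step (n : nat) (g a b : 'rV[R]_m.+1 -> R) :
  @constants_are_scalars R m -> analytic0 g -> regular_in_hd n g -> vanish U g ->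
  analytic0 a -> analytic0 b -> ~ vanish U b ->
  (forall v, admissible U v ->
     vanish U (fun x => b x * 'D_(v x) a x - a x * 'D_(v x) b x)) ->
  exists c, vanish U (fun x => a x - c * b x).
Proof.
move=> IH hg g_reg gU ha hb bU hab.
have fin h : analytic0 h -> exists r : nat -> 'rV[R]_m -> R, (forall i, analytic0 (r i)) /\
     U [set x | h x = \sum_(i < n) r i (tl x) * hd x ^+ i].
  move=> hh; have [q [r [hq hr E]]] := weierstrass_division g_reg hh.
  exists r; split=> //; apply: filterS (filterI (U0 E) gU) => x [/= -> ->].
  by rewrite mulr0 add0r.
have one_U : ~ vanish U (fun=> 1).
  by apply: not_vanish; apply: filterS filterT => x _ /=; exact: oner_neq0.
(* [q] is a minimal equation of the coordinate [hd], taken as the quotient [hd / 1], and serves to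
   lift vector fields; [al] below is a minimal equation of [a / b]. *)
have [d [q [[hq qd qU] qmin]]] :=
  minimal_relation one_U fin (analytic0_hd (m := m)) (analytic0_cst 1).
rewrite homog_form_tpoly in qU.
have {}qmin l be : (l <= d)%N -> (forall i, analytic0 (be i)) ->
      vanish U (tpoly l be) -> forall i, (i < l)%N -> vanish V (be i).
  by move=> ld hbe; rewrite -homog_form_tpoly; exact: qmin.
have [e [al [[hal ale alU] almin]]] := minimal_relation bU fin ha hb.
have analytic0_form de : (forall i, analytic0 (de i)) -> analytic0 (homog_form e.+1 de a b).
  move=> hde; apply: analytic0_sum => i.
  apply: analytic0M (analytic0X _ hb).
  by apply: analytic0M (analytic0_tl (hde i)) (analytic0X _ ha).
have wronskian v : admissible V v -> forall i, (i < e)%N ->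
    vanish V (fun y => al e y * 'D_(v y) (al i) y - al i y * 'D_(v y) (al e) y).
  move=> hv; pose de i y := 'D_(v y) (al i) y.
  have hde i : analytic0 (de i) by apply: analytic0_derive (hal i) hv.1.
  set w := lift_field d q v.
  have adm : admissible U w := lift_admissible (FU := FU) U0 hq qd qU qmin hv hg gU g_reg.
  have qt0 : ~ vanish U (tpoly_deriv_hd d.+1 q) := not_vanish_qt (FU := FU) hq qd qU qmin.
  have dal := near0_forall e.+1 (fun i => derive_lift_tl d q v (hal i)).
  have hnear := U0 (near0I (near0I (analytic0_near_diff ha) (analytic0_near_diff hb)) dal).
  have deU : vanish U (homog_form e.+1 de a b).
    apply: (vanish_cancel bU); apply: (vanish_cancel qt0).
    have DR := adm.2 _ (analytic0_form _ hal) alU.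
    apply: filterS (filterI (filterI hnear (hab _ adm)) (filterI DR alU)).
    move=> x [[[[dax dbx] dalx] /= /eqP]]; rewrite subr_eq0 => /eqP abx [/= DRx alx].
    have := derive_homog_form (al := al) (de := de)
      (diff_derivable (v := w x) dax) (diff_derivable (v := w x) dbx)
      dalx abx.
    rewrite DRx alx !mulr0 addr0 => /esym H.
    by rewrite mulrCA; exact: H.
  (* Eliminating the leading term between the equation and its derivative leaves [e] terms, so all
     their coefficients vanish by minimality. *)
  pose be i y := al e y * de i y - al i y * de e y.
  have hbe i : analytic0 (be i) by apply: analytic0B; apply: analytic0M.
  have beU : vanish U (homog_form e be a b).
    apply: (vanish_cancel bU).
    apply: filterS (filterI deU alU) => x [/= h1 h2].
    have : homog_form e.+1 be a b x = al e (tl x) * homog_form e.+1 de a b x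
        - de e (tl x) * homog_form e.+1 al a b x.
      rewrite /homog_form !mulr_sumr -sumrB; apply: eq_bigr => i _.
      by rewrite /be; ring.
    have be_e : be e (tl x) = 0 by rewrite /be subrr.
    by rewrite h1 h2 !mulr0 subr0 homog_formS be_e mul0r addr0.
  exact: almin (leqnn e) hbe beU.
have /choice[c hc] i : exists c, (i < e)%N -> vanish V (fun y => al i y - c * al e y).
  case: (ltnP i e) => ie; last by exists 0.
  have [c hc] := IH V (al i) (al e) _ (push_tl_finer U0) (hal i) (hal e) ale
    (fun v hv => wronskian v hv i ie).
  by exists c.
(* The equation of [a / b] divided by its leading coefficient [al e]: along [U] its coefficients are
   the real numbers [c i], and 1 in degree [e]. *)
pose p : {poly R} := \poly_(i < e.+1) (if i == e then 1 else c i).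
have p0 : p != 0.
  apply/eqP => /(congr1 (fun q : {poly R} => q`_e)).
  by rewrite coef_poly leqnn eqxx coef0 => /eqP; rewrite oner_eq0.
have hcU k : (k <= e)%N -> U [set x | forall i, (i < k)%N -> al i (tl x) = c i * al e (tl x)].
  elim: k => [|k IHk] ke; first by apply: U0; apply: near0T => x i.
  have h : vanish U (fun x => al k (tl x) - c k * al e (tl x)) := hc k ke.
  apply: filterS (filterI (IHk (ltnW ke)) h) => x [/= h1 /eqP]; rewrite subr_eq0 => /eqP h2 i.
  by rewrite ltnS leq_eqVlt => /orP[/eqP ->//|]; exact: h1.
have aleU : ~ vanish U (fun x => al e (tl x)) := ale.
have pU : U [set x | p.[a x / b x] = 0].
  apply: filterS (filterI (filterI (vanish_neg aleU) (vanish_neg bU))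
    (filterI alU (hcU e (leqnn e)))) => x [[/= h1 h2] [/= h3 h4]].
  have : al e (tl x) * b x ^+ e * p.[a x / b x] = 0.
    rewrite -h3 /p horner_poly mulr_sumr; apply: eq_bigr => i _.
    have -> : al i (tl x) = (if (i : nat) == e then 1 else c i) * al e (tl x).
      case: eqP => [->|/eqP ie]; first by rewrite mul1r.
      by apply: h4; rewrite ltn_neqAle ie -ltnS ltn_ord.
    have -> : b x ^+ e = b x ^+ i * b x ^+ (e - i) by rewrite -exprD subnKC // -ltnS.
    rewrite expr_div_n; set B := b x ^+ i.
    have B0 : B != 0 by rewrite expf_neq0.
    by rewrite /=; field.
  move/eqP; rewrite !mulf_eq0 (negPf h1) expf_eq0 (negPf h2) andbF /=.
  by move/eqP.
have [z hz] := ultra_poly_root p0 pU.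
exists z; apply: filterS (filterI hz (vanish_neg bU)) => x [/= <- bx].
by rewrite divfK // subrr.
Qed.

End Step.

End Constants.

(** * Regularity in the first variable and the identity theorem *)

Section Identity.
Context {R : realType}.

Lemma half_power_lt (C e : R) : 0 < e -> exists n, C / 2 ^+ n < e.
Proof.
move=> e0; have [n0 hn] := geometric_small `|C| (divr_gt0 e0 (ltr0n R 2)).
exists n0.*2; have := hn n0 (leqnn _); rewrite -exprVn -mul2n exprM.
have -> : (2^-1 ^+ 2 : R) = 4^-1 by rewrite exprVn -natrX.
have p4 : 0 <= 4^-1 :> R by rewrite invr_ge0.
have := ler_wpM2r (exprn_ge0 n0 p4) (ler_norm C).
lra.
Qed.

(** If the first [n] coefficients all vanished at 0, the value at [consrv t0 0] would be [t0 ^+ n]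
    times a number of size at most [C / hd w ^+ n], hence at most [C / 2 ^+ n] because
    [2 * |t0| <= hd w]. *)
Lemma regular_of_neq0 (m : nat) (w : 'rV[R]_m.+1) f C (t0 : R) :
  (forall i, 0 < w 0 i) -> pseries w f C -> 2 * `|t0| <= hd w ->
  f (consrv t0 0) != 0 -> exists n, regular_in_hd n f.
Proof.
move=> w0 hf ht f0; have wn i : 0 <= w 0 i := ltW (w0 i).
have hw0 : 0 < hd w := w0 ord0.
pose P n := exists (r : nat -> 'rV[R]_m -> R) (h : 'rV[R]_m.+1 -> R),
  [/\ forall i, analytic0 (r i), analytic0 h, exists i, (i < n)%N /\ r i 0 != 0 &
   forall x, polydisc w x -> f x = hd x ^+ n * h x + \sum_(i < n) r i (tl x) * hd x ^+ i].
have ex : exists n, `[< P n >].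
  have [|n hn] := @half_power_lt C `|f (consrv t0 0)|; first by rewrite normr_gt0.
  exists n; apply/asboolP.
  have [r [h [hr hh E]]] := pseries_split n hw0 wn hf.
  exists r, h; split=> //.
  - by move=> i; apply: pseries_analytic0 (hr i) => j; rewrite mxE.
  - exact: pseries_analytic0 hh.
  apply/not_existsP => hall.
  have px : polydisc w (consrv t0 0).
    apply: polydisc_cons => [|j]; last by rewrite !mxE normr0.
    by apply: le_trans ht; have := normr_ge0 t0; lra.
  have := E _ px; rewrite hd_cons tl_cons big1 ?addr0 => [H|i _]; last first.
    suff -> : r i 0 = 0 by rewrite mul0r.
    by apply/eqP/contraT => ri; case: (hall i).
  move: hn; rewrite H normrM normrX ltNge => /negP; apply.
  have h1 := pseries_bound hh px; have hwn : 0 < hd w ^+ n by exact: exprn_gt0.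
  apply: (@le_trans _ _ (`|t0| ^+ n * (C / hd w ^+ n))).
    by apply: ler_wpM2l; rewrite ?exprn_ge0.
  have C0 := pseries_ge0 hf.
  rewrite mulrCA; apply: ler_wpM2l => //.
  rewrite ler_pdivrMr // mulrC ler_pdivlMr ?exprn_gt0 // -exprMn mulrC.
  by apply: lerXn2r; rewrite ?nnegrE ?mulr_ge0 // ltW.
(* [P n] asks for a nonzero coefficient of index below [n], so the order of [f] on the axis is one
   less than the least such [n]. *)
case: (ex_minnP ex) => n /asboolP[r [h [hr hh [i0 [i0n ri0]] E]]] nmin.
case: n => [//|n] in i0n E nmin *.
have small i : (i < n)%N -> r i 0 = 0.
  move=> ni; apply/eqP/contraT => ri.
  suff /nmin : `[< P n >] by rewrite ltnn.
  apply/asboolP; exists r, (fun x => hd x * h x + r n (tl x)); split => //.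
  - by apply: analytic0D (analytic0M analytic0_hd hh) (analytic0_tl (hr n)).
  - by exists i.
  - by move=> x xw; rewrite (E x xw) big_ord_recr /= exprSr; ring.
exists n; have [d [d0 hd]] := polydisc_uniform w0.
exists d, r, h; split=> //; split.
  by move: i0n ri0; rewrite ltnS leq_eqVlt => /orP[/eqP ->//|/small ->]; rewrite eqxx.
by move=> x xd; apply: E; exact: polydisc_trans hd xd.
Qed.

(** With a nonzero value within [r / 2], [f] would have the form [t ^+ n * (c + t * G)] with
    [c != 0] near 0, and could not vanish at small negative [t]. Zeros are assumed on the negative
    side since [identity_interval] approaches a supremum from below. *)
Lemma analytic_zeros_isolated (f : 'rV[R]_1 -> R) : analytic0 f ->
  (exists e : R, 0 < e /\ forall t, 0 < t < e -> f (const_mx (- t)) = 0) ->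
  exists e : R, 0 < e /\ forall t, `|t| <= e -> f (const_mx t) = 0.
Proof.
move=> [r [C [r0 hf]]] [e [e0 he]].
have cE (t : R) : const_mx t = consrv t 0 :> 'rV[R]_1.
  by apply/rowP => i; rewrite !mxE; case: unliftP => // -[].
exists (r / 2); split; first by rewrite divr_gt0.
move=> t ht; apply/eqP/contraT => ft.
have [||||n [d [gi [G [d0 hgi hG small [gn E]]]]]] := @regular_of_neq0 0 (const_mx r) f C t.
- by move=> i; rewrite mxE.
- by [].
- by rewrite /hd mxE mulrC -ler_pdivlMr.
- by rewrite -cE.
have [B [c [c0 hB]]] := analytic0_small hG.
(* A zero at [- s] would force [|gi n 0| <= s * |B|], which the last entry of the list makes at most
   half of [|gi n 0|]. *)
pose s := \big[Num.min/1]_(z <- [:: d; c; e / 2; `|gi n 0| / (`|B| + 1) / 2]) z.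
have B1 : 0 < `|B| + 1 by rewrite ltr_wpDl.
have gp : 0 < `|gi n 0| by rewrite normr_gt0.
have s0 : 0 < s by rewrite /s !big_cons big_nil !lt_min ltr01 d0 c0 !divr_gt0.
have [sd sc se sg] : [/\ s <= d, s <= c, s <= e / 2 & s <= `|gi n 0| / (`|B| + 1) / 2].
  by rewrite /s !big_cons big_nil; split; rewrite !ge_min lexx ?orbT.
pose x : 'rV[R]_1 := const_mx (- s).
have xs (k : R) : s <= k -> polydisc (const_mx k) x.
  by move=> sk i; rewrite !mxE normrN gtr0_norm.
have := E x (xs _ sd); rewrite he; last by rewrite s0 /=; lra.
have hx : hd x = - s by rewrite /hd mxE.
have tx : tl x = 0 by apply/rowP => -[].
rewrite big_ord_recr /= big1 ?add0r => [|i _]; last by rewrite tx small ?mul0r.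
rewrite tx exprSr -mulrA [gi n 0 * _]mulrC -mulrDr => /esym/eqP.
rewrite mulf_eq0 expf_eq0 hx oppr_eq0 (gt_eqF s0) andbF /= => /eqP H.
have HG : `|G x| <= B.
  by apply: (pseries_bound (hB (const_mx c) _) (xs _ sc)) => i; rewrite mxE lexx ltW.
have Hg : `|gi n 0| <= s * `|B|.
  have -> : gi n 0 = s * G x by apply/eqP; rewrite -subr_eq0 -H; apply/eqP; ring.
  rewrite normrM (gtr0_norm s0); apply: ler_wpM2l; first exact: ltW.
  exact: le_trans HG (ler_norm _).
have : s * `|B| <= `|gi n 0| / 2.
  apply: (@le_trans _ _ (`|gi n 0| / (`|B| + 1) / 2 * (`|B| + 1))).
    apply: ler_pM => //; [exact: ltW|lra].
  by rewrite mulrAC divfK ?gt_eqF.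
lra.
Qed.

(** The supremum of the [s] such that [G] is zero on [[0, s]] cannot be less than 1:
    [analytic_zeros_isolated], applied there, extends the zeros beyond it. *)
Lemma identity_interval (G : R -> R) :
  (forall s, 0 <= s <= 1 -> analytic0 (fun z : 'rV[R]_1 => G (s + z 0 0))) ->
  (exists e : R, 0 < e /\ forall s, 0 <= s <= e -> G s = 0) -> G 1 = 0.
Proof.
move=> hG [e [e0 he]].
pose S := [set s : R | 0 <= s <= 1 /\ forall t, 0 <= t <= s -> G t = 0].
have S0 : S (Num.min 1 e).
  split; first by rewrite le_min ler01 (ltW e0) ge_min lexx.
  by move=> t /andP[t0]; rewrite le_min => /andP[_ te]; apply: he; rewrite t0.
have supS : has_sup S.
  by split; [exists (Num.min 1 e)|exists 1 => s [/andP[]]].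
pose u := sup S.
have u0 : 0 < u.
  by apply: lt_le_trans (ub_le_sup supS.2 S0); rewrite lt_min ltr01.
have u1 : u <= 1 by apply: ge_sup supS.1 _ => s [/andP[]].
have below t : 0 <= t < u -> G t = 0.
  move=> /andP[t0 tu]; have ut : 0 < u - t by rewrite subr_gt0.
  have [s [s1 s2] ts] := sup_adherent ut supS.
  by apply: s2; rewrite t0 /=; apply: ltW; move: ts; rewrite -/u; lra.
have hu : 0 <= u <= 1 by rewrite u1 ltW.
have [|e1 [e10 hz]] := analytic_zeros_isolated (hG u hu).
  by exists u; split=> // t /andP[t0 tu]; apply: below; rewrite mxE; lra.
have above t : 0 <= t <= u + e1 -> G t = 0.
  move=> /andP[t0 te]; case: (ltP t u) => tu; first by apply: below; rewrite t0.
  have := hz (t - u); rewrite mxE (addrC u) subrK; apply.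
  by rewrite ger0_norm; lra.
have := u1; rewrite le_eqVlt => /orP[/eqP u1'|ul1].
  by apply: above; lra.
have Sm : S (Num.min 1 (u + e1)).
  split; first by rewrite le_min ler01 ge_min lexx /=; lra.
  move=> t /andP[t0]; rewrite le_min => /andP[_ te]; apply: above.
  by rewrite t0.
have := ub_le_sup supS.2 Sm; rewrite -/u leNgt lt_min ul1 ltrDl e10.
by [].
Qed.

Lemma line_quotient (m : nat) (f : 'rV[R]_m -> R) (v y : 'rV[R]_m) (s : R) :
  (fun h : R => h^-1 *: (((fun t : R => f (t *: v + y)) \o shift s) (h *: 1)
     - f (s *: v + y)))
  = (fun h : R => h^-1 *: ((f \o shift (s *: v + y)) (h *: v) - f (s *: v + y))).
Proof.
by apply/funext => h; rewrite /= [h *: 1]mulr1 scalerDl addrA.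
Qed.

Lemma derive_line (m : nat) (f : 'rV[R]_m -> R) (v y : 'rV[R]_m) (s : R) :
  differentiable f (s *: v + y) ->
  derivable (fun t : R => f (t *: v + y)) s 1 /\
  'D_1 (fun t : R => f (t *: v + y)) s = 'D_v f (s *: v + y).
Proof.
move=> df; split; first by rewrite /derivable line_quotient; exact: diff_derivable.
by rewrite /derive line_quotient.
Qed.

Lemma zero_derive_const (Q : R -> R) (s : R) : 0 <= s ->
  (forall t, 0 <= t <= s -> derivable Q t 1 /\ 'D_1 Q t = 0) -> Q s = Q 0.
Proof.
move=> s0 hQ; have [|| t _] := @MVT_segment R Q (fun=> 0) 0 s s0.
- move=> t; rewrite in_itv /= => /andP[/ltW t0 /ltW ts].
  have [|d1 d2] := hQ t; first by rewrite t0.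
  by apply: DeriveDef.
- apply: derivable_within_continuous => t; rewrite in_itv /= => ht.
  by case: (hQ t ht).
by rewrite mul0r => /eqP; rewrite subr_eq0 => /eqP.
Qed.

(* Along every segment issued from x0 the quotient a / b has zero derivative, so a - c b
   vanishes near x0, hence on the whole segment. *)
Lemma wronskian_zero (m : nat) (a b : 'rV[R]_m -> R) : analytic0 a -> analytic0 b ->
  (\forall x \near (0 : 'rV[R]_m), forall v, b x * 'D_v a x - a x * 'D_v b x = 0) ->
  ~ (\forall x \near (0 : 'rV[R]_m), b x = 0) ->
  exists c, \forall x \near (0 : 'rV[R]_m), a x - c * b x = 0.
Proof.
move=> ha hb hW b0.
have [ra [Ca [ra0 hra]]] := ha; have [rb [Cb [rb0 hrb]]] := hb.
have /nbhs0_polydisc[r1 [r10 hr1]] :=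
  near0I hW (near0I (analytic0_near_diff ha) (analytic0_near_diff hb)).
(* The entries of [x - x0] are at most [2 * r], so for [|z| <= 1 / 2] the point [ga (s + z)] has
   entries at most [2 * r] and stays in the polydiscs of radii [ra] and [rb]. *)
pose r := Num.min r1 (Num.min (ra / 2) (rb / 2)).
have r0 : 0 < r by rewrite !lt_min r10 !divr_gt0.
have [rr1 [rra rrb]] : r <= r1 /\ r <= ra / 2 /\ r <= rb / 2.
  by rewrite /r !ge_min !lexx !orbT.
have [x0 [hx0 bx0]] : exists x0, polydisc (const_mx r) x0 /\ b x0 != 0.
  apply: contrapT => /forallNP h; apply: b0; apply/nbhs0_polydisc.
  exists r; split=> // x hx; apply/eqP/contraT => bx.
  by case: (h x).
pose c := a x0 / b x0; exists c; apply/nbhs0_polydisc; exists r; split=> // x hx.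
pose ga (s : R) : 'rV[R]_m := s *: (x - x0) + x0.
have ga0 : ga 0 = x0 by rewrite /ga scale0r add0r.
have ga1 : ga 1 = x by rewrite /ga scale1r subrK.
have gar s : 0 <= s <= 1 -> polydisc (const_mx r) (ga s).
  move=> /andP[s0 s1] i; rewrite !mxE.
  have -> : s * (x 0 i - x0 0 i) + x0 0 i = s * x 0 i + (1 - s) * x0 0 i by ring.
  have h1 := hx i; have h2 := hx0 i; rewrite !mxE in h1 h2.
  apply: le_trans (ler_normD _ _) _; rewrite !normrM (ger0_norm s0).
  rewrite (@ger0_norm _ (1 - s)) ?subr_ge0 //.
  have h3 := ler_wpM2l s0 h1; have h4 : (1 - s) * `|x0 0 i| <= (1 - s) * r.
    by apply: ler_wpM2l; rewrite ?subr_ge0.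
  lra.
have gax s : 0 <= s <= 1 -> polydisc (const_mx r1) (ga s).
  by move=> hs; apply: polydisc_const_le rr1 (gar s hs).
have comp_analytic0 f rf Cf s : pseries (const_mx rf) f Cf -> r <= rf / 2 -> 0 <= s <= 1 ->
    analytic0 (fun z : 'rV[R]_1 => f (ga (s + z 0 0))).
  move=> hf rrf hs; exists (1 / 2), Cf; split; first by rewrite divr_gt0.
  apply: (pseries_comp _ hf) => [i|i]; first by rewrite mxE divr_ge0.
  have w0 j : 0 <= (const_mx (1 / 2) : 'rV[R]_1) 0 j by rewrite mxE divr_ge0.
  have := pseriesD (pseriesZ (x 0 i - x0 0 i) (pseries_coord 0 w0))
    (pseries_cst (const_mx (1/2)) (ga s 0 i)).
  move=> /(pseriesW (_ : _ <= (const_mx rf : 'rV[R]_m) 0 i)) h.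
  apply: pseries_ext (h _) _ => [|z _]; last by rewrite !mxE; ring.
  move: (hx i) (hx0 i) (gar s hs i); move: (ga s 0 i) => z; rewrite !mxE => h1 h2 h3.
  have := ler_normB (x 0 i) (x0 0 i); lra.
pose G s := a (ga s) - c * b (ga s).
suff : G 1 = 0 by rewrite /G ga1.
apply: identity_interval => [s hs|].
  apply: analytic0B; first exact: comp_analytic0 hra rra hs.
  by apply: analytic0M (analytic0_cst _) _; exact: comp_analytic0 hrb rrb hs.
have [e [e0 [e1 he]]] : exists e, 0 < e /\ e <= 1 /\ forall s, 0 <= s <= e -> b (ga s) != 0.
  have hb0 : analytic0 (fun z : 'rV[R]_1 => b (ga (0 + z 0 0))).
    by apply: comp_analytic0 hrb rrb _; rewrite lexx ler01.
  have [|e [e0 he]] := iffLR (nbhs0_polydisc _) (analytic0_near_neq0 hb0 _).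
    by rewrite mxE addr0 ga0.
  exists (Num.min 1 e); rewrite lt_min ltr01 e0 ge_min lexx; split=> //; split=> // s.
  move=> /andP[s0]; rewrite le_min => /andP[_ se].
  have := he (const_mx s); rewrite mxE add0r; apply => i.
  by rewrite !mxE ger0_norm.
exists e; split=> // s /andP[s0 se].
pose Q t := a (ga t) * (b (ga t))^-1.
have ht t : 0 <= t <= s -> 0 <= t <= 1 /\ b (ga t) != 0.
  move=> /andP[t0 ts]; have te : t <= e by apply: le_trans se.
  by split; [rewrite t0 (le_trans te)|apply: he; rewrite t0].
have : Q s = Q 0.
  apply: zero_derive_const => // t /ht[t01 bt].
  have [W [dax dbx]] := hr1 _ (gax t t01).
  have [a1 a2] := derive_line dax; have [b1 b2] := derive_line dbx.
  have [q1 q2] := fderivM a1 (derivableV bt b1).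
  have Ev : 'D_1 (fun t => (b (ga t))^-1) t = - b (ga t) ^- 2 * 'D_(x - x0) b (ga t).
    by have E := deriveV bt b1; rewrite -b2 -[RHS]E.
  split=> //; rewrite [LHS]q2 Ev a2 -/(ga t).
  have W' := W (x - x0); apply: (mulfI (_ : b (ga t) ^+ 2 != 0)).
    by rewrite expf_neq0.
  by rewrite mulr0 -[RHS]W'; field.
rewrite /Q /G ga0 -/c => Qs; have [|_ bs] := ht s; first by rewrite s0 lexx.
by rewrite -Qs mulfVK // subrr.
Qed.

End Identity.

(** * Linear changes of coordinates and the full induction *)

Section AllDimensions.
Context {R : realType}.

Lemma derive_coord (m : nat) (f : 'rV[R]_m -> R) (x v : 'rV[R]_m) :
  differentiable f x -> 'D_v f x = \sum_i v 0 i * 'D_(delta_mx 0 i) f x.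
Proof.
move=> df; rewrite deriveE // {1}(row_sum_delta v) linear_sum; apply: eq_bigr => i _.
by rewrite linearZ /= deriveE.
Qed.

(** For the zero ideal all constant fields are admissible, and the resulting identities hold near 0
    and not only along [U], as [wronskian_zero] requires. *)
Lemma constants_no_relation (m : nat) (U : set_system 'rV[R]_m) (a b : 'rV[R]_m -> R) :
  UltraFilter U -> finer_than_nbhs0 U ->
  (forall g, analytic0 g -> vanish U g -> \forall x \near (0 : 'rV[R]_m), g x = 0) ->
  analytic0 a -> analytic0 b -> ~ vanish U b ->
  (forall v, admissible U v ->
     vanish U (fun x => b x * 'D_(v x) a x - a x * 'D_(v x) b x)) ->
  exists c, vanish U (fun x => a x - c * b x).
Proof.
move=> FU U0 hP ha hb bU hab.
have adm (v : 'rV[R]_m) : admissible U (fun=> v).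
  split=> [i|h hh hU]; first exact: analytic0_cst.
  apply: U0; apply: near0W (near0_near (hP _ hh hU)) => x hx.
  have E := near_eq_derive v hx; rewrite /= E; exact: derive_cst.
have W i : \forall x \near (0 : 'rV[R]_m), b x * 'D_(delta_mx 0 i) a x
    - a x * 'D_(delta_mx 0 i) b x = 0.
  apply: hP (hab _ (adm _)).
  have hd f : analytic0 f -> analytic0 (fun x => 'D_(delta_mx 0 i) f x).
    by move=> hf; apply: (analytic0_derive hf) => j; exact: analytic0_cst.
  by apply: analytic0B; apply: analytic0M => //; exact: hd.
have W' : \forall x \near (0 : 'rV[R]_m), forall i : 'I_m,
    b x * 'D_(delta_mx 0 i) a x - a x * 'D_(delta_mx 0 i) b x = 0.
  have Wk k : \forall x \near (0 : 'rV[R]_m), forall hk : (k < m)%N,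
      b x * 'D_(delta_mx 0 (Ordinal hk)) a x - a x * 'D_(delta_mx 0 (Ordinal hk)) b x = 0.
    have [km|km] := pselect (k < m)%N; last by apply: near0T => x hk; case: km.
    apply: near0W (W (Ordinal km)) => x h hk.
    by have -> : Ordinal hk = Ordinal km by exact: val_inj.
  apply: near0W (near0_forall m Wk) => x h i.
  have := h i (ltn_ord i) (ltn_ord i).
  by have -> : Ordinal (ltn_ord i) = i by exact: val_inj.
have [||c hc] := @wronskian_zero R m a b ha hb.
- apply: near0W (near0I W' (near0I (analytic0_near_diff ha) (analytic0_near_diff hb))).
  move=> x [h [da db]] v; rewrite (derive_coord v da) (derive_coord v db).
  rewrite !mulr_sumr -sumrB big1 // => i _.
  by rewrite mulrCA (mulrCA (a x)) -mulrBr h mulr0.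
- by move=> h; apply/bU/U0.
by exists c; exact: U0.
Qed.

Section Shear.
Context {m : nat}.

(** Linear automorphism sending the first axis to the line spanned by [(1, y)]; it serves to make a
    nonzero germ regular in the first variable. *)
Definition shear (y : 'rV[R]_m) (x : 'rV[R]_m.+1) : 'rV[R]_m.+1 :=
  consrv (hd x) (tl x + hd x *: y).

Lemma shearK y : cancel (shear y) (shear (- y)).
Proof.
by move=> x; rewrite /shear hd_cons tl_cons scalerN addrK cons_hd_tl.
Qed.

Lemma shear0 y : shear y 0 = 0.
Proof.
by rewrite /shear tl0 [hd 0]mxE scale0r addr0 -[RHS]cons_hd_tl tl0 /hd mxE.
Qed.

Lemma shear_linear y (t : R) v x : shear y (t *: v + x) = t *: shear y v + shear y x.
Proof.
apply/rowP => i; rewrite /shear !mxE; case: unliftP => [j _|_].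
  by rewrite tl_is_linear hd_is_linear !mxE; ring.
exact: hd_is_linear.
Qed.

Lemma analytic0_shear y i : analytic0 (fun x => shear y x 0 i).
Proof.
case: (unliftP ord0 i) => [j ->|->].
  apply: (analytic0_eq (analytic0D (analytic0_tl (analytic0_coord j))
    (analytic0M (analytic0_hd (m := m)) (analytic0_cst (y 0 j))))).
  by move=> x; rewrite /shear [RHS]mxE liftK [RHS]mxE [(_ *: y) _ _]mxE.
by apply: (analytic0_eq (analytic0_hd (m := m))) => x; rewrite /shear [RHS]mxE unlift_none.
Qed.

Lemma analytic0_comp_shear (y : 'rV[R]_m) f : analytic0 f -> analytic0 (fun x => f (shear y x)).
Proof. by move=> hf; apply: analytic0_comp hf (analytic0_shear y) (shear0 y). Qed.

Lemma derive_shear (y : 'rV[R]_m) (f : 'rV[R]_m.+1 -> R) x v :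
  'D_v (fun z => f (shear y z)) x = 'D_(shear y v) f (shear y x).
Proof.
have E : (fun h : R => h^-1 *: (((fun z => f (shear y z)) \o shift x) (h *: v)
      - f (shear y x)))
    = (fun h : R => h^-1 *: ((f \o shift (shear y x)) (h *: shear y v) - f (shear y x))).
  by apply/funext => h; rewrite /= shear_linear.
by rewrite /derive E.
Qed.

Lemma push_shear_finer y (U : set_system 'rV[R]_m.+1) :
  finer_than_nbhs0 U -> finer_than_nbhs0 (push (shear y) U).
Proof.
by move=> U0 P hP; apply: U0; exact: near0_pullback (analytic0_shear y) (shear0 y) hP.
Qed.

Lemma exists_regular_shear (g : 'rV[R]_m.+1 -> R) : analytic0 g ->
  ~ (\forall x \near (0 : 'rV[R]_m.+1), g x = 0) ->
  exists y n, regular_in_hd n (fun x => g (shear y x)).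
Proof.
move=> hg g0; have [r [C [r0 hC]]] := hg.
have [r1 [r10 hr1]] := iffLR (nbhs0_polydisc _) (analytic0_near_diff hg).
pose s := Num.min r1 (r / 8).
have s0 : 0 < s by rewrite lt_min r10 divr_gt0.
have [x1 [hx1 gx1]] : exists x, polydisc (const_mx s) x /\ g x != 0.
  apply: contrapT => /forallNP h; apply: g0; apply/nbhs0_polydisc.
  exists s; split=> // x hx; apply/eqP/contraT => gx.
  by case: (h x).
have gcont : {for x1, continuous g}.
  apply: differentiable_continuous; apply: hr1; apply: polydisc_const_le hx1.
  by rewrite ge_min lexx.
(* The line through [x0] is the image of the first axis under a shear only if [hd x0 != 0];
   otherwise the first coordinate is perturbed, and continuity keeps [g] nonzero. *)
have [x0 [hx0 gx0 hd0]] : exists x, [/\ polydisc (const_mx (r / 4)) x, g x != 0 & hd x != 0].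
  have nb : \forall x \near x1, g x != 0.
    have : \forall z \near g x1, z != 0 by exact: open_nbhs_nbhs (conj (@open_neq _ 0) gx1).
    exact: gcont.
  have [hd1|hd1] := eqVneq (hd x1) 0; last first.
    exists x1; split=> //; apply: polydisc_const_le hx1.
    by rewrite ge_min; apply/orP; right; lra.
  have /nbhs_ballP[e /= e0 he] := nb.
  pose t := Num.min (e / 2) (r / 8).
  have t0 : 0 < t by rewrite lt_min !divr_gt0.
  have te : t <= e / 2 by rewrite ge_min lexx.
  have tr : t <= r / 8 by rewrite ge_min lexx orbT.
  exists (consrv t (tl x1)); split; last by rewrite hd_cons gt_eqF.
    move=> i; rewrite !mxE; case: unliftP => [j _|_].
      rewrite mxE; have := hx1 (lift ord0 j); rewrite mxE /s le_min => /andP[_ h].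
      by apply: le_trans h _; lra.
    by rewrite gtr0_norm //; lra.
  apply: he; split=> // i j; rewrite ord1 /ball /= [consrv _ _ _ _]mxE.
  case: unliftP => [k ->|->]; first by rewrite [tl _ _ _]mxE subrr normr0.
  by rewrite -/(hd x1) hd1 sub0r normrN gtr0_norm //; lra.
pose t0 := hd x0; pose y := t0^-1 *: tl x0.
exists y; have t00 : 0 < `|t0| by rewrite normr_gt0.
have ht0 : `|t0| <= r / 4 by have := hx0 ord0; rewrite mxE.
(* [shear y] sends [consrv t0 0] to [x0]. The first radius meets the condition of [regular_of_neq0]
   at [t0], and the norm of each entry of [tl x + hd x *: y] is at most [r / 4 + 2 * (r / 4)], below
   [r]. *)
pose w : 'rV[R]_m.+1 := consrv (2 * `|t0|) (const_mx (r / 4)).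
have w0 i : 0 < w 0 i.
  by rewrite /w mxE; case: unliftP => [j _|_]; rewrite ?mxE ?divr_gt0 ?mulr_gt0.
have wn i : 0 <= w 0 i := ltW (w0 i).
have hw : hd w = 2 * `|t0| by rewrite /w hd_cons.
have tw j : w 0 (lift ord0 j) = r / 4 by rewrite /w mxE liftK mxE.
clearbody w.
have hdw : pseries w (@hd R m) (2 * `|t0|) by rewrite -hw; exact: pseries_coord.
have hf : pseries w (fun x => g (shear y x)) C.
  apply: (pseries_comp wn hC) => i; rewrite mxE; case: (unliftP ord0 i) => [j ->|->].
    have := pseriesD (pseries_coord (lift ord0 j) wn) (pseriesZ (y 0 j) hdw).
    move=> /(@pseriesW _ _ _ _ _ r) h.
    apply: pseries_ext (h _) _ => [|x _].
      rewrite tw mxE normrM normfV.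
      have -> : `|t0|^-1 * `|tl x0 0 j| * (2 * `|t0|) = 2 * `|tl x0 0 j|.
        by field; rewrite normr_eq0.
      by have := hx0 (lift ord0 j); rewrite !mxE; lra.
    by rewrite /shear [RHS]mxE liftK [RHS]mxE [tl _ _ _]mxE [(_ *: y) _ _]mxE mulrC.
  apply: pseries_ext (@pseriesW _ _ _ _ _ r _ hdw) _ => [|x _]; first by lra.
  by rewrite /shear [RHS]mxE unlift_none.
apply: (regular_of_neq0 w0 hf (t0 := t0)); first by rewrite hw.
by rewrite /shear hd_cons tl_cons add0r /y scalerA divff // scale1r cons_hd_tl.
Qed.

End Shear.

Theorem constants_are_scalars_all (m : nat) : @constants_are_scalars R m.
Proof.
elim: m => [|m IH] U a b FU U0 ha hb bU hab.
  have [x bx] := filter_ex (vanish_neg bU).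
  exists (a x / b x); apply: U0; apply: near0T => z.
  have -> : z = x by apply/rowP => -[].
  by rewrite /= divfK // subrr.
have [hP|] := pselect (forall g, analytic0 g -> vanish U g ->
  \forall x \near (0 : 'rV[R]_m.+1), g x = 0).
  exact: constants_no_relation hP ha hb bU hab.
move=> /existsNP[g /not_implyP[hg /not_implyP[gU g0]]].
have [y [n g_reg]] := exists_regular_shear hg g0.
pose U' := push (shear (- y)) U.
have sK x : shear y (shear (- y) x) = x by have := shearK (- y) x; rewrite opprK.
have vE f : vanish U' (fun x => f (shear y x)) <-> vanish U f.
  rewrite /vanish /U' /push /=.
  have -> // : [set x | f x = 0] = shear (- y) @^-1` [set x | f (shear y x) = 0].
  by apply/seteqP; split=> x /=; rewrite sK.
have [|c hc] := @constants_step R m U' _ (push_shear_finer (- y) U0) n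
    (fun x => g (shear y x)) (fun x => a (shear y x)) (fun x => b (shear y x)) IH
    (analytic0_comp_shear y hg) g_reg (iffRL (vE g) gU) (analytic0_comp_shear y ha)
    (analytic0_comp_shear y hb) (fun h => bU (iffLR (vE b) h)).
  move=> v [hv1 hv2].
  (* As the shear is linear, it is its own differential, and this is the field [v] in the original
     coordinates. *)
  have adm : admissible U (fun x => shear y (v (shear (- y) x))).
    split=> [i|h hh hU].
      pose vi j := fun x => v (shear (- y) x) 0 j.
      have hvi j : analytic0 (vi j) := analytic0_comp_shear (- y) (hv1 j).
      case: (unliftP ord0 i) => [j ->|->].
        apply: (analytic0_eq (analytic0D (hvi (lift ord0 j))
          (analytic0M (hvi ord0) (analytic0_cst (y 0 j))))).
        by move=> x; rewrite /shear [RHS]mxE liftK [RHS]mxE [tl _ _ _]mxE [(_ *: y) _ _]mxE.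
      by apply: (analytic0_eq (hvi ord0)) => x; rewrite /shear [RHS]mxE unlift_none.
    have := hv2 _ (analytic0_comp_shear y hh) (iffRL (vE h) hU).
    rewrite /vanish /U' /push /=; apply: filterS => x /=.
    by rewrite derive_shear sK.
  have := hab _ adm; rewrite /vanish /U' /push /=; apply: filterS => x /=.
  by rewrite !derive_shear !sK.
by exists c; apply/vE.
Qed.

End AllDimensions.

(** * From the definition of analyticity to power series *)

Section AnalyticGerms.
Context {R : realType}.

Lemma summable_abs_bounded (I : choiceType) (a : I -> R) :
  summable [set: I] (fun i => (a i)%:E) -> exists C, abs_bounded a C.
Proof.
move=> h; exists (fine (\esum_(i in [set: I]) `|(a i)%:E|)%E) => J.
have fin : (\esum_(i in [set: I]) `|(a i)%:E|)%E \is a fin_num.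
  by rewrite -summableE.
rewrite -lee_fin fineK //; apply: esum_ge; exists [set` J]; first by split.
rewrite -fsbig_seq //= sumEFin.
by under eq_bigr do rewrite -/(abse _).
Qed.

(** Summability at the corner [w] of the polydisc is the weighted bound on the coefficients. The
    boxes exhaust the multi-indices, so the limit along them is the unordered sum. *)
Lemma analytic0_of_analytic_at (m : nat) (f : 'rV[R]_m -> R) : analytic_at f 0 -> analytic0 f.
Proof.
move=> [c /nbhs0_polydisc[r [r0 h]]].
pose w : 'rV[R]_m := const_mx r.
have [C hC] : exists C, abs_bounded (fun k => c k * monomial k w) C.
  apply: summable_abs_bounded; have [|+ _] := h w; last by rewrite subr0.
  by move=> i; rewrite mxE ger0_norm // ltW.
exists r, C; split=> //; apply: (pseries_of_countable hC) => x xw.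
have hx : abs_bounded (fun k => c k * monomial k x) C.
  apply: abs_bounded_le hC => k; rewrite !normrM; apply: ler_wpM2l => //.
  by apply: le_trans (ler_norm _); exact: monomial_le.
have [s hs] := abs_bounded_sum hx; have [_] := h x xw; rewrite subr0.
pose g n (k : {ffun 'I_m -> 'I_n}) : {ffun 'I_m -> nat} := [ffun i => nat_of_ord (k i)].
pose J n := [fset k in map (@g n) (enum {ffun 'I_m -> 'I_n})]%fset.
have memJ n k : (k \in J n) = [forall i, k i < n]%N.
  rewrite inE /=; apply/mapP/forallP => [[l _ ->] i|hk]; first by rewrite ffunE.
  exists [ffun i => Ordinal (hk i)]; first by rewrite mem_enum.
  by apply/ffunP => i; rewrite !ffunE.
have g_inj n : injective (@g n).
  by move=> k l /ffunP e; apply/ffunP => i; apply: val_inj; have := e i; rewrite !ffunE.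
have boxE n : \sum_(k <- J n) c k * monomial k x =
    \sum_(k : {ffun 'I_m -> 'I_n}) c (g n k) * monomial (g n k) x.
  rewrite -[RHS]big_enum /= -(big_map (@g n) predT (fun k => c k * monomial k x)).
  apply: perm_big; apply: uniq_perm; first exact: fset_uniq.
    by rewrite map_inj_uniq ?enum_uniq //; exact: g_inj.
  by move=> k; rewrite inE.
move=> hlim; suff -> : f x = s by [].
apply/eqP; rewrite -subr_eq0 -normr_le0; apply: le0_eps => e e0.
have e20 : 0 < e / 2 by lra.
have [||n0 hn0] := @sum_to_cofinal _ _ _ _ J _ _ hs _ e20.
- move=> p q pq; apply/fsubsetP => k; rewrite !memJ => /forallP hk.
  by apply/forallP => i; apply: leq_trans pq.
- move=> k; exists (\max_i k i).+1; rewrite memJ; apply/forallP => i.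
  by rewrite ltnS; exact: (leq_bigmax i).
have /cvgrPdist_le/(_ _ e20)[n1 _ hn1] := hlim.
have := hn0 _ (leq_maxl n0 n1); have := hn1 _ (leq_maxr n0 n1).
rewrite boxE /= /g; set S := \sum_(k : _) _ => h1 h2.
have -> : f x - s = (f x - S) + (S - s) by ring.
by apply: le_trans (ler_normD _ _) _; lra.
Qed.

Lemma analytic0_of_analytic_germ (m n : nat) (F : 'rV[R]_m -> 'rV[R]_n) :
  analytic_germ F -> forall j, analytic0 (fun x => F x 0 j).
Proof. by move=> [_ h _] j; apply: analytic0_of_analytic_at; exact: nbhs_singleton (h j). Qed.

Lemma analytic0_rhoE (m : nat) : analytic0 (@rhoE R m).
Proof. by apply: analytic0_sum => i; apply: analytic0X (analytic0_coord i). Qed.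

(** * Jacobian matrices *)

Lemma differentiable_rv (m n : nat) (F : 'rV[R]_m -> 'rV[R]_n) x :
  (forall j, differentiable (fun y => F y 0 j) x) -> differentiable F x.
Proof.
move=> h; have -> : F = \sum_(j < n) (fun y => F y 0 j *: (delta_mx 0 j : 'rV[R]_n)).
  by apply/funext => y; rewrite fct_sumE -row_sum_delta.
by apply: differentiable_sum => j; exact: differentiableZl.
Qed.

Lemma near_differentiable_rv (m n : nat) (F : 'rV[R]_m -> 'rV[R]_n) :
  (forall j, analytic0 (fun x => F x 0 j)) ->
  \forall x \near (0 : 'rV[R]_m), forall j, differentiable (fun y => F y 0 j) x.
Proof.
move=> h; have H k : \forall x \near (0 : 'rV[R]_m), forall hk : (k < n)%N,
    differentiable (fun y => F y 0 (Ordinal hk)) x.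
  have [kn|kn] := pselect (k < n)%N; last by apply: near0T => x hk; case: kn.
  apply: near0W (analytic0_near_diff (h (Ordinal kn))) => x hx hk.
  by have -> : Ordinal hk = Ordinal kn by exact: val_inj.
apply: near0W (near0_forall n H) => x hx j; have := hx j (ltn_ord j) (ltn_ord j).
by have -> : Ordinal (ltn_ord j) = j by exact: val_inj.
Qed.

Lemma mul_jacobian_entry (m n : nat) (F : 'rV[R]_m -> 'rV[R]_n) x v j :
  (forall j, differentiable (fun y => F y 0 j) x) ->
  (v *m 'J F x) 0 j = 'D_v (fun y => F y 0 j) x.
Proof.
move=> h; have dF := differentiable_rv h.
rewrite -deriveEjacobian // derive_mx ?mxE //; exact: diff_derivable.
Qed.

Lemma jacobian_entry (m n : nat) (F : 'rV[R]_m -> 'rV[R]_n) x i j :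
  (forall j, differentiable (fun y => F y 0 j) x) ->
  'J F x i j = 'D_(delta_mx 0 i) (fun y => F y 0 j) x.
Proof. by move=> h; rewrite -mul_jacobian_entry // -rowE [RHS]mxE. Qed.

Lemma jacobian_comp (m n k : nat) (F : 'rV[R]_m -> 'rV[R]_n) (G : 'rV[R]_n -> 'rV[R]_k) x :
  differentiable F x -> differentiable G (F x) ->
  'J (G \o F) x = 'J F x *m 'J G (F x).
Proof.
move=> dF dG; have dGF := differentiable_comp dF dG.
apply/row_matrixP => i; rewrite row_mul !rowE -(deriveEjacobian _ dGF).
rewrite -(deriveEjacobian _ dF) -(deriveEjacobian _ dG).
by rewrite (deriveE _ dGF) (deriveE _ dF) (deriveE _ dG) diff_comp.
Qed.

(** [milnor_set F] is convertible to [Sing (jointly F)]; naming the map allows its Jacobian to be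
    computed by blocks. *)
Definition jointly (m n : nat) (F : 'rV[R]_m -> 'rV[R]_n) (x : 'rV[R]_m) : 'rV[R]_(n + 1) :=
  row_mx (F x) (rhoE x)%:M.

Lemma jointly_entry (m n : nat) (F : 'rV[R]_m -> 'rV[R]_n) (j : 'I_(n + 1)) :
  (exists j', (fun x => jointly F x 0 j) = (fun x => F x 0 j') /\ j = lshift 1 j') \/
  (fun x => jointly F x 0 j) = @rhoE R m /\ j = rshift n 0.
Proof.
rewrite /jointly; case: (split_ordP j) => k ->.
  by left; exists k; split=> //; apply/funext => x; rewrite row_mxEl.
by right; rewrite ord1; split=> //; apply/funext => x; rewrite row_mxEr mxE mulr1n.
Qed.

Definition gradient_col (m : nat) (x : 'rV[R]_m) : 'cV[R]_m :=
  \col_i 'D_(delta_mx 0 i) (@rhoE R m) x.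

Lemma jacobian_jointly (m n : nat) (F : 'rV[R]_m -> 'rV[R]_n) x :
  (forall j, differentiable (fun y => F y 0 j) x) -> differentiable (@rhoE R m) x ->
  'J (jointly F) x = row_mx ('J F x) (gradient_col x).
Proof.
move=> dF dr.
have dj j : differentiable (fun y => jointly F y 0 j) x.
  by case: (jointly_entry F j) => [[j' [-> _]]|[-> _]].
apply/matrixP => i j; rewrite (jacobian_entry _ _ dj).
case: (jointly_entry F j) => [[j' [-> ->]]|[-> ->]].
  by rewrite row_mxEl jacobian_entry.
by rewrite row_mxEr mxE.
Qed.

Lemma mul_gradient_col (m : nat) (x v : 'rV[R]_m) : differentiable (@rhoE R m) x ->
  (v *m gradient_col x) 0 0 = 'D_v (@rhoE R m) x.
Proof.
by move=> dr; rewrite mxE (derive_coord v dr); apply: eq_bigr => i _; rewrite mxE.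
Qed.

(** Existence of Lagrange multipliers, with [A] the Jacobian at a regular point and [c] the gradient
    of the squared norm. *)
Lemma rank_row_mx_lt (m k : nat) (A : 'M[R]_(m, k)) (c : 'cV[R]_m) :
  ~~ (\rank A < k)%N -> (\rank (row_mx A c) < k + 1)%N -> exists l, c = A *m l.
Proof.
rewrite -leqNgt => kA hr.
have h : (c^T <= A^T)%MS.
  have hAc : (A^T <= A^T + c^T)%MS by exact: addsmxSl.
  have le : (\rank (A^T + c^T)%MS <= \rank A^T)%N.
    rewrite addsmxE mxrank_tr -(mxrank_tr (col_mx _ _)) tr_col_mx !trmxK.
    by apply: leq_trans kA; move: hr; set r := \rank _; lia.
  have /eqmxP/eqmx_sym e : (A^T == A^T + c^T)%MS.
    by rewrite -(geq_leqif (mxrank_leqif_eq hAc)).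
  by apply: submx_trans (addsmxSr A^T c^T) _; rewrite e.
have [l hl] := submxP h; exists l^T.
by rewrite -[LHS]trmxK hl trmx_mul trmxK.
Qed.

Lemma rank_row_mx_mul (m k : nat) (A : 'M[R]_(m, k)) (l : 'cV[R]_k) :
  (\rank (row_mx A (A *m l)) < k + 1)%N.
Proof.
have -> : row_mx A (A *m l) = A *m row_mx 1%:M l by rewrite mul_mx_row mulmx1.
have := leq_trans (mxrankM_maxl A (row_mx 1%:M l)) (rank_leq_col A).
by set r := \rank _; lia.
Qed.

Lemma cvg_bigprod (T I : Type) (F : set_system T) {FF : Filter F} (r : seq I)
    (f : I -> T -> R) (a : I -> R) :
  (forall i, f i x @[x --> F] --> a i) ->
  (\prod_(i <- r) f i x) @[x --> F] --> \prod_(i <- r) a i.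
Proof.
move=> h; elim: r => [|i r IH].
  by under eq_fun do rewrite big_nil; rewrite big_nil; exact: cvg_cst.
by under eq_fun do rewrite big_cons; rewrite big_cons; exact: cvgM (h i) IH.
Qed.

Lemma cvg_det (T : Type) (F : set_system T) {FF : Filter F} (n : nat)
    (A : T -> 'M[R]_n) (B : 'M[R]_n) :
  (forall i j, A x i j @[x --> F] --> B i j) -> \det (A x) @[x --> F] --> \det B.
Proof.
move=> h; apply: cvg_bigsum => s; apply: cvgM; first exact: cvg_cst.
by apply: cvg_bigprod => i; exact: h.
Qed.

(* Full rank is an open condition: a left inverse at x keeps a nonzero determinant nearby. *)
Lemma regular_points_open (m p : nat) (F : 'rV[R]_m -> 'rV[R]_p) :
  (forall j, analytic0 (fun x => F x 0 j)) ->
  \forall x \near (0 : 'rV[R]_m), ~ Sing F x -> \forall y \near x, ~ Sing F y.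
Proof.
move=> hF.
pose A x : 'M[R]_(m, p) := \matrix_(i, j) 'D_(delta_mx 0 i) (fun y => F y 0 j) x.
have hA i j : analytic0 (fun x => A x i j).
  apply: (@analytic0_eq _ _ (fun x => 'D_(delta_mx 0 i) (fun y => F y 0 j) x)).
    by apply: analytic0_derive (hF j) _ => k; exact: analytic0_cst.
  by move=> x; rewrite mxE.
have cA : \forall x \near (0 : 'rV[R]_m), forall i j, differentiable (fun y => A y i j) x.
  have hrow i := near_differentiable_rv (F := fun y => row i (A y)).
  have hv : forall j, analytic0 (fun x => mxvec (A x) 0 j).
    by move=> j; case/mxvec_indexP: j => i j; apply: (analytic0_eq (hA i j)) => x; rewrite mxvecE.
  apply: near0W (near_differentiable_rv hv) => x h i j.
  have := h (mxvec_index i j).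
  by have -> : (fun y => mxvec (A y) 0 (mxvec_index i j)) = (fun y => A y i j)
    by apply/funext => y; rewrite mxvecE.
have JA : \forall x \near (0 : 'rV[R]_m), 'J F x = A x.
  apply: near0W (near_differentiable_rv hF) => x h.
  by apply/matrixP => i j; rewrite jacobian_entry // mxE.
apply: near0W (near0I cA (near0_near JA)) => x [dA Jx] xS.
have Jx0 : 'J F x = A x := nbhs_singleton Jx.
have full : (p <= \rank (A x))%N by rewrite -Jx0 leqNgt; apply/negP.
have /row_fullP[B BA] : row_full (A x) by rewrite /row_full eqn_leq rank_leq_col.
have cdet : \det (B *m A y) @[y --> x] --> \det (B *m A x).
  apply: (@cvg_det _ _ (nbhs_filter x)) => i j; rewrite mxE.
  under eq_fun do rewrite mxE.
  apply: (@cvg_bigsum _ _ _ _ (nbhs_filter x)) => k; apply: cvgM; first exact: cvg_cst.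
  exact: differentiable_continuous (dA k j).
have det1 : \det (B *m A x) != 0 by rewrite BA det1 oner_neq0.
have : \forall z \near \det (B *m A x), z != 0.
  exact: open_nbhs_nbhs (conj (@open_neq _ 0) det1).
move/cdet => hd; have hnear := @filterI _ _ (nbhs_filter x) _ _ hd Jx.
apply: (@filterS _ _ (nbhs_filter x)) hnear => y [/= dy Jy].
rewrite /Sing /= Jy; apply/negP; rewrite -leqNgt.
have : B *m A y \in unitmx by rewrite unitmxE unitfE.
move=> /mxrank_unit {1}<-; exact: mxrankM_maxr.
Qed.

End AnalyticGerms.

(** * Critical points of the squared norm, and the equivalence *)

Section Main.
Context {R : realType}.

Lemma rhoE_eq0 (m : nat) (x : 'rV[R]_m) : rhoE x = 0 -> x = 0.
Proof.
move/eqP; rewrite psumr_eq0 => [/allP h|i _]; last exact: sqr_ge0.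
apply/rowP => i; rewrite mxE; apply/eqP.
by have := h i (mem_index_enum i); rewrite sqrf_eq0.
Qed.

Lemma rhoE0 (m : nat) : rhoE (0 : 'rV[R]_m) = 0.
Proof. by rewrite /rhoE big1 // => i _; rewrite mxE expr0n. Qed.

(** The origin always lies in [milnor_set H], the gradient of the squared norm being zero there.
    [Sing H 0] places it in the conclusion, and contradicts a point of [A] whose squared norm is
    0. *)
Lemma regular_critical_points_isolated (m k : nat) (H : 'rV[R]_m -> 'rV[R]_k) :
  (forall j, analytic0 (fun x => H x 0 j)) -> Sing H 0 ->
  \forall x \near (0 : 'rV[R]_m), milnor_set H x -> H x = 0 -> Sing H x.
Proof.
move=> hH S0; apply: contrapT => hN.
pose A : set 'rV[R]_m := [set x | [/\ milnor_set H x, H x = 0 & ~ Sing H x]].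
have PF : ProperFilter (within A (nbhs (0 : 'rV[R]_m))).
  apply: Build_ProperFilter => hA; apply: hN.
  apply: near0W hA => x h hM h0; apply: contrapT => hS; exact: h (And3 hM h0 hS).
have [U [FU hU]] := ultraFilterLemma PF.
have U0 : finer_than_nbhs0 U.
  by move=> P hP; apply: hU; apply: near0W hP => x Px _.
have UA : U A by apply: hU; apply: near0T.
have one_U : ~ vanish U (fun=> 1).
  by apply: not_vanish; apply: filterS filterT => x _ /=; exact: oner_neq0.
have [|c hc] := constants_are_scalars_all FU U0 (analytic0_rhoE m) (analytic0_cst 1) one_U.
  move=> v [_ hv].
  have hvj : U [set x | forall j, 'D_(v x) (fun y => H y 0 j) x = 0].
    apply: (@filter_forall _ _ (fun j x => 'D_(v x) (fun y => H y 0 j) x = 0)) => j.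
    by apply: hv => //; apply: filterS UA => x [_ + _] => /= ->; rewrite mxE.
  have hd := U0 _ (near0I (near_differentiable_rv hH) (analytic0_near_diff (analytic0_rhoE m))).
  apply: filterS (filterI (filterI hvj hd) UA) => x [[/= h1 [h2 h3]] [hM _ hS]].
  have hM' : (\rank ('J (jointly H) x) < k + 1)%N := hM.
  rewrite (jacobian_jointly h2 h3) in hM'.
  have [l hl] := rank_row_mx_lt (introN idP hS) hM'.
  have vJ : v x *m 'J H x = 0.
    by apply/rowP => j; rewrite (mul_jacobian_entry _ _ h2) h1 mxE.
  rewrite -(mul_gradient_col _ h3) hl mulmxA vJ mul0mx mxE mulr0.
  by rewrite (derive_cst _ _ _) mulr0 subr0.
have c0 : c = 0.
  apply/eqP; rewrite -normr_le0; apply: le0_eps => e e0.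
  have [x [/= h1 h2]] := filter_ex (filterI hc (U0 _ (analytic0_cvg0 (analytic0_rhoE m) e0))).
  rewrite rhoE0 subr0 in h2; apply: le_trans h2.
  by move/eqP: h1; rewrite subr_eq0 mulr1 => /eqP ->.
have [x [/= h1 [_ _]]] := filter_ex (filterI hc UA); apply.
suff -> : x = 0 by [].
by apply: rhoE_eq0; move: h1; rewrite c0 mul0r subr0.
Qed.

Lemma closed_eball_polydisc (m : nat) (e : R) (x : 'rV[R]_m) : 0 <= e ->
  closed_eball e x -> polydisc (const_mx e) x.
Proof.
move=> e0 hx i; rewrite mxE -(ler_pXn2r (n := 2)) ?nnegrE // real_normK ?num_real //.
apply: le_trans hx; rewrite /rhoE (bigD1 i) //= lerDl.
by apply: sumr_ge0 => j _; exact: sqr_ge0.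
Qed.

Lemma closed_eball_compact (m : nat) (e : R) : 0 <= e ->
  compact (closed_eball e : set 'rV[R]_m).
Proof.
move=> e0; apply: bounded_closed_compact.
  exists e; split; first exact: num_real.
  move=> t et x hx; rewrite /= [leLHS]/Num.Def.normr /= mx_normrE.
  apply: bigmax_le; first by apply: le_trans e0 (ltW et).
  move=> [i j] _ /=; rewrite ord1; have := closed_eball_polydisc e0 hx j.
  by rewrite mxE => /le_trans; apply; exact: ltW.
have -> : closed_eball e = @rhoE R m @^-1` [set t | t <= e ^+ 2] by [].
apply: closed_comp; last exact: closed_le.
move=> x _; apply: (@cvg_bigsum _ _ _ _ (nbhs_filter x)) => i.
by apply: cvgM; exact: coord_continuous.
Qed.

Lemma closure_image_compact (m n : nat) (F : 'rV[R]_m -> 'rV[R]_n) (A B : set 'rV[R]_m) :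
  compact B -> A `<=` B -> (forall x, B x -> {for x, continuous F}) ->
  closure (F @` A) `<=` F @` closure A.
Proof.
move=> cB AB cF.
have clB : closed B by apply: compact_closed => //; exact: norm_hausdorff.
have cAB : closure A `<=` B.
  by apply: subset_trans (closure_subset AB) _; rewrite -((closure_id B).1 clB).
have cA : compact (closure A).
  exact: (subclosed_compact (@closed_closure _ A) cB cAB).
have cFA : compact (F @` closure A).
  apply: continuous_compact cA; apply: continuous_in_subspaceT => x.
  by rewrite inE => /cAB; exact: cF.
have clFA : closed (F @` closure A) by apply: compact_closed => //; exact: norm_hausdorff.
have sub : F @` A `<=` F @` closure A by apply: image_subset; exact: subset_closure.
by move=> y /(closure_subset sub); rewrite -((closure_id _).1 clFA).
Qed.

End Main.

Unset Implicit Arguments.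

Theorem theorem4p4 (R : realType) (M N K : nat)
    (hMN : (N <= M)%N) (hNK : (K <= N)%N) (hK : (2 <= K)%N)
    (F : 'rV[R]_M -> 'rV[R]_N) (G : 'rV[R]_N -> 'rV[R]_K)
    (F_analytic : analytic_germ F) (F_tame : tame F)
    (F_disc : isolated_critical_value F)
    (G_analytic : analytic_germ G)
    (G_sing0 : germ_subset [set 0] (Sing G))
    (G_sing : germ_subset (Sing G) (zero_locus G)) :
  \forall e \near (0 : R)^'+,
    tame (G \o F) <->
    germ_subset
      (closure (F @` ((milnor_set (G \o F) `&` closed_eball e)
                        `\` Sing (G \o F)))
         `&` Sing G)
      [set 0].
Proof.
have hF := analytic0_of_analytic_germ F_analytic; have hG := analytic0_of_analytic_germ G_analytic.
have F0 : F 0 = 0 by case: F_analytic.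
have G0 : G 0 = 0 by case: G_analytic.
set H := G \o F.
have hH j : analytic0 (fun x => H x 0 j) := analytic0_comp (hG j) hF F0.
have SG0 : Sing G 0 by exact: (nbhs_singleton G_sing0).
have dG := near0_pullback hF F0 (near_differentiable_rv hG).
have JH : \forall x \near (0 : 'rV[R]_M), 'J H x = 'J F x *m 'J G (F x).
  apply: near0W (near0I (near_differentiable_rv hF) dG) => x [dFx dGx].
  by apply: jacobian_comp; exact: differentiable_rv.
(* At a singular point of [F] the value is 0, which lies in [Sing G]; elsewhere the differential of
   [F] is onto, and composing with it keeps the rank of ['J G (F x)]. *)
have SH : \forall x \near (0 : 'rV[R]_M), Sing H x <-> Sing G (F x).
  apply: near0W (near0I JH F_disc) => x [J hx]; rewrite /Sing /= J; split=> h; last first.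
    exact: leq_ltn_trans (mxrankM_maxr _ _) h.
  case: (pselect (Sing F x)) => [/hx|/negP]; first by rewrite /zero_locus /= => ->.
  rewrite -leqNgt => full.
  have fullF : row_full ('J F x) by rewrite /row_full eqn_leq rank_leq_col.
  by rewrite (eqmxMfull _ fullF) in h.
have SV : \forall x \near (0 : 'rV[R]_M), Sing H x -> H x = 0.
  by apply: near0W (near0I SH (near0_pullback hF F0 G_sing)) => x [h1 h2] /h1/h2.
have SH0 : Sing H 0 by apply: (nbhs_singleton SH).2; rewrite F0.
(* Multipliers [l] for [H] give the multipliers ['J G (F x) *m l] for [F]. *)
have MM : \forall x \near (0 : 'rV[R]_M), milnor_set H x -> ~ Sing H x -> milnor_set F x.
  apply: near0W (near0I (near0I JH (near_differentiable_rv hF))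
    (near0I (near_differentiable_rv hH) (analytic0_near_diff (analytic0_rhoE M)))).
  move=> x [[J dF] [dH dr]] hM hS.
  have hM' : (\rank ('J (jointly H) x) < K + 1)%N := hM.
  rewrite (jacobian_jointly dH dr) in hM'.
  have [l hl] := rank_row_mx_lt (introN idP hS) hM'.
  change (\rank ('J (jointly F) x) < N + 1)%N.
  by rewrite (jacobian_jointly dF dr) hl J -mulmxA; exact: rank_row_mx_mul.
have CP := regular_critical_points_isolated hH SH0.
have hHr j : analytic0 (fun x => jointly H x 0 j).
  by case: (jointly_entry H j) => [[j' [-> _]]|[-> _]]; [exact: hH|exact: analytic0_rhoE].
have OP := regular_points_open hHr.
have cF : \forall x \near (0 : 'rV[R]_M), {for x, continuous F}.
  apply: near0W (near_differentiable_rv hF) => x dFx.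
  exact/differentiable_continuous/differentiable_rv.
(* The radius [r] is chosen before the equivalence is split, while tameness of [H] is available in
   one direction only; it is therefore kept as a premise. *)
have TH : \forall x \near (0 : 'rV[R]_M), tame H ->
    (closure (milnor_set H `\` zero_locus H) `&` zero_locus H) x -> x = 0.
  have [tH|ntH] := pselect (tame H); last by apply: near0T => x /ntH.
  by apply: near0W (tH : \forall x \near (0 : 'rV[R]_M), _) => x h _ /h.
have [r [r0 hr]] := iffLR (nbhs0_polydisc _)
  (near0I (near0I (near0I SH SV) (near0I CP cF)) TH).
near=> e.
have e0 : 0 < e by near: e; exact: nbhs_right_gt.
have er : e < r by near: e; exact: nbhs_right_lt.
have ball_facts (x : 'rV[R]_M) : closed_eball e x -> polydisc (const_mx r) x.
  move=> /(closed_eball_polydisc (ltW e0)); apply: polydisc_const_le; exact: ltW.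
split=> [tH|hR].
  apply: near0T => y [hy ySG].
  (* Compactness of the ball lifts [y] to a point [x] of the closure upstairs, to which tameness of
     [H] applies. *)
  have [x xcl xy] : (F @` closure ((milnor_set H `&` closed_eball e) `\` Sing H)) y.
    apply: (closure_image_compact (closed_eball_compact (ltW e0))) hy.
      by move=> x [[]].
    by move=> x /ball_facts/hr [[_ [_ ?]] _].
  have xB : closed_eball e x.
    have clB := compact_closed (@norm_hausdorff _ _) (closed_eball_compact (m := M) (ltW e0)).
    rewrite ((closure_id _).1 clB); apply: closure_subset xcl.
    by move=> z [[]].
  have [[[SHx SVx] _] THx] := hr x (ball_facts x xB).
  have x0 : x = 0.
    (* Inside the ball, [CP] keeps Milnor points outside [Sing H] away from the zero locus of
       [H]. *)
    have sub : (milnor_set H `&` closed_eball e) `\` Sing H `<=`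
        milnor_set H `\` zero_locus H.
      move=> z [[zM zB] zS]; split; first exact: zM.
      by move=> zV; apply: zS; have [[_ [CPz _]] _] := hr z (ball_facts z zB); exact: CPz zM zV.
    apply: THx tH _; split; first exact: closure_subset sub _ xcl.
    by apply: SVx; apply/SHx; rewrite xy.
  by rewrite -xy x0 F0.
(* Points close enough to 0 are approached from inside the ball, so the restriction to it in [hR] is
   no loss. *)
have eB : \forall x \near (0 : 'rV[R]_M), closed_eball e x.
  have e20 : 0 < e ^+ 2 by rewrite exprn_gt0.
  apply: near0W (analytic0_cvg0 (analytic0_rhoE M) e20) => x; rewrite rhoE0 subr0 => h.
  exact: le_trans (ler_norm _) h.
have hR' := near0_pullback hF F0 hR.
apply: near0W (near0I (near0I (near0_near (near0I (near0I SV MM) eB)) (near0I SH (near0I CP cF)))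
  (near0I (near0I hR' F_tame) OP)).
move=> x [[nx [SHx [CPx cFx]]] [[hRx tFx] OPx]] [xcl xV].
(* If [F x = 0]: the approximating points [z] have [H z != 0], so they avoid [Sing H] and the zero
   locus of [F], and lie in [milnor_set F]; tameness of [F] concludes. *)
have [Fx0|Fx0] := pselect (F x = 0).
  apply: tFx; split=> // B hB.
  have [z [[zM zV] [zB [[SVz MMz] _]]]] := xcl _ (@filterI _ _ (nbhs_filter x) _ _ hB nx).
  exists z; split=> //; split; first by apply: MMz => // /SVz.
  by move=> Fz; apply: zV; rewrite /zero_locus /= /H /= Fz.
(* Over [Sing G]: the images of the approximating points tend to [F x], and [hRx] forces
   [F x = 0]. *)
have [SGx|SGx] := pselect (Sing G (F x)).
  case: Fx0; apply: hRx; split=> // B hB.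
  have hB' : nbhs x (F @^-1` B) := cFx _ hB.
  have [z [[zM zV] [zB [[SVz MMz] ze]]]] := xcl _ (@filterI _ _ (nbhs_filter x) _ _ hB' nx).
  exists (F z); split=> //; exists z => //; split=> // /SVz; exact: zV.
have SHx' : ~ Sing H x by move=> /SHx.
(* Otherwise [x] is outside the Milnor set, hence by [OPx] outside its closure. *)
have MHx : ~ milnor_set H x by move=> /CPx /(_ xV).
have [z [[zM _] zn]] := xcl _ (OPx MHx).
by case: zn.
Unshelve. all: by end_near.
Qed.
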